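(* Let $G$ be a locally elliptic group, $(K_i)_{i\in\mathbb{N}}$ a standard decomposition of $G$, $(\Phi,\Psi)$ a complementary pair of Young functions and $\omega$ a weight on $G$. Let $\mu$ be the Haar measure on $G$ with $\mu(K_1)=1$ and $a_i:=\sup\{\omega(x):x\in K_i\}$. Then the weight $$\omega^\sharp_1:=(a_1+1)\chi_{K_1}+\sum_{i=2}^\infty(a_i+i^2)\,\mu(K_i\setminus K_{i-1})\,\chi_{K_i\setminus K_{i-1}}$$ is an $L^\Phi$-weight.
   Context: Locally elliptic groups: a locally compact group $G$ is locally elliptic if every compact subset of $G$ generates a relatively compact subgroup. By the paper's standing convention, such a $G$ is non-compact and is a countable increasing union of compact open subgroups. Such groups are unimodular; integration is with respect to a Haar measure. A standard decomposition of $G$ is a sequence $(K_i)_{i\in\mathbb{N}}$ of compact open subgroups with $K_i\le K_{i+1}$, $G=\bigcup_iK_i$, and $([K_{i+1}:K_i])_{i\ge1}$ non-decreasing. $\chi_U$ is the characteristic function of $U$. Young functions: a Young function is a convex even function $\Phi:\mathbb{R}\to[0,\infty]$ with $\Phi(0)=0$ and $\lim_{x\to\infty}\Phi(x)=+\infty$. Its complementary Young function is $\Psi(y)=\sup\{x|y|-\Phi(x):x\ge0\}$, and $(\Phi,\Psi)$ is then called a complementary pair. Orlicz spaces: $L^\Phi(G)$ is the space of measurable $f:G\to\mathbb{C}$ (modulo a.e. equality) with $\int_G\Phi(\alpha|f|)\,dx<\infty$ for some $\alpha>0$, with norm $\|f\|_{L^\Phi(G)}=\sup\{\int_G|fg|\,dx:\int_G\Psi(|g|)\,dx\le1\}$.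 Weights: a weight on $G$ is a measurable function $\omega:G\to[1,\infty)$ that is bounded on compact sets, satisfies $\omega(xy)\le\omega(x)\omega(y)$ and $\omega(x)=\omega(x^{-1})$. $L^\Phi(G,\omega)=\{f\in L^\Phi(G):\|f\omega\|_{L^\Phi(G)}<\infty\}$ with norm $\|f\omega\|_{L^\Phi(G)}$. $\omega$ is an $L^\Phi$-weight if $L^\Phi(G,\omega)$ is a Banach $*$-algebra under convolution and the involution $f^*(x)=\overline{f(x^{-1})}$ (the norm being submultiplicative possibly only up to a constant, i.e. after passing to an equivalent norm). *)

(* Defs.v *)
From HB Require Import structures.
From mathcomp Require Import all_boot all_order all_algebra.
From mathcomp Require Import all_classical all_reals all_analysis.
From mathcomp Require Import finmap complex.

Set Implicit Arguments.
Unset Strict Implicit.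
Unset Printing Implicit Defensive.

Import Order.TTheory GRing.Theory Num.Theory.
Import numFieldTopology.Exports numFieldNormedType.Exports.

Local Open Scope classical_set_scope.
Local Open Scope ring_scope.

(* The base point is required by [g_sigma_algebraType] only; it plays no role
   and need not be the identity. *)
HB.mixin Record PointedTopological_isTopologicalGroup G
    of PointedTopological G & Group G := {
  mulg_continuous : continuous (fun x : G * G => (x.1 * x.2)%g) ;
  invg_continuous : continuous (fun x : G => (x^-1)%g)
}.

#[short(type="topologicalGroupType")]
HB.structure Definition TopologicalGroup :=
  {G of PointedTopological G & Group G
      & PointedTopological_isTopologicalGroup G}.

Notation borel G := (g_sigma_algebraType (@open G)).

Section LocallyEllipticGroups.
Context (G : topologicalGroupType).
Implicit Types (H L A C : set G) (x y : G).

Definition subgroup H :=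
  [/\ H 1%g, forall x y, H x -> H y -> H (x * y)%g & forall x, H x -> H x^-1%g].

Definition left_coset x A : set G := [set (x * y)%g | y in A].

(* [fset_set] is meaningful only on finite sets, so this is [H : L] only when
   that index is finite; this holds for compact [H] and open [L <= H]. *)
Definition subgroup_index H L : nat :=
  (#|` fset_set [set left_coset x L | x in H]|)%fset.

Definition generated_subgroup A := smallest subgroup A.

Definition compact_open_subgroup H := [/\ subgroup H, compact H & open H].

Record locally_elliptic : Prop := LocallyElliptic {
  le_hausdorff : hausdorff_space G ;
  le_locally_compact : locally_compact [set: G] ;
  le_generated : forall C, compact C -> precompact (generated_subgroup C) ;
  le_noncompact : ~ compact [set: G] ;
  le_union : exists U : nat -> set G,
    [/\ forall i, compact_open_subgroup (U i),
        forall i, U i `<=` U i.+1 &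
        \bigcup_i U i = [set: G]]
}.

(* The sequence starts at [K 1]; the value [K 0] is unconstrained. *)
Record standard_decomposition (K : nat -> set G) : Prop :=
    StandardDecomposition {
  sd_subgroup : forall i, (1 <= i)%N -> compact_open_subgroup (K i) ;
  sd_incr : forall i, (1 <= i)%N -> K i `<=` K i.+1 ;
  sd_union : \bigcup_(i in [set i | (1 <= i)%N]) K i = [set: G] ;
  sd_index : forall i, (1 <= i)%N ->
    (subgroup_index (K i.+1) (K i) <= subgroup_index (K i.+2) (K i.+1))%N
}.

End LocallyEllipticGroups.

(* Left Haar measure: a nonzero left-invariant Radon measure on the Borel
   sigma-algebra. *)
Record haar_measure (R : realType) (G : topologicalGroupType)
    (mu : {measure set (borel G) -> \bar R}) : Prop := HaarMeasure {
  haar_left_invariant : forall (x : G) (A : set (borel G)),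
    measurable A -> mu (left_coset x A) = mu A ;
  haar_compact_lty : forall C : set G, compact C -> (mu C < +oo)%E ;
  haar_outer_regular : forall A : set (borel G), measurable A ->
    mu A = ereal_inf [set mu U | U in [set U : set G | open U /\ A `<=` U]] ;
  haar_inner_regular : forall U : set G, open U ->
    mu U = ereal_sup [set mu C | C in [set C : set G | compact C /\ C `<=` U]] ;
  haar_neq0 : mu [set: G] != 0%E
}.

Section YoungFunctions.
Context {R : realType}.
Implicit Types Phi Psi : R -> \bar R.

(* With the convention [0 * +oo = 0], the convexity inequality is trivial at
   [t = 0] and [t = 1] also where [Phi] is infinite. *)
Record young_function Phi : Prop := YoungFunction {
  young_ge0 : forall x, (0 <= Phi x)%E ;
  young_convex : forall t x y : R, 0 <= t <= 1 ->
    (Phi (t * x + (1 - t) * y)%R <= t%:E * Phi x + (1 - t)%:E * Phi y)%E ;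
  young_even : forall x, Phi (- x) = Phi x ;
  young_0 : Phi 0 = 0%E ;
  young_lim : Phi x @[x --> +oo%R] --> +oo%E
}.

Definition complementary_function Phi (y : R) : \bar R :=
  ereal_sup [set ((x * `|y|)%:E - Phi x)%E | x in [set x : R | 0 <= x]].

Definition complementary_pair Phi Psi :=
  young_function Phi /\ (forall y, Psi y = complementary_function Phi y).

End YoungFunctions.

Definition cabs (R : realType) (z : R[i]) : R := ComplexField.Normc.normc z.

Section ComplexFunctions.
Context {R : realType} {G : topologicalGroupType}.
Variable mu : {measure set (borel G) -> \bar R}.
Implicit Types f g : G -> R[i].

Definition cmeasurable f :=
  measurable_fun [set: borel G] (fun x : borel G => complex.Re (f x)) /\
  measurable_fun [set: borel G] (fun x : borel G => complex.Im (f x)).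

Definition cintegrable f :=
  mu.-integrable [set: borel G] (fun x : borel G => (complex.Re (f x))%:E) /\
  mu.-integrable [set: borel G] (fun x : borel G => (complex.Im (f x))%:E).

Definition cintegral f : R[i] :=
  Complex (Rintegral mu [set: borel G] (fun x : borel G => complex.Re (f x)))
          (Rintegral mu [set: borel G] (fun x : borel G => complex.Im (f x))).

Definition convolution f g : G -> R[i] :=
  fun x => cintegral (fun y => f y * g (y^-1 * x)%g).

Definition involution f : G -> R[i] := fun x => conjc (f x^-1%g).

Definition ae_equal f g := \forall x \ae mu, f x = g x.

End ComplexFunctions.

Section OrliczSpaces.
Context {R : realType} {G : topologicalGroupType}.
Variables (mu : {measure set (borel G) -> \bar R}) (Phi Psi : R -> \bar R).
Implicit Types (f g : G -> R[i]) (w : G -> R).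

Definition orlicz_space : set (G -> R[i]) :=
  [set f | cmeasurable f /\
    exists2 alpha : R, 0 < alpha &
      (\int[mu]_(x in [set: borel G]) Phi (alpha * cabs (f x))%R < +oo)%E].

Definition orlicz_norm f : \bar R :=
  ereal_sup [set (\int[mu]_(x in [set: borel G]) (cabs (f x * g x))%:E)%E
            | g in [set g | cmeasurable g /\
                (\int[mu]_(x in [set: borel G]) Psi (cabs (g x)) <= 1)%E]].

Definition weighted_norm w f : \bar R :=
  orlicz_norm (fun x => f x * (w x)%:C%C).

Definition weighted_orlicz_space w : set (G -> R[i]) :=
  [set f | orlicz_space f /\ (weighted_norm w f < +oo)%E].

End OrliczSpaces.

(* The quotient of [S] by [eqv], with operations and norm induced from those
   given on [V], is a complex Banach *-algebra whose norm is submultiplicative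
   up to a constant. [S] consists of functions and [eqv] is equality almost
   everywhere in the application below. *)
Record banach_star_algebra_mod (R : realType) (V : lmodType R[i]) (S : set V)
    (eqv : V -> V -> Prop) (norm : V -> \bar R) (mul : V -> V -> V)
    (star : V -> V) : Prop := BanachStarAlgebraMod {
  bsa_refl : forall f, S f -> eqv f f ;
  bsa_sym : forall f g, S f -> S g -> eqv f g -> eqv g f ;
  bsa_trans : forall f g h, S f -> S g -> S h ->
    eqv f g -> eqv g h -> eqv f h ;
  bsa_0 : S 0 ;
  bsa_add : forall f g, S f -> S g -> S (f + g) ;
  bsa_scale : forall (a : R[i]) f, S f -> S (a *: f) ;
  bsa_mul : forall f g, S f -> S g -> S (mul f g) ;
  bsa_star : forall f, S f -> S (star f) ;
  bsa_add_eqv : forall f f' g g', S f -> S f' -> S g -> S g' ->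
    eqv f f' -> eqv g g' -> eqv (f + g) (f' + g') ;
  bsa_scale_eqv : forall (a : R[i]) f f', S f -> S f' ->
    eqv f f' -> eqv (a *: f) (a *: f') ;
  bsa_mul_eqv : forall f f' g g', S f -> S f' -> S g -> S g' ->
    eqv f f' -> eqv g g' -> eqv (mul f g) (mul f' g') ;
  bsa_star_eqv : forall f f', S f -> S f' ->
    eqv f f' -> eqv (star f) (star f') ;
  bsa_norm_eqv : forall f f', S f -> S f' -> eqv f f' -> norm f = norm f' ;
  bsa_norm_fin : forall f, S f -> norm f \is a fin_num ;
  bsa_norm_ge0 : forall f, S f -> (0 <= norm f)%E ;
  bsa_norm_eq0 : forall f, S f -> norm f = 0%E -> eqv f 0 ;
  bsa_normD : forall f g, S f -> S g -> (norm (f + g)%R <= norm f + norm g)%E ;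
  bsa_normZ : forall (a : R[i]) f, S f ->
    norm (a *: f) = ((cabs a)%:E * norm f)%E ;
  bsa_complete : forall u : nat -> V, (forall n, S (u n)) ->
    (forall e : R, 0 < e -> exists N, forall m n, (N <= m)%N -> (N <= n)%N ->
      (norm (u m - u n)%R < e%:E)%E) ->
    exists2 f, S f & norm (u n - f) @[n --> \oo] --> 0%E ;
  bsa_mulA : forall f g h, S f -> S g -> S h ->
    eqv (mul f (mul g h)) (mul (mul f g) h) ;
  bsa_mul_linearl : forall (a : R[i]) f g h, S f -> S g -> S h ->
    eqv (mul (a *: f + g) h) (a *: mul f h + mul g h) ;
  bsa_mul_linearr : forall (a : R[i]) f g h, S f -> S g -> S h ->
    eqv (mul h (a *: f + g)) (a *: mul h f + mul h g) ;
  bsa_normM : exists c : R, forall f g, S f -> S g ->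
    (norm (mul f g) <= c%:E * (norm f * norm g))%E ;
  bsa_star_semilinear : forall (a : R[i]) f g, S f -> S g ->
    eqv (star (a *: f + g)) (conjc a *: star f + star g) ;
  bsa_starK : forall f, S f -> eqv (star (star f)) f ;
  bsa_starM : forall f g, S f -> S g ->
    eqv (star (mul f g)) (mul (star g) (star f)) ;
  bsa_norm_star : forall f, S f -> norm (star f) = norm f
}.

Record weight (R : realType) (G : topologicalGroupType) (w : G -> R) : Prop :=
    Weight {
  weight_measurable : measurable_fun [set: borel G] (w : borel G -> R) ;
  weight_ge1 : forall x, 1 <= w x ;
  weight_bounded : forall C : set G, compact C ->
    exists M : R, forall x, C x -> w x <= M ;
  weight_submul : forall x y, w (x * y)%g <= w x * w y ;
  weight_inv : forall x, w x = w x^-1%g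
}.

(* [convolution] is a total function with a junk value where its integrand is
   not integrable; [lw_conv_ae] says that this happens only on a null set. *)
Record lphi_weight (R : realType) (G : topologicalGroupType)
    (mu : {measure set (borel G) -> \bar R}) (Phi Psi : R -> \bar R)
    (w : G -> R) : Prop := LphiWeight {
  lw_weight : weight w ;
  lw_conv_ae : forall f g, weighted_orlicz_space mu Phi Psi w f ->
    weighted_orlicz_space mu Phi Psi w g ->
    \forall x \ae mu, cintegrable mu (fun y : G => f y * g (y^-1 * x)%g) ;
  lw_algebra :
    banach_star_algebra_mod (weighted_orlicz_space mu Phi Psi w)
      (ae_equal mu) (weighted_norm mu Psi w) (convolution mu) (@involution R G)
}.

Section SharpWeight.
Context {R : realType} {G : topologicalGroupType}.
Variables (mu : {measure set (borel G) -> \bar R}) (K : nat -> set G).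
Variable w : G -> R.

Definition weight_sup (i : nat) : R := sup [set w x | x in K i].

(* At each point at most one term of the series is nonzero. *)
Definition sharp_weight : G -> R := fun x =>
  (weight_sup 1 + 1) * \1_(K 1%N) x +
  limn (fun n => \sum_(2 <= i < n) (weight_sup i + i%:R ^+ 2) *
    fine (mu (K i `\` K i.-1)) * \1_(K i `\` K i.-1) x).

End SharpWeight.

(* Main.v *)
From HB Require Import structures.
Require Import Defs.
From mathcomp Require Import finmap.
From mathcomp Require Import all_boot all_order all_algebra.
From mathcomp Require Import all_classical all_reals all_analysis.
From mathcomp Require Import measurable_realfun complex ring lra.

Set Implicit Arguments.
Unset Strict Implicit.
Unset Printing Implicit Defensive.

Import Order.TTheory GRing.Theory Num.Theory.
Import numFieldTopology.Exports numFieldNormedType.Exports.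

Local Open Scope classical_set_scope.
Local Open Scope ring_scope.

(** Let W be the sharp weight.  On the annulus K_i \ K_(i-1) it is the constant
    (a_i + i^2) mu(K_i \ K_(i-1)), and on the nonempty annuli these constants
    increase with i: such an annulus contains a coset of K_(i-1), hence has at
    least the mass of K_(i-1) and of every earlier annulus.  This has two
    consequences.

    First, W(xy) <= max(W x, W y), because the K_i are subgroups
    ([sharp_weight_max]); in particular W is subadditive.  Secondly, 1/W is
    integrable: the factor mu(K_i \ K_(i-1)) cancels in its integral over the
    annulus, which leaves at most 1/i^2 ([sharp_weight_integrable]).

    Every weight W that is subadditive and has an integrable inverse is an
    L^Phi-weight ([integrable_inverse_lphi_weight]).  The reasons are these.

    - Psi is finite near 0 and Psi(t y) <= t Psi(y) for 0 <= t <= 1, so a small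
      multiple of 1/W is a test function in the supremum that defines the Orlicz
      norm.  Thus the L^1-norm is at most a multiple of the weighted norm
      ([integral_le_weighted_norm]).  So the weighted norm is definite, all
      convolutions exist almost everywhere, and a fast Cauchy sequence converges
      almost everywhere; completeness follows by Fatou's lemma
      ([weighted_complete]).
    - Subadditivity gives |f * g| W <= |f W| * |g| + |f| * |g W| up to a
      constant.  The Orlicz norm is invariant under left and right translations,
      so that each term has norm at most the L^1-norm of one factor times the
      weighted norm of the other ([weighted_norm_convolution]).
    - A measurable function of finite Orlicz norm lies in the Orlicz space
      ([orlicz_norm_modular]).  This rests on Psi(c / z) <= c for
      0 <= c <= Phi(z), which makes Phi(a|f|) / (a|f|), suitably truncated, a
      test function ([conjugate_slope], [conjugate_duality]).

    Convolution needs the theorems of Tonelli and Fubini on G x G.  The group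
    need not be second countable, so the Borel sigma-algebra of G x G can be
    larger than the product of the Borel sigma-algebras, and the theorems about
    product measures do not apply directly.  Inner regularity helps: an open set
    U contains a countable union of measurable rectangles which fills almost
    every section of U up to a null set ([dense_rects]).  This yields Tonelli's
    theorem for open sets, then for Borel sets in a box by Dynkin's lemma, then
    for nonnegative Borel functions ([tonelli_borel]).  Together with left
    invariance it shows that the Haar measure is invariant under inversion, and
    so under right translations ([preserving_inv], [preserving_mulr]). *)

(* Makes [X * Y] a pointed topological space, so that [borel (X * Y)] is defined. *)
HB.saturate prod.

(** * Borel sets *)

Section Borel.

Lemma borel_open (X : ptopologicalType) (U : set X) :
  open U -> measurable (U : set (borel X)).
Proof. by move=> oU; exact: sub_sigma_algebra. Qed.

Lemma borel_closed (X : ptopologicalType) (U : set X) :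
  closed U -> measurable (U : set (borel X)).
Proof.
by move=> cU; rewrite -(setCK U); apply: measurableC; apply: borel_open;
  rewrite openC.
Qed.

Lemma borel_compact (X : ptopologicalType) (U : set X) :
  hausdorff_space X -> compact U -> measurable (U : set (borel X)).
Proof. by move=> hX cU; apply: borel_closed; exact: compact_closed. Qed.

Lemma borel_continuous (X Y : ptopologicalType) (f : X -> Y) :
  continuous f -> measurable_fun [set: borel X] (f : borel X -> borel Y).
Proof.
move=> /continuousP cf.
apply: (@measurability _ _ (borel X) (borel Y) _ _ (@open Y)) => //.
by move=> _ [U oU <-]; rewrite setTI; apply: borel_open; exact: cf.
Qed.

End Borel.

Lemma le_mu d (T : measurableType d) (R : realType)
    (mu : {measure set T -> \bar R}) (A B : set T) :
  measurable A -> measurable B -> A `<=` B -> (mu A <= mu B)%E.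
Proof. by move=> mA mB; apply: le_measure; exact: mem_set. Qed.

(** * Countably many rectangles almost fill an open set *)

Definition inner_regular_on_opens (R : realType) (X : ptopologicalType)
    (mu : set (borel X) -> \bar R) :=
  forall U : set X, open U ->
    mu U = ereal_sup [set mu C | C in [set C : set X | compact C /\ C `<=` U]].

Section Sections.
Local Open Scope ereal_scope.
Context (R : realType) (X Y : ptopologicalType).
Variable nu : {measure set (borel Y) -> \bar R}.
Hypothesis hY : hausdorff_space Y.
Hypothesis nu_inner : inner_regular_on_opens nu.

Definition xsec (T1 T2 : Type) (E : set (T1 * T2)) (x : T1) : set T2 :=
  [set y | E (x, y)].

Lemma continuous_pair1 (x : X) : continuous (fun y : Y => (x, y)).
Proof.
by move=> y; apply: cvg_pair => //=; exact: cvg_cst.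
Qed.

Lemma measurable_xsec (E : set (borel (X * Y)%type)) x :
  measurable E -> measurable (xsec E x : set (borel Y)).
Proof.
move=> mE; rewrite -[xsec _ _]setTI.
exact: (borel_continuous (@continuous_pair1 x) measurableT mE).
Qed.

Lemma open_xsec (E : set (X * Y)) x : open E -> open (xsec E x).
Proof. by move=> oE; have /continuousP := @continuous_pair1 x; exact. Qed.

Lemma tube (U : set (X * Y)) (C : set Y) x : open U -> compact C ->
  C `<=` xsec U x -> \forall x' \near x, C `<=` xsec U x'.
Proof.
move=> oU /compact_near_coveringP cC CU.
have := cC X (nbhs x) (fun x' y => U (x', y)) _; apply => y Cy.
have : nbhs (x, y) U by apply: open_nbhs_nbhs; split => //; exact: CU.
move=> [[A B] /= [xA yB] AB]; exists (B, A) => //=.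
by move=> [y' x'] /= [By' Ax']; exact: AB.
Qed.

(** The measure of the sections of an open set is lower semicontinuous: a
    compact subset of one section lies in all neighbouring sections. *)
Lemma open_lt_measure_xsec (U : set (X * Y)) (c : \bar R) : open U ->
  open [set x | c < nu (xsec U x)].
Proof.
move=> oU; rewrite openE => x /=.
rewrite nu_inner; last exact: open_xsec.
move=> /ereal_sup_gt[_ [C [cC CU] <-] cC'].
rewrite /interior; near=> x' => /=; apply: (lt_le_trans cC').
apply: le_mu.
- exact: (borel_compact hY cC).
- by apply: borel_open; exact: open_xsec.
- by near: x'; exact: tube.
Unshelve. all: by end_near. Qed.

(** Every point of [C] has a neighbourhood [V] and a compact [D] of measure more
    than [c] with [V `*` D `<=` U]; finitely many such rectangles suffice. *)
Lemma finite_rects (U : set (X * Y)) (C : set X) (c : \bar R) : open U ->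
  compact C -> (forall x, C x -> c < nu (xsec U x)) ->
  exists W : set (borel X * borel Y), [/\ measurable W, W `<=` U &
    forall x, C x -> c < nu (xsec W x)].
Proof.
move=> oU cC CU.
have rect x : C x -> exists V : set X * set Y,
    [/\ open V.1, compact V.2, V.1 x, V.1 `*` V.2 `<=` U & c < nu V.2].
  move=> Cx; have := CU _ Cx; rewrite nu_inner; last exact: open_xsec.
  move=> /ereal_sup_gt[_ [D [cD DU] <-] cD'].
  exists (interior [set x' : X | D `<=` xsec U x'], D); split => //=.
  - exact: open_interior.
  - exact: tube.
  - by move=> [x' y] /= [/interior_subset /= DU' /DU'].
have /choice[V HV] : forall x, exists V : set X * set Y, C x ->
    [/\ open V.1, compact V.2, V.1 x, V.1 `*` V.2 `<=` U & c < nu V.2].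
  move=> x; have [/rect[V HV]|nCx] := pselect (C x); first by exists V.
  by exists point.
move: cC; rewrite compact_cover => /(_ X C (fun x => (V x).1))[].
- by move=> x /HV[].
- by move=> x Cx; exists x => //; have [] := HV _ Cx.
move=> D DC CD.
have mW : measurable
    (\bigcup_(x in [set` D]) ((V x).1 `*` (V x).2) : set (borel X * borel Y)).
  apply: fin_bigcup_measurable => // x /DC/set_mem/HV[? ? _ _ _].
  by apply: measurableX; [exact: borel_open|exact: (borel_compact hY)].
exists (\bigcup_(x in [set` D]) ((V x).1 `*` (V x).2)); split => //.
- by move=> p [x /DC/set_mem/HV[_ _ _ + _]]; exact.
- move=> x Cx; have [x0 x0D Vx] := CD _ Cx.
  have /set_mem/HV[oV1 oV2 _ _ /lt_le_trans] := DC _ x0D; apply.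
  apply: le_mu.
  + exact: (borel_compact hY).
  + rewrite -[xsec _ _]setTI.
    exact: (@pair1_measurable _ _ (borel X) (borel Y) x measurableT _ mW).
  + by move=> y Vy; exists x0.
Qed.

End Sections.

Section Exhaustion.
Local Open Scope ereal_scope.
Context (R : realType) (X : ptopologicalType).
Variable mu : {measure set (borel X) -> \bar R}.
Hypothesis hX : hausdorff_space X.
Hypothesis mu_inner : inner_regular_on_opens mu.

(** Being open of finite measure, [O] is a countable union of compact sets up to a
    null set, although it need not be sigma-compact. *)
Lemma compact_exhaustion (O : set X) : open O -> mu O < +oo ->
  exists C : nat -> set X, (forall n, compact (C n) /\ C n `<=` O) /\
    mu (O `\` \bigcup_n C n) = 0.
Proof.
move=> oO muO.
have fO : mu O \is a fin_num by rewrite ge0_fin_numE.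
have /choice[C HC] : forall n : nat, exists C : set X,
    [/\ compact C, C `<=` O & mu O < mu C + (n.+1%:R^-1)%:E].
  move=> n.
  have : mu O - (n.+1%:R^-1)%:E < mu O by rewrite lteBlDr// lteDl// lte_fin.
  rewrite {2}mu_inner// => /ereal_sup_gt[_ [C [cC CO] <-]].
  by rewrite lteBlDr// => ?; exists C.
exists C; split; first by move=> n; have [] := HC n.
have mC n : measurable (C n : set (borel X)).
  by apply: (borel_compact hX); have [] := HC n.
have mO := borel_open oO.
have mU : measurable (\bigcup_n C n : set (borel X)) by exact: bigcupT_measurable.
apply/eqP; rewrite eq_le measure_ge0 andbT; apply/lee_addgt0Pr => e e0.
rewrite add0e; have [n ne] : exists n, (n.+1%:R^-1 < e)%R.
  by have [n _ /(_ n (leqnn n)) /=] := near_infty_natSinv_lt (PosNum e0); exists n.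
have [_ CO Cn] := HC n.
apply: (@le_trans _ _ (mu (O `\` C n))).
  apply: le_mu; [exact: measurableD|exact: measurableD|].
  by apply: setDS; exact: bigcup_sup.
rewrite measureD// setIidr// leeBlDr; last first.
  by rewrite ge0_fin_numE// (le_lt_trans _ muO)// le_mu.
rewrite addeC; apply/ltW/(lt_le_trans Cn); rewrite leeD2l// lee_fin.
exact: ltW.
Qed.

End Exhaustion.

(** Rationals are numbered by [unpickle], which makes the parameter of the later
    countable union a natural number. *)
Lemma ereal_rat_between (R : realType) (a b : \bar R) : (0 <= a)%E ->
  (a < b)%E -> exists m,
    (a <= (ratr (odflt 0 (unpickle m : option rat)) : R)%:E < b)%E.
Proof.
move=> a0 ab.
suff [q qab] : exists q : rat, (a <= (ratr q : R)%:E < b)%E.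
  by exists (pickle q); rewrite pickleK.
case: a b ab a0 => [a| |] [b| |] //.
  rewrite lte_fin => ab _; have [q] := rat_in_itvoo ab.
  by rewrite in_itv/= => /andP[aq qb]; exists q; rewrite lee_fin lte_fin ltW.
move=> _ _; have [q] : exists q, ratr q \in `]a, (a + 1)[.
  by apply: rat_in_itvoo; rewrite ltrDl.
by rewrite in_itv/= => /andP[aq qb]; exists q; rewrite lee_fin ltry ltW.
Qed.

Section OpenTonelli.
Local Open Scope ereal_scope.
Context (R : realType) (X Y : ptopologicalType).
Variable mu : {sigma_finite_measure set (borel X) -> \bar R}.
Variable nu : {sigma_finite_measure set (borel Y) -> \bar R}.
Hypothesis hX : hausdorff_space X.
Hypothesis hY : hausdorff_space Y.
Hypothesis mu_inner : inner_regular_on_opens mu.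
Hypothesis nu_inner : inner_regular_on_opens nu.
Variable A : nat -> set X.
Hypothesis oA : forall n, open (A n).
Hypothesis finA : forall n, mu (A n) < +oo.
Hypothesis covA : \bigcup_n A n = setT.

(** For each rational [r] the open set of the [x] with [r < nu (xsec U x)] is
    exhausted by compact sets up to a null set, and over each of these finitely
    many rectangles in [U] have sections of measure more than [r].  Off the
    countably many null sets, the union of all these rectangles then has sections
    of measure at least that of the sections of [U]. *)
Lemma dense_rects (U : set (X * Y)) : open U ->
  exists W : set (borel X * borel Y), [/\ measurable W, W `<=` U &
    {ae mu, forall x, nu (xsec U x) <= nu (xsec W x)}].
Proof.
move=> oU.
pose r (m : nat) : R := ratr (odflt 0%R (unpickle m : option rat)).
pose O m : set X := [set x | (r m)%:E < nu (xsec U x)].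
have oO m : open (O m) by exact: open_lt_measure_xsec.
have oOA m k : open (O m `&` A k) by exact: openI.
have fOA m k : mu (O m `&` A k) < +oo.
  apply: le_lt_trans (finA k); apply: le_mu; [exact: borel_open|exact: borel_open|].
  by move=> ? [].
have /choice[C HC] : forall mk : nat * nat, exists C : nat -> set X,
    (forall n, compact (C n) /\ C n `<=` O mk.1 `&` A mk.2) /\
    mu ((O mk.1 `&` A mk.2) `\` \bigcup_n C n) = 0.
  by move=> [m k]; exact: (compact_exhaustion hX mu_inner (oOA m k) (fOA m k)).
have /choice[W HW] : forall mkn : nat * nat * nat,
    exists W : set (borel X * borel Y), [/\ measurable W, W `<=` U &
    forall x, C mkn.1 mkn.2 x -> (r mkn.1.1)%:E < nu (xsec W x)].
  move=> [[m k] n] /=; have [/(_ n) [cC CO] _] := HC (m, k).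
  by apply: finite_rects => // x /CO[].
have mW : measurable (\bigcup_m \bigcup_k \bigcup_n W (m, k, n)).
  apply: bigcupT_measurable => m; apply: bigcupT_measurable => k.
  by apply: bigcupT_measurable => n; have [] := HW (m, k, n).
exists (\bigcup_m \bigcup_k \bigcup_n W (m, k, n)); split => //.
  by move=> p [m _ [k _ [n _]]]; have [_ + _] := HW (m, k, n); exact.
pose N m k := (O m `&` A k) `\` \bigcup_n C (m, k) n.
have mN m k : measurable (N m k : set (borel X)).
  apply: measurableD; first exact: borel_open.
  apply: bigcupT_measurable => n; apply: (borel_compact hX).
  by have [/(_ n)[]] := HC (m, k).
apply: (@negligibleS _ _ _ mu (\bigcup_m \bigcup_k N m k)); last first.
  apply: negligible_bigcup => m; apply: negligible_bigcup => k.
  by apply/negligibleP => //; have [] := HC (m, k).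
move=> x /= /negP; rewrite -ltNge => ltWU.
have [m mWU] : exists m, nu (xsec (\bigcup_m \bigcup_k \bigcup_n W (m, k, n)) x) <=
    (r m)%:E < nu (xsec U x).
  exact: ereal_rat_between.
have [k _ Akx] : (\bigcup_n A n) x by rewrite covA.
exists m => //; exists k => //; split.
  by split => //; have /andP[] := mWU.
move=> [n _ Cx]; have [mWn _ /(_ _ Cx) /=] := HW (m, k, n).
apply/negP; rewrite -leNgt; apply: le_trans (proj1 (andP mWU)).
apply: le_mu.
- rewrite -[xsec _ _]setTI.
  exact: (@pair1_measurable _ _ (borel X) (borel Y) x measurableT _ mWn).
- rewrite -[xsec _ _]setTI.
  exact: (@pair1_measurable _ _ (borel X) (borel Y) x measurableT _ mW).
- by move=> y Wy; exists m => //; exists k => //; exists n.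
Qed.

End OpenTonelli.

(** * Tonelli's theorem for Borel functions on a product *)

Section TonelliFunctions.
Local Open Scope ereal_scope.
Context (R : realType) (X Y : ptopologicalType).
Variable mu : {measure set (borel X) -> \bar R}.
Variable nu : {measure set (borel Y) -> \bar R}.

(** The functions that satisfy Tonelli's theorem, including the measurability of
    both partial integrals, which is part of what has to be carried through the
    closure arguments. *)
Record tonelli_fun (H : X * Y -> \bar R) : Prop := TonelliFun {
  tonelli_ge0 : forall z, 0 <= H z ;
  tonelli_meas : measurable_fun [set: borel (X * Y)%type] (H : borel (X * Y)%type -> \bar R) ;
  tonelli_measl : measurable_fun [set: borel X]
    (fun x : borel X => \int[nu]_(y in [set: borel Y]) H (x, y)) ;
  tonelli_measr : measurable_fun [set: borel Y]
    (fun y : borel Y => \int[mu]_(x in [set: borel X]) H (x, y)) ;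
  tonelli_swap :
    \int[mu]_(x in [set: borel X]) \int[nu]_(y in [set: borel Y]) H (x, y) =
    \int[nu]_(y in [set: borel Y]) \int[mu]_(x in [set: borel X]) H (x, y) }.

Lemma continuous_pair2 (y : Y) : continuous (fun x : X => (x, y)).
Proof. by move=> x; apply: cvg_pair => //=; exact: cvg_cst. Qed.

Lemma measurable_sliceY d (T : measurableType d) (H : X * Y -> T) x :
  measurable_fun [set: borel (X * Y)%type] (H : borel (X * Y)%type -> T) ->
  measurable_fun [set: borel Y] (fun y : borel Y => H (x, y)).
Proof.
by move=> mH; exact: (measurableT_comp mH (borel_continuous (@continuous_pair1 X Y x))).
Qed.

Lemma measurable_sliceX d (T : measurableType d) (H : X * Y -> T) y :
  measurable_fun [set: borel (X * Y)%type] (H : borel (X * Y)%type -> T) ->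
  measurable_fun [set: borel X] (fun x : borel X => H (x, y)).
Proof.
by move=> mH; exact: (measurableT_comp mH (borel_continuous (@continuous_pair2 y))).
Qed.

Lemma tonelli_fun0 : tonelli_fun (cst 0).
Proof.
have l (x : X) : \int[nu]_(y in [set: borel Y]) (cst 0 : X * Y -> \bar R) (x, y) = 0.
  exact: integral0.
have r (y : Y) : \int[mu]_(x in [set: borel X]) (cst 0 : X * Y -> \bar R) (x, y) = 0.
  exact: integral0.
split => //.
- by under eq_fun do rewrite l; exact: measurable_cst.
- by under eq_fun do rewrite r; exact: measurable_cst.
- by rewrite !integral0_eq.
Qed.

Lemma tonelli_funD H1 H2 : tonelli_fun H1 -> tonelli_fun H2 ->
  tonelli_fun (H1 \+ H2).
Proof.
move=> [H10 mH1 mH1l mH1r H1E] [H20 mH2 mH2l mH2r H2E].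
have l x : \int[nu]_(y in [set: borel Y]) (H1 \+ H2) (x, y) =
    \int[nu]_(y in [set: borel Y]) H1 (x, y) +
    \int[nu]_(y in [set: borel Y]) H2 (x, y).
  by apply: ge0_integralD => //; exact: measurable_sliceY.
have r y : \int[mu]_(x in [set: borel X]) (H1 \+ H2) (x, y) =
    \int[mu]_(x in [set: borel X]) H1 (x, y) +
    \int[mu]_(x in [set: borel X]) H2 (x, y).
  by apply: ge0_integralD => //; exact: measurable_sliceX.
split.
- by move=> z; rewrite adde_ge0.
- exact: emeasurable_funD.
- by under eq_fun do rewrite l; exact: emeasurable_funD.
- by under eq_fun do rewrite r; exact: emeasurable_funD.
- under eq_integral do rewrite l; under [RHS]eq_integral do rewrite r.
  rewrite ge0_integralD//; try by move=> ? _; exact: integral_ge0.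
  rewrite [RHS]ge0_integralD//; try by move=> ? _; exact: integral_ge0.
  by rewrite H1E H2E.
Qed.

Lemma tonelli_funZ (k : R) H : (0 <= k)%R -> tonelli_fun H ->
  tonelli_fun (fun z => k%:E * H z).
Proof.
move=> k0 [H0 mH mHl mHr HE].
have l x : \int[nu]_(y in [set: borel Y]) (k%:E * H (x, y)) =
    k%:E * \int[nu]_(y in [set: borel Y]) H (x, y).
  by apply: ge0_integralZl_EFin => //; exact: measurable_sliceY.
have r y : \int[mu]_(x in [set: borel X]) (k%:E * H (x, y)) =
    k%:E * \int[mu]_(x in [set: borel X]) H (x, y).
  by apply: ge0_integralZl_EFin => //; exact: measurable_sliceX.
split.
- by move=> z; rewrite mule_ge0.
- exact: measurable_funeM.
- by under eq_fun do rewrite l; exact: measurable_funeM.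
- by under eq_fun do rewrite r; exact: measurable_funeM.
- under eq_integral do rewrite l; under [RHS]eq_integral do rewrite r.
  rewrite ge0_integralZl_EFin//; try by move=> ? _; exact: integral_ge0.
  rewrite [RHS]ge0_integralZl_EFin//; try by move=> ? _; exact: integral_ge0.
  by rewrite HE.
Qed.

Lemma tonelli_fun_sum (I : eqType) (s : seq I) (H : I -> X * Y -> \bar R) :
  (forall i, i \in s -> tonelli_fun (H i)) ->
  tonelli_fun (fun z => \sum_(i <- s) H i z).
Proof.
elim: s => [|i s IH] Hs.
  by under eq_fun do rewrite big_nil; exact: tonelli_fun0.
under eq_fun do rewrite big_cons.
apply: tonelli_funD; first by apply: Hs; rewrite inE eqxx.
by apply: IH => j js; apply: Hs; rewrite inE js orbT.
Qed.

Lemma tonelli_fun_lim (F : nat -> X * Y -> \bar R) (H : X * Y -> \bar R) :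
  (forall n, tonelli_fun (F n)) ->
  (forall z, nondecreasing_seq (F ^~ z)) ->
  (forall z, F n z @[n --> \oo] --> H z) -> tonelli_fun H.
Proof.
move=> tF ndF FH.
have HE z : H z = limn (F ^~ z) by apply/esym/cvg_lim => //; exact: FH.
have F0 n z : 0 <= F n z by case: (tF n).
have mF n := tonelli_meas (tF n).
have l x : \int[nu]_(y in [set: borel Y]) F n (x, y) @[n --> \oo] -->
    \int[nu]_(y in [set: borel Y]) H (x, y).
  under [X in _ --> X]eq_integral do rewrite HE.
  apply: cvg_monotone_convergence => //.
  by move=> n; exact: measurable_sliceY.
have r y : \int[mu]_(x in [set: borel X]) F n (x, y) @[n --> \oo] -->
    \int[mu]_(x in [set: borel X]) H (x, y).
  under [X in _ --> X]eq_integral do rewrite HE.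
  apply: cvg_monotone_convergence => //.
  by move=> n; exact: measurable_sliceX.
have ll : \int[mu]_(x in [set: borel X])
      \int[nu]_(y in [set: borel Y]) F n (x, y) @[n --> \oo] -->
    \int[mu]_(x in [set: borel X]) \int[nu]_(y in [set: borel Y]) H (x, y).
  under [X in _ --> X]eq_integral do rewrite -(cvg_lim _ (l _))//.
  apply: cvg_monotone_convergence => //.
  - by move=> n; case: (tF n).
  - by move=> n x _; exact: integral_ge0.
  - move=> x _ m n mn; apply: ge0_le_integral => //.
    + exact: measurable_sliceY.
    + exact: measurable_sliceY.
    + by move=> y _; exact: (ndF (x, y) _ _ mn).
have rr : \int[nu]_(y in [set: borel Y])
      \int[mu]_(x in [set: borel X]) F n (x, y) @[n --> \oo] -->
    \int[nu]_(y in [set: borel Y]) \int[mu]_(x in [set: borel X]) H (x, y).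
  under [X in _ --> X]eq_integral do rewrite -(cvg_lim _ (r _))//.
  apply: cvg_monotone_convergence => //.
  - by move=> n; case: (tF n).
  - by move=> n x _; exact: integral_ge0.
  - move=> x _ m n mn; apply: ge0_le_integral => //.
    + exact: measurable_sliceX.
    + exact: measurable_sliceX.
    + by move=> y _; exact: (ndF (y, x) _ _ mn).
split.
- move=> z; rewrite HE; apply: lime_ge; last exact: nearW.
  by apply/cvg_ex; exists (H z); exact: FH.
- exact: (@emeasurable_fun_cvg _ (borel (X * Y)%type) _ _ F) (fun z _ => FH z).
- apply: (emeasurable_fun_cvg (fun n (x : borel X) => \int[nu]_(y in [set: borel Y]) F n (x, y))).
  + by move=> n; case: (tF n).
  + by move=> x _; exact: l.
- apply: (emeasurable_fun_cvg (fun n (y : borel Y) => \int[mu]_(x in [set: borel X]) F n (x, y))).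
  + by move=> n; case: (tF n).
  + by move=> x _; exact: r.
- apply: (cvg_unique _ ll); first exact: ereal_hausdorff.
  by rewrite (funext (fun n => tonelli_swap (tF n))).
Qed.

End TonelliFunctions.

Section OpenSets.
Local Open Scope ereal_scope.
Context (R : realType).

Definition ysec (T1 T2 : Type) (E : set (T1 * T2)) (y : T2) : set T1 :=
  [set x | E (x, y)].

Definition swap_set (T1 T2 : Type) (E : set (T1 * T2)) : set (T2 * T1) :=
  [set p | E (p.2, p.1)].

Lemma open_swap_set (X Y : topologicalType) (U : set (X * Y)) :
  open U -> open (swap_set U).
Proof. by have /continuousP := @swap_continuous Y X; exact. Qed.

Lemma open_setX (X Y : topologicalType) (A : set X) (B : set Y) :
  open A -> open B -> open (A `*` B).
Proof.
move=> oA oB; rewrite openE => -[x y] [/= Ax By].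
by exists (A, B) => //=; split; exact: open_nbhs_nbhs.
Qed.

Lemma measurable_lsc (X : ptopologicalType) (f : X -> \bar R) :
  (forall c, open [set x | c < f x]) ->
  measurable_fun [set: borel X] (f : borel X -> \bar R).
Proof.
move=> fo; apply: (measurability _ (ErealGenOInfty.measurableE R)) => //.
move=> _ [_ [r ->] <-]; rewrite setTI.
have -> : f @^-1` `]r%:E, +oo[ = [set x | r%:E < f x].
  by apply/seteqP; split => x /=; rewrite in_itv/= andbT.
exact: borel_open.
Qed.

(** One inequality between the iterated integrals: replace [U] by the measurable
    set [W] of [dense_rects] and apply the theorem for product measures to it.
    Exchanging the factors gives the other inequality. *)
Lemma tonelli_open_le (X Y : ptopologicalType)
  (mu : {sigma_finite_measure set (borel X) -> \bar R})
  (nu : {sigma_finite_measure set (borel Y) -> \bar R})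
  (A : nat -> set X) (U : set (X * Y)) :
  hausdorff_space X -> hausdorff_space Y ->
  inner_regular_on_opens mu -> inner_regular_on_opens nu ->
  (forall n, open (A n)) -> (forall n, mu (A n) < +oo) ->
  \bigcup_n A n = setT -> open U ->
  \int[mu]_(x in [set: borel X]) nu (xsec U x) <=
  \int[nu]_(y in [set: borel Y]) mu (ysec U y).
Proof.
move=> hX hY mi ni oA fA cA oU.
have [W [mW WU aeW]] := dense_rects hX hY mi ni oA fA cA oU.
have xW x : xsec W x = xsection W x.
  by apply/seteqP; split => y /=; rewrite /xsection /= inE.
have yW y : ysec W y = ysection W y.
  by apply/seteqP; split => x /=; rewrite /ysection /= inE.
have mnuU : measurable_fun [set: borel X] (fun x : borel X => nu (xsec U x)).
  by apply: measurable_lsc => c; exact: open_lt_measure_xsec.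
have mmuU : measurable_fun [set: borel Y] (fun y : borel Y => mu (ysec U y)).
  apply: measurable_lsc => c; apply: (open_lt_measure_xsec hX mi (U := swap_set U)).
  exact: open_swap_set.
apply: (@le_trans _ _ (\int[mu]_(x in [set: borel X]) nu (xsec W x))).
  apply: ae_ge0_le_integral => //.
    under eq_fun do rewrite xW; exact: measurable_fun_xsection.
  by apply: (@filterS _ _ (ae_filter_ringOfSetsType mu) _ _ _ aeW) => x + _.
under eq_integral do rewrite xW.
have -> : \int[mu]_(x in [set: borel X]) nu (xsection W x) = (mu \x^ nu) W.
  by apply: product_measure_unique => //= *; rewrite product_measure2E.
rewrite /product_measure2/=; apply: ge0_le_integral => //.
  exact: measurable_fun_ysection.
move=> y _ /=; rewrite -yW; apply: le_mu.
- by rewrite yW; exact: measurable_ysection.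
- apply: borel_open; have /continuousP := @continuous_pair2 X Y y; exact.
- by move=> x; exact: WU.
Qed.

End OpenSets.

Section BorelTonelli.
Local Open Scope ereal_scope.
Context (R : realType) (X Y : ptopologicalType).

Lemma le_indic (T : Type) (E F : set T) z : (E z -> F z) ->
  (\1_E z <= \1_F z :> R)%R.
Proof.
move=> EF; rewrite !indicE ler_nat.
by have [/set_mem/EF/mem_set ->|] := boolP (z \in E).
Qed.

Lemma eq_indic (T : Type) (E F : set T) z : (E z <-> F z) ->
  (\1_E z = \1_F z :> R)%R.
Proof. by move=> [EF FE]; apply/eqP; rewrite eq_le !le_indic. Qed.

Lemma indic_setD (T : Type) (E F D : set T) z : F `<=` E ->
  (\1_(E `&` D) z = \1_(F `&` D) z + \1_((E `\` F) `&` D) z :> R)%R.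
Proof.
move=> FE; rewrite !indicE.
have -> : (z \in (E `\` F) `&` D) = (z \in E) && (z \notin F) && (z \in D).
  by rewrite in_setI in_setD.
rewrite (in_setI z E) (in_setI z F).
have [zF|zF] := boolP (z \in F); last by rewrite add0r andbT.
have -> : z \in E by apply/mem_set/FE/set_mem.
by rewrite addr0.
Qed.

(** The complement step of Dynkin's lemma; finiteness is what allows the
    subtraction of the integrals. *)
Lemma tonelli_fun_subl (mu : {measure set (borel X) -> \bar R})
    (nu : {measure set (borel Y) -> \bar R}) (H1 H2 H3 : X * Y -> \bar R) :
  (forall z, 0 <= H3 z) ->
  measurable_fun [set: borel (X * Y)%type] (H3 : borel (X * Y)%type -> \bar R) ->
  (forall z, H1 z = H2 z + H3 z) ->
  (forall x, \int[nu]_(y in [set: borel Y]) H1 (x, y) < +oo) ->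
  (forall y, \int[mu]_(x in [set: borel X]) H1 (x, y) < +oo) ->
  \int[mu]_(x in [set: borel X]) \int[nu]_(y in [set: borel Y]) H1 (x, y) < +oo ->
  tonelli_fun mu nu H1 -> tonelli_fun mu nu H2 -> tonelli_fun mu nu H3.
Proof.
move=> H30 mH3 H123 xfin yfin fin [H10 mH1 mH1l mH1r H1E] [H20 mH2 mH2l mH2r H2E].
have subE (a b c : \bar R) : 0 <= b -> 0 <= c -> a < +oo -> a = b + c -> c = a - b.
  move=> b0 c0 afin abc; rewrite abc addeAC subee ?add0e// ge0_fin_numE//.
  by apply: le_lt_trans afin; rewrite abc leeDl.
have l x : \int[nu]_(y in [set: borel Y]) H1 (x, y) =
    \int[nu]_(y in [set: borel Y]) H2 (x, y) +
    \int[nu]_(y in [set: borel Y]) H3 (x, y).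
  under eq_integral do rewrite H123.
  by apply: ge0_integralD => //; exact: measurable_sliceY.
have r y : \int[mu]_(x in [set: borel X]) H1 (x, y) =
    \int[mu]_(x in [set: borel X]) H2 (x, y) +
    \int[mu]_(x in [set: borel X]) H3 (x, y).
  under eq_integral do rewrite H123.
  by apply: ge0_integralD => //; exact: measurable_sliceX.
have l' x : \int[nu]_(y in [set: borel Y]) H3 (x, y) =
    \int[nu]_(y in [set: borel Y]) H1 (x, y) - \int[nu]_(y in [set: borel Y]) H2 (x, y).
  by apply: subE => //; exact: integral_ge0.
have r' y : \int[mu]_(x in [set: borel X]) H3 (x, y) =
    \int[mu]_(x in [set: borel X]) H1 (x, y) - \int[mu]_(x in [set: borel X]) H2 (x, y).
  by apply: subE => //; exact: integral_ge0.
have mH3l : measurable_fun [set: borel X]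
    (fun x : borel X => \int[nu]_(y in [set: borel Y]) H3 (x, y)).
  by rewrite (funext l'); exact: emeasurable_funB.
have mH3r : measurable_fun [set: borel Y]
    (fun y : borel Y => \int[mu]_(x in [set: borel X]) H3 (x, y)).
  by rewrite (funext r'); exact: emeasurable_funB.
split => //.
have L : \int[mu]_(x in [set: borel X]) \int[nu]_(y in [set: borel Y]) H1 (x, y) =
    \int[mu]_(x in [set: borel X]) \int[nu]_(y in [set: borel Y]) H2 (x, y) +
    \int[mu]_(x in [set: borel X]) \int[nu]_(y in [set: borel Y]) H3 (x, y).
  under eq_integral do rewrite l.
  by apply: ge0_integralD => // x _; exact: integral_ge0.
have R' : \int[nu]_(y in [set: borel Y]) \int[mu]_(x in [set: borel X]) H1 (x, y) =
    \int[nu]_(y in [set: borel Y]) \int[mu]_(x in [set: borel X]) H2 (x, y) +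
    \int[nu]_(y in [set: borel Y]) \int[mu]_(x in [set: borel X]) H3 (x, y).
  under eq_integral do rewrite r.
  by apply: ge0_integralD => // y _; exact: integral_ge0.
rewrite (subE _ _ _ _ _ _ L)//; try by (apply: integral_ge0 => x _; exact: integral_ge0).
rewrite (subE _ _ _ _ _ _ R')//; try by (apply: integral_ge0 => x _; exact: integral_ge0).
  by rewrite H1E H2E.
by rewrite -H1E.
Qed.

Lemma integral_xsec (nu : {measure set (borel Y) -> \bar R}) (E : set (X * Y)) x :
  measurable (E : set (borel (X * Y)%type)) ->
  \int[nu]_(y in [set: borel Y]) (\1_E (x, y))%:E = nu (xsec E x).
Proof.
move=> mE; have mx := measurable_xsec x mE.
have -> : nu (xsec E x) = nu (xsec E x `&` [set: borel Y]) by rewrite setIT.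
by rewrite -integral_indic.
Qed.

Lemma integral_ysec (mu : {measure set (borel X) -> \bar R}) (E : set (X * Y)) y :
  measurable (E : set (borel (X * Y)%type)) ->
  \int[mu]_(x in [set: borel X]) (\1_E (x, y))%:E = mu (ysec E y).
Proof.
move=> mE.
have my : measurable (ysec E y : set (borel X)).
  rewrite -[ysec _ _]setTI.
  exact: (borel_continuous (@continuous_pair2 X Y y) measurableT mE).
have -> : mu (ysec E y) = mu (ysec E y `&` [set: borel X]) by rewrite setIT.
by rewrite -integral_indic.
Qed.

Variable mu : {sigma_finite_measure set (borel X) -> \bar R}.
Variable nu : {sigma_finite_measure set (borel Y) -> \bar R}.
Hypothesis hX : hausdorff_space X.
Hypothesis hY : hausdorff_space Y.
Hypothesis mu_inner : inner_regular_on_opens mu.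
Hypothesis nu_inner : inner_regular_on_opens nu.
Variables (A : nat -> set X) (B : nat -> set Y).
Hypothesis oA : forall n, open (A n).
Hypothesis finA : forall n, mu (A n) < +oo.
Hypothesis covA : \bigcup_n A n = setT.
Hypothesis oB : forall n, open (B n).
Hypothesis finB : forall n, nu (B n) < +oo.
Hypothesis covB : \bigcup_n B n = setT.

Local Notation tonelli_set E := (tonelli_fun mu nu (fun z => (\1_E z)%:E)).

Lemma tonelli_set_open U : open U -> tonelli_set U.
Proof.
move=> oU; have mU : measurable (U : set (borel (X * Y)%type)) by exact: borel_open.
have xU x := @integral_xsec nu U x mU; have yU y := @integral_ysec mu U y mU.
split.
- by move=> z; rewrite lee_fin indicE.
- by apply/measurable_EFinP; exact: measurable_indic.
- rewrite (funext xU); apply: measurable_lsc => c.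
  exact: open_lt_measure_xsec.
- rewrite (funext yU); apply: measurable_lsc => c.
  apply: (open_lt_measure_xsec hX mu_inner (U := swap_set U)).
  exact: open_swap_set.
under eq_integral do rewrite xU.
under [RHS]eq_integral do rewrite yU.
apply/eqP; rewrite eq_le; apply/andP; split.
  exact: (tonelli_open_le hX hY mu_inner nu_inner oA finA covA oU).
exact: (tonelli_open_le hY hX nu_inner mu_inner oB finB covB (open_swap_set oU)).
Qed.

(** Dynkin's lemma, started from the intersection-stable family of open sets.  The
    box makes all integrals finite, as the complement step requires. *)
Lemma tonelli_set_box n (E : set (X * Y)) :
  measurable (E : set (borel (X * Y)%type)) -> tonelli_set (E `&` (A n `*` B n)).
Proof.
set D := A n `*` B n.
have oD : open D by exact: open_setX.
have mD : measurable (D : set (borel (X * Y)%type)) by exact: borel_open.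
pose P := [set E : set (X * Y) | measurable (E : set (borel (X * Y)%type)) /\
  tonelli_set (E `&` D)].
suff : <<s (@open (X * Y)%type) >> `<=` P by move=> + mE => /(_ _ mE)[].
have Dx x : nu (xsec D x) <= nu (B n) * (\1_(A n) x)%:E.
  rewrite indicE; case: (boolP (x \in A n)) => xA.
    rewrite mule1; apply: le_mu; [exact: measurable_xsec|exact: borel_open|].
    by move=> y [].
  rewrite mule0 (_ : xsec D x = set0) ?measure0//.
  by apply/seteqP; split => y //= [/= Ax _]; move: xA; rewrite notin_setE.
have Dy y : mu (ysec D y) <= mu (A n).
  apply: le_mu; [|exact: borel_open|by move=> x []].
  by apply: borel_open; have /continuousP := @continuous_pair2 X Y y; exact.
apply: lambda_system_subset => //; [exact: openI| |].
- split => //.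
  + by split => //; rewrite setTI; exact: tonelli_set_open.
  + move=> {}E F FE [mE tE] [mF tF]; split; first exact: measurableD.
    have mED : measurable (E `&` D : set (borel (X * Y)%type)) by exact: measurableI.
    have fx x : \int[nu]_(y in [set: borel Y]) (\1_(E `&` D) (x, y))%:E <=
        nu (B n) * (\1_(A n) x)%:E.
      rewrite integral_xsec//; apply: le_trans (Dx x); apply: le_mu.
      * exact: measurable_xsec.
      * exact: measurable_xsec.
      * by move=> y [].
    have fyo : nu (B n) \is a fin_num by rewrite ge0_fin_numE.
    apply: (tonelli_fun_subl _ _ _ _ _ _ tE tF).
    * by move=> z; rewrite lee_fin indicE.
    * apply/measurable_EFinP; apply: measurable_indic; apply: measurableI => //.
      exact: measurableD.
    * by move=> z; rewrite -EFinD; congr EFin; exact: indic_setD.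
    * move=> x; apply: le_lt_trans (fx x) _; rewrite indicE.
      by case: (x \in A n); rewrite ?mule1 ?mule0.
    * move=> y; rewrite integral_ysec//; apply: le_lt_trans (finA n).
      apply: le_trans (Dy y); apply: le_mu; last by move=> x [].
        rewrite -[ysec _ _]setTI.
        exact: (borel_continuous (@continuous_pair2 X Y y) measurableT mED).
      by apply: borel_open; have /continuousP := @continuous_pair2 X Y y; exact.
    * apply: (@le_lt_trans _ _ (\int[mu]_(x in [set: borel X]) (nu (B n) * (\1_(A n) x)%:E))).
        apply: ge0_le_integral => //.
        - by move=> x _; exact: integral_ge0.
        - by case: tE.
        - apply: measurable_funeM; apply/measurable_EFinP.
          by apply: measurable_indic; exact: borel_open.
      rewrite ge0_integralZl//.
      + rewrite integral_indic ?setIT//; last exact: borel_open.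
        by apply: lte_mul_pinfty => //; exact: finA.
      + apply/measurable_EFinP.
        by apply: measurable_indic; exact: borel_open.
  + move=> F ndF HF; split; first by apply: bigcupT_measurable => k; case: (HF k).
    apply: (@tonelli_fun_lim _ _ _ _ _ (fun k z => (\1_(F k `&` D) z)%:E)).
    * by move=> k; case: (HF k).
    * move=> z k l kl; rewrite lee_fin; apply: le_indic => -[Fk Dz]; split => //.
      by have /subsetPset := ndF _ _ kl; exact.
    * move=> z; have [[k _ Fkz]|nF] := pselect ((\bigcup_i F i) z).
        apply: cvg_near_cst; exists k => // l /= kl; congr EFin.
        apply: eq_indic; split=> -[Fl Dz]; split => //; first by exists l.
        by have /subsetPset := ndF _ _ kl; exact.
      apply: cvg_near_cst; exists 0%N => // l /= kl; congr EFin.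
      by apply: eq_indic; split=> -[Fl Dz]; exfalso; apply: nF => //; exists l.
- move=> U oU; split; first exact: borel_open.
  by apply: tonelli_set_open; exact: openI.
Qed.

End BorelTonelli.

Section TonelliBorel.
Local Open Scope ereal_scope.
Context (R : realType) (X Y : ptopologicalType).
Variable mu : {sigma_finite_measure set (borel X) -> \bar R}.
Variable nu : {sigma_finite_measure set (borel Y) -> \bar R}.
Hypothesis hX : hausdorff_space X.
Hypothesis hY : hausdorff_space Y.
Hypothesis mu_inner : inner_regular_on_opens mu.
Hypothesis nu_inner : inner_regular_on_opens nu.
Variables (A : nat -> set X) (B : nat -> set Y).
Hypothesis oA : forall n, open (A n).
Hypothesis finA : forall n, mu (A n) < +oo.
Hypothesis covA : \bigcup_n A n = setT.
Hypothesis ndA : forall n, A n `<=` A n.+1.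
Hypothesis oB : forall n, open (B n).
Hypothesis finB : forall n, nu (B n) < +oo.
Hypothesis covB : \bigcup_n B n = setT.
Hypothesis ndB : forall n, B n `<=` B n.+1.

Import HBNNSimple.

Theorem tonelli_borel (H : X * Y -> \bar R) : (forall z, 0 <= H z) ->
  measurable_fun [set: borel (X * Y)%type] (H : borel (X * Y)%type -> \bar R) ->
  tonelli_fun mu nu H.
Proof.
move=> H0 mH.
pose phi := nnsfun_approx measurableT mH.
pose D n := A n `*` B n.
have ndA' m n : (m <= n)%N -> A m `<=` A n.
  by move=> /subnK <-; elim: (n - m)%N => //= k IH x /IH; exact: ndA.
have ndB' m n : (m <= n)%N -> B m `<=` B n.
  by move=> /subnK <-; elim: (n - m)%N => //= k IH x /IH; exact: ndB.
have ndD m n : (m <= n)%N -> D m `<=` D n.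
  by move=> mn [x y] [/(ndA' _ _ mn) ? /(ndB' _ _ mn) ?].
apply: (@tonelli_fun_lim _ _ _ _ _ (fun n z => (phi n z * \1_(D n) z)%:E)).
- move=> n.
  have -> : (fun z => (phi n z * \1_(D n) z)%:E) = (fun z =>
      \sum_(k <- fset_set (range (phi n)))
        (k%:E * (\1_((phi n @^-1` [set k] : set (X * Y)) `&` D n) z)%:E)).
    apply/funext => z; rewrite fimfunE fsbig_finite//= mulr_suml -sumEFin.
    by apply: eq_bigr => k _; rewrite -EFinM indicI mulrA.
  apply: tonelli_fun_sum => k; rewrite in_fset_set// inE => -[z _ <-].
  apply: tonelli_funZ => //.
  by apply: (tonelli_set_box hX hY mu_inner nu_inner oA finA covA oB finB covB).
- move=> z m n mn; rewrite lee_fin ler_pM// ?le_indic//; last exact: ndD.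
  by have /lefP := nd_nnsfun_approx measurableT mH mn; exact.
- move=> z.
  have [[n0 _ An0] [m0 _ Bm0]] : (\bigcup_n A n) z.1 /\ (\bigcup_n B n) z.2.
    by rewrite covA covB.
  have phiz : EFin \o phi^~ z @ \oo --> H z by exact: (cvg_nnsfun_approx measurableT mH).
  move: phiz; apply: cvg_trans; apply: near_eq_cvg; exists (maxn n0 m0) => // n /=.
  rewrite geq_max => /andP[n0n m0n].
  rewrite indicE mem_set ?mulr1//; split; first exact: (ndA' _ _ n0n).
  exact: (ndB' _ _ m0n).
Qed.

End TonelliBorel.

(** * Haar measure: invariance under translations and inversion *)

Section MeasurePreserving.
Local Open Scope ereal_scope.
Context (R : realType) d (T : measurableType d).
Variable mu : {measure set T -> \bar R}.

Definition measure_preserving (f : T -> T) :=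
  measurable_fun setT f /\ forall A, measurable A -> mu (f @^-1` A) = mu A.

Lemma measure_preserving_comp f g : measure_preserving f ->
  measure_preserving g -> measure_preserving (f \o g).
Proof.
move=> [mf f_] [mg g_]; split; first exact: measurableT_comp.
move=> A mA; rewrite comp_preimage g_ ?f_//.
by rewrite -[X in measurable X]setTI; exact: mf.
Qed.

Lemma ge0_integral_preserving f (F : T -> \bar R) : measure_preserving f ->
  measurable_fun setT F -> (forall x, 0 <= F x) ->
  \int[mu]_x F (f x) = \int[mu]_x F x.
Proof.
move=> [mf f_] mF F0.
rewrite -[LHS](@ge0_integral_pushforward _ _ _ _ _ _ mf mu setT F)//.
by apply: eq_measure_integral => A mA _; exact: f_.
Qed.

Lemma integral_preserving f (F : T -> \bar R) : measure_preserving f ->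
  measurable_fun setT F -> \int[mu]_x F (f x) = \int[mu]_x F x.
Proof.
move=> hf mF; rewrite integralE [in RHS]integralE.
rewrite (_ : (fun x => F (f x))^\+ = fun x => F^\+ (f x)); last first.
  by apply/funext => x; rewrite !funeposE.
rewrite (_ : (fun x => F (f x))^\- = fun x => F^\- (f x)); last first.
  by apply/funext => x; rewrite !funenegE.
congr (_ - _).
  exact: (ge0_integral_preserving hf (measurable_funepos mF) (funepos_ge0 _)).
exact: (ge0_integral_preserving hf (measurable_funeneg mF) (funeneg_ge0 _)).
Qed.

Lemma ae_preserving f (P : T -> Prop) : measure_preserving f ->
  {ae mu, forall x, P x} -> {ae mu, forall x, P (f x)}.
Proof.
move=> [mf f_] [N [mN N0 PN]]; exists (f @^-1` N); split.
- by rewrite -[X in measurable X]setTI; exact: mf.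
- by rewrite f_.
- by move=> x /= nP; exact: PN.
Qed.

End MeasurePreserving.

(** The setting of the analysis on [G].  The subgroups [K n] give sigma-finiteness,
    and the normalisation gives each of them positive measure. *)
Record haar_exhaustion (R : realType) (G : topologicalGroupType)
    (mu : {measure set (borel G) -> \bar R}) (K : nat -> set G) : Prop :=
  HaarExhaustion {
  he_hausdorff : hausdorff_space G ;
  he_haar : haar_measure mu ;
  he_subgroup : forall n, compact_open_subgroup (K n) ;
  he_incr : forall n, K n `<=` K n.+1 ;
  he_union : \bigcup_n K n = setT ;
  he_one : mu (K 0%N) = 1%E }.

Section Haar.
Local Open Scope ereal_scope.
Context (R : realType) (G : topologicalGroupType).
Variables (mu : {measure set (borel G) -> \bar R}) (K : nat -> set G).
Hypothesis he : haar_exhaustion mu K.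

Let hG : hausdorff_space G. Proof. by case: he. Qed.
Let hmu : haar_measure mu. Proof. by case: he. Qed.
Let oK n : open (K n). Proof. by case: he => _ _ /(_ n)[]. Qed.
Let cK n : compact (K n). Proof. by case: he => _ _ /(_ n)[]. Qed.
Let sK n : subgroup (K n). Proof. by case: he => _ _ /(_ n)[]. Qed.
Let mK n : measurable (K n : set (borel G)). Proof. exact: borel_open. Qed.
Let fK n : mu (K n) < +oo. Proof. by case: hmu => _ + _ _ _; apply. Qed.

Lemma exhaustion_le m n : (m <= n)%N -> K m `<=` K n.
Proof.
move=> /subnK <-; elim: (n - m)%N => //= k IH x /IH; exact: (he_incr he).
Qed.

Lemma exhaustionP x : exists n, K n x.
Proof.
have : (\bigcup_n K n) x by rewrite (he_union he).
by move=> [n _ Kx]; exists n.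
Qed.

Lemma haar_sigma_finite : sigma_finite setT mu.
Proof.
exists K; first by rewrite (he_union he).
by move=> n; split.
Qed.

Lemma tonelli_haar (H : G * G -> \bar R) : (forall z, 0 <= H z) ->
  measurable_fun [set: borel (G * G)%type] (H : borel (G * G)%type -> \bar R) ->
  tonelli_fun mu mu H.
Proof.
move=> H0 mH.
pose sf := isSigmaFinite.Build _ _ _ (mu : set (borel G) -> \bar R) haar_sigma_finite.
pose sfi := isSFinite.Build _ _ _ (mu : set (borel G) -> \bar R)
  (sfinite_measure_sigma_finite haar_sigma_finite).
pose mu' : {sigma_finite_measure set (borel G) -> \bar R} :=
  HB.pack (mu : set (borel G) -> \bar R) (Measure.class mu) sf sfi.
have mui : inner_regular_on_opens mu' by case: hmu.
have -> : mu = mu' by exact: eq_measure.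
exact: (tonelli_borel (mu := mu') (nu := mu') hG hG mui mui oK fK (he_union he)
  (he_incr he) oK fK (he_union he) (he_incr he) H0 mH).
Qed.

Lemma continuous_mull (a : G) : continuous (fun x : G => (a * x)%g).
Proof.
move=> x; apply: (@continuous_comp _ _ _ (fun x : G => (a, x)) (fun p : G * G => (p.1 * p.2)%g)).
  exact: continuous_pair1.
exact: mulg_continuous.
Qed.

Lemma continuous_mulVl : continuous (fun z : G * G => (z.2^-1 * z.1)%g).
Proof.
move=> z; apply: (@continuous_comp _ _ _ (fun z : G * G => (z.2^-1, z.1)%g) (fun p : G * G => (p.1 * p.2)%g)).
  apply: cvg_pair => /=; last exact: cvg_fst.
  by apply: (@continuous_comp _ _ _ snd (fun x : G => x^-1)%g); [exact: cvg_snd|exact: invg_continuous].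
exact: mulg_continuous.
Qed.

Lemma preserving_mull (a : G) :
  measure_preserving mu ((fun x : G => (a * x)%g) : borel G -> borel G).
Proof.
split; first exact: (@borel_continuous G G _ (@continuous_mull a)).
move=> A mA; rewrite -(haar_left_invariant hmu (a^-1)%g mA); congr (mu _).
apply/seteqP; split => [x Ax|_ [y Ay <-]] /=.
  by exists (a * x)%g => //; rewrite mulKg.
by rewrite mulVKg.
Qed.

Let mV (A : set (borel G)) : measurable A ->
  measurable ((fun x : G => x^-1)%g @^-1` A : set (borel G)).
Proof.
move=> mA; rewrite -[X in measurable X]setTI.
exact: (borel_continuous (@invg_continuous G) measurableT mA).
Qed.

(* Integrate the indicator of [A (y^-1 x)] over [y] in [K n] in both orders.
   For [x] in [K n] the section is a translate of [A^-1], for [y] in [K n] it is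
   a translate of [A], and otherwise both are empty because [A `<=` K n].  So
   [mu (A^-1) * mu (K n) = mu A * mu (K n)]. *)
Let mu_inv n (A : set (borel G)) : measurable A -> A `<=` K n ->
  mu ((fun x : G => x^-1)%g @^-1` A) = mu A.
Proof.
move=> mA AK.
pose E : set (G * G) := [set z | K n z.2 /\ A (z.2^-1 * z.1)%g].
have mE : measurable (E : set (borel (G * G)%type)).
  apply: measurableI.
    rewrite -[X in measurable X]setTI.
    apply: (borel_continuous (f := @snd G G) _ measurableT (mK n)).
    by move=> z; exact: cvg_snd.
  rewrite -[X in measurable X]setTI.
  exact: (borel_continuous continuous_mulVl measurableT mA).
have tE : tonelli_fun mu mu (fun z => (\1_E z)%:E).
  apply: tonelli_haar; first by move=> z; rewrite lee_fin indicE.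
  by apply/measurable_EFinP; exact: measurable_indic.
have := tonelli_swap tE.
rewrite (eq_integral (fun x : borel G => mu (xsec E x))); last first.
  by move=> x _; exact: integral_xsec.
rewrite [RHS](eq_integral (fun x : borel G => mu (ysec E x))); last first.
  by move=> x _; exact: integral_ysec.
have xE x : mu (xsec E x) = mu ((fun x : G => x^-1)%g @^-1` A) * (\1_(K n) x)%:E.
  rewrite indicE; case: (boolP (x \in K n)) => [/set_mem Kx|]; last first.
    rewrite notin_setE => nKx; rewrite mule0 (_ : xsec E x = set0) ?measure0//.
    apply/seteqP; split => y //= [/= Ky /AK Kyx]; apply: nKx.
    by have [_ + _] := sK n; move=> /(_ _ _ Ky Kyx); rewrite mulVKg.
  rewrite mule1 -((preserving_mull x^-1)%g.2 _ (mV mA)); congr (mu _).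
  apply/seteqP; split => [y [/= _ Ay]|y /=]; rewrite /= invgM invgK//.
  move=> Ay; split => //=; have [_ /(_ x) KM KV] := sK n.
  by have := KM _ Kx (KV _ (AK _ Ay)); rewrite invgM invgK mulVKg.
have yE y : mu (ysec E y) = mu A * (\1_(K n) y)%:E.
  rewrite indicE; case: (boolP (y \in K n)) => [/set_mem Ky|]; last first.
    rewrite notin_setE => nKy; rewrite mule0 (_ : ysec E y = set0) ?measure0//.
    by apply/seteqP; split => x //= [/= Ky].
  rewrite mule1 -((preserving_mull y^-1)%g.2 _ mA); congr (mu _).
  by apply/seteqP; split => [x [/= _ Ay]|x /=].
under eq_integral do rewrite xE.
under [in RHS]eq_integral do rewrite yE.
have mi : measurable_fun [set: borel G] (fun x : borel G => (\1_(K n) x)%:E : \bar R).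
  by apply/measurable_EFinP; exact: measurable_indic.
rewrite !ge0_integralZl// integral_indic// setIT => muKA.
have K0 : 0 < mu (K n).
  rewrite (@lt_le_trans _ _ (mu (K 0%N)))//; first by rewrite (he_one he).
  by apply: le_mu => //; exact: exhaustion_le.
have Kfin : mu (K n) \is a fin_num by rewrite ge0_fin_numE.
by apply/eqP; rewrite eq_le; apply/andP; split; rewrite -(lee_pmul2r Kfin K0) muKA.
Qed.

Lemma preserving_inv :
  measure_preserving mu ((fun x : G => x^-1)%g : borel G -> borel G).
Proof.
split; first exact: (@borel_continuous G G _ (@invg_continuous G)).
move=> A mA.
have mAK n : measurable (A `&` K n) by exact: measurableI.
have ndAK : nondecreasing_seq (fun n => A `&` K n).
  by move=> m n mn; apply/subsetPset; apply: setIS; exact: exhaustion_le.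
have AE : A = \bigcup_n (A `&` K n) by rewrite -setI_bigcupr (he_union he) setIT.
have l : mu (A `&` K n) @[n --> \oo] --> mu A.
  rewrite [in X in _ --> X]AE; apply: nondecreasing_cvg_mu => //.
  exact: bigcupT_measurable.
have : mu ((fun x : G => x^-1)%g @^-1` (A `&` K n)) @[n --> \oo] -->
    mu ((fun x : G => x^-1)%g @^-1` A).
  rewrite [in X in _ --> X]AE preimage_bigcup; apply: nondecreasing_cvg_mu => //.
  - by move=> n; exact: mV.
  - by apply: bigcupT_measurable => n; exact: mV.
  - by move=> m n mn; apply/subsetPset; apply: preimage_subset; apply/subsetPset/ndAK.
have -> := funext (fun n => mu_inv (mAK n) (@subIsetr _ A (K n))).
by move=> l'; apply: (cvg_unique _ l' l); exact: ereal_hausdorff.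
Qed.

Lemma preserving_mulr (a : G) :
  measure_preserving mu ((fun x : G => (x * a)%g) : borel G -> borel G).
Proof.
rewrite (_ : (fun x => _) = (fun x : G => x^-1)%g \o
   (fun x : G => (a^-1 * x)%g) \o (fun x : G => x^-1)%g); last first.
  by apply/funext => x /=; rewrite invgM !invgK.
apply: measure_preserving_comp; last exact: preserving_inv.
by apply: measure_preserving_comp; [exact: preserving_inv|exact: preserving_mull].
Qed.

End Haar.

(** * Complex-valued functions and their integrals *)

Section ComplexModulus.
Context (R : realType).
Implicit Types z u : R[i].

Lemma cabs_ge0 z : 0 <= cabs z.
Proof. by case: z => a b; exact: sqrtr_ge0. Qed.

Lemma cabs0 : cabs (0 : R[i]) = 0.
Proof. exact: ComplexField.Normc.normc0. Qed.

Lemma cabs_eq0 z : cabs z = 0 -> z = 0.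
Proof. exact: ComplexField.Normc.eq0_normc. Qed.

Lemma cabsM z u : cabs (z * u) = cabs z * cabs u.
Proof. exact: ComplexField.Normc.normcM. Qed.

Lemma cabsD z u : cabs (z + u) <= cabs z + cabs u.
Proof. by have /andP[] := ComplexField.lec_normD z u. Qed.

Lemma cabs_conj z : cabs (conjc z) = cabs z.
Proof. by case: z => a b; rewrite /cabs /= sqrrN. Qed.

Lemma cabs_real (r : R) : cabs r%:C%C = `|r|.
Proof. by rewrite /cabs /= expr0n /= addr0 sqrtr_sqr. Qed.

Lemma normr_Re_le z : `|complex.Re z| <= cabs z.
Proof. by case: z => a b /=; rewrite -sqrtr_sqr ler_wsqrtr// lerDl sqr_ge0. Qed.

Lemma normr_Im_le z : `|complex.Im z| <= cabs z.
Proof. by case: z => a b /=; rewrite -sqrtr_sqr ler_wsqrtr// lerDr sqr_ge0. Qed.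

Lemma cabs_le z : cabs z <= `|complex.Re z| + `|complex.Im z|.
Proof.
case: z => a b /=; rewrite -[leRHS]ger0_norm ?addr_ge0// -sqrtr_sqr.
rewrite ler_wsqrtr// sqrrD !real_normK ?num_real// lerD2r lerDl.
by rewrite mulrn_wge0// mulr_ge0.
Qed.

Lemma cReD z u : complex.Re (z + u) = complex.Re z + complex.Re u.
Proof. by case: z; case: u. Qed.
Lemma cImD z u : complex.Im (z + u) = complex.Im z + complex.Im u.
Proof. by case: z; case: u. Qed.
Lemma cReM z u : complex.Re (z * u) =
  complex.Re z * complex.Re u - complex.Im z * complex.Im u.
Proof. by case: z; case: u. Qed.
Lemma cImM z u : complex.Im (z * u) =
  complex.Re z * complex.Im u + complex.Im z * complex.Re u.
Proof. by case: z; case: u. Qed.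
Lemma cRe_conj z : complex.Re (conjc z) = complex.Re z.
Proof. by case: z. Qed.
Lemma cIm_conj z : complex.Im (conjc z) = - complex.Im z.
Proof. by case: z. Qed.
Lemma complex_ext z u : complex.Re z = complex.Re u ->
  complex.Im z = complex.Im u -> z = u.
Proof. by case: z => a b; case: u => c d /= -> ->. Qed.

End ComplexModulus.

Section ComplexMeasurable.
Context (R : realType) d (T : measurableType d).
Implicit Types f g : T -> R[i].

(** [cmeasurable] over any measurable type; it is needed on [borel (G * G)]. *)
Definition complex_measurable f :=
  measurable_fun setT (fun x => complex.Re (f x)) /\
  measurable_fun setT (fun x => complex.Im (f x)).

Lemma complex_measurableD f g : complex_measurable f -> complex_measurable g ->
  complex_measurable (fun x => f x + g x).
Proof.
move=> [fr fi] [gr gi]; split.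
  by under eq_fun do rewrite cReD; exact: measurable_funD.
by under eq_fun do rewrite cImD; exact: measurable_funD.
Qed.

Lemma complex_measurableM f g : complex_measurable f -> complex_measurable g ->
  complex_measurable (fun x => f x * g x).
Proof.
move=> [fr fi] [gr gi]; split.
  by under eq_fun do rewrite cReM; apply: measurable_funB; exact: measurable_funM.
by under eq_fun do rewrite cImM; apply: measurable_funD; exact: measurable_funM.
Qed.

Lemma complex_measurable_cst (a : R[i]) : complex_measurable (fun=> a).
Proof. by split; exact: measurable_cst. Qed.

Lemma complex_measurable_conj f : complex_measurable f ->
  complex_measurable (fun x => conjc (f x)).
Proof.
move=> [fr fi]; split.
  by under eq_fun do rewrite cRe_conj.
by under eq_fun do rewrite cIm_conj; exact: measurable_funN.
Qed.

Lemma complex_measurable_real (w : T -> R) : measurable_fun setT w ->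
  complex_measurable (fun x => (w x)%:C%C).
Proof. by move=> mw; split => //=; exact: measurable_cst. Qed.

Lemma measurable_cabs f : complex_measurable f ->
  measurable_fun setT (fun x => cabs (f x)).
Proof.
move=> [fr fi].
have -> : (fun x => cabs (f x)) =
    (fun x => Num.sqrt (complex.Re (f x) ^+ 2 + complex.Im (f x) ^+ 2)).
  by apply/funext => x; case: (f x).
apply: (measurableT_comp (continuous_measurable_fun (@sqrt_continuous R))).
by apply: measurable_funD; exact: measurable_funX.
Qed.

Lemma measurable_cabsE f : complex_measurable f ->
  measurable_fun setT (fun x => (cabs (f x))%:E).
Proof. by move=> mf; apply/measurable_EFinP; exact: measurable_cabs. Qed.

End ComplexMeasurable.

Lemma complex_measurable_comp (R : realType) d d' (T : measurableType d)
    (T' : measurableType d') (f : T' -> R[i]) (h : T -> T') :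
  measurable_fun setT h -> complex_measurable f ->
  complex_measurable (fun x => f (h x)).
Proof.
by move=> mh [fr fi]; split; [exact: (measurableT_comp fr)|exact: (measurableT_comp fi)].
Qed.

Lemma ae_impl d (T : measurableType d) (R : realType)
    (mu : {measure set T -> \bar R}) (P Q : T -> Prop) :
  {ae mu, forall x, P x} -> (forall x, P x -> Q x) -> {ae mu, forall x, Q x}.
Proof. by move=> aeP PQ; apply: filterS aeP. Qed.

Lemma ae_and d (T : measurableType d) (R : realType)
    (mu : {measure set T -> \bar R}) (P Q : T -> Prop) :
  {ae mu, forall x, P x} -> {ae mu, forall x, Q x} ->
  {ae mu, forall x, P x /\ Q x}.
Proof. by move=> aeP aeQ; apply: filterS2 aeP aeQ. Qed.

Section RealIntegral.
Local Open Scope ereal_scope.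
Context (R : realType) d (T : measurableType d).
Variable mu : {measure set T -> \bar R}.
Implicit Types h : T -> R.

Lemma fineB_opp (a b : \bar R) : 0 <= a -> 0 <= b -> (fine (a - b) = - fine (b - a))%R.
Proof.
by case: a => [a| |]; case: b => [b| |] //= _ _; rewrite ?oppr0// opprB.
Qed.

Lemma RintegralN h : Rintegral mu setT (fun x => - h x)%R = (- Rintegral mu setT h)%R.
Proof.
rewrite /Rintegral integralE [in RHS]integralE.
rewrite (_ : (fun x => (- h x)%:E) = \- (EFin \o h))//.
by rewrite funeposN funenegN fineB_opp//; exact: integral_ge0.
Qed.

Lemma normr_Rintegral_le h : measurable_fun setT h ->
  (`|Rintegral mu setT h|)%:E <= \int[mu]_(x in setT) (`|h x|)%:E.
Proof.
move=> mh; have mh' : measurable_fun setT (EFin \o h) by exact/measurable_EFinP.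
apply: le_trans (le_abse_integral mu measurableT mh').
rewrite /Rintegral; case: (\int[mu]_(x in setT) (h x)%:E) => [r| |] //=.
- by rewrite normr0 leey.
- by rewrite normr0 leey.
Qed.

Lemma ae_eq_Rintegral h h' : measurable_fun setT h -> measurable_fun setT h' ->
  {ae mu, forall x, h x = h' x} -> Rintegral mu setT h = Rintegral mu setT h'.
Proof.
move=> mh mh' hh'; rewrite /Rintegral; congr fine; apply: ae_eq_integral => //.
- exact/measurable_EFinP.
- exact/measurable_EFinP.
- by apply: filterS hh' => x -> _.
Qed.

End RealIntegral.

Section ComplexIntegral.
Local Open Scope ereal_scope.
Context (R : realType) (G : topologicalGroupType).
Variable mu : {measure set (borel G) -> \bar R}.
Implicit Types f g : G -> R[i].

Lemma cintegrableP f :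
  cintegrable mu f <-> cmeasurable f /\
    \int[mu]_(x in [set: borel G]) (cabs (f x))%:E < +oo.
Proof.
split.
  move=> [/integrableP[fr ifr] /integrableP[fi ifi]].
  have mf : cmeasurable f by split; exact/measurable_EFinP.
  split => //.
  apply: (@le_lt_trans _ _ (\int[mu]_(x in [set: borel G])
    (`|(complex.Re (f x))%:E| + `|(complex.Im (f x))%:E|))).
    apply: ge0_le_integral => //.
    - by move=> x _; rewrite lee_fin cabs_ge0.
    - exact: measurable_cabsE.
    - by apply: emeasurable_funD; exact: measurableT_comp.
    - by move=> x _; rewrite /= -EFinD lee_fin cabs_le.
  rewrite ge0_integralD//; try exact: measurableT_comp.
  exact: lte_add_pinfty.
move=> [[fr fi] ffin]; split; apply/integrableP; split.
- exact/measurable_EFinP.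
- apply: le_lt_trans ffin; apply: ge0_le_integral => //.
  + by apply: measurableT_comp => //; exact/measurable_EFinP.
  + exact: (@measurable_cabsE R _ (borel G) f).
  + by move=> x _; rewrite /= lee_fin normr_Re_le.
- exact/measurable_EFinP.
- apply: le_lt_trans ffin; apply: ge0_le_integral => //.
  + by apply: measurableT_comp => //; exact/measurable_EFinP.
  + exact: (@measurable_cabsE R _ (borel G) f).
  + by move=> x _; rewrite /= lee_fin normr_Im_le.
Qed.

(** The constant 2 comes from estimating the real and imaginary parts separately. *)
Lemma cabs_cintegral_le f : cmeasurable f ->
  (cabs (cintegral mu f))%:E <=
    2%:E * \int[mu]_(x in [set: borel G]) (cabs (f x))%:E.
Proof.
move=> mf; have [fr fi] := mf.
have mabs := @measurable_cabsE R _ (borel G) f mf.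
apply: (@le_trans _ _ ((`|complex.Re (cintegral mu f)|)%:E +
    (`|complex.Im (cintegral mu f)|)%:E)).
  by rewrite -EFinD lee_fin cabs_le.
rewrite (_ : 2%:E = 1 + 1)// ge0_muleDl// mul1e; apply: leeD.
  apply: (le_trans (normr_Rintegral_le mu fr)).
  apply: ge0_le_integral => //.
  - by apply/measurable_EFinP; exact: measurableT_comp.
  - by move=> x _; rewrite lee_fin normr_Re_le.
apply: (le_trans (normr_Rintegral_le mu fi)).
apply: ge0_le_integral => //.
- by apply/measurable_EFinP; exact: measurableT_comp.
- by move=> x _; rewrite lee_fin normr_Im_le.
Qed.

Lemma ae_eq_cintegral f g : cmeasurable f -> cmeasurable g ->
  ae_equal mu f g -> cintegral mu f = cintegral mu g.
Proof.
move=> [fr fi] [gr gi] fg; rewrite /cintegral; congr Complex.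
  by apply: ae_eq_Rintegral => //; apply: (ae_impl fg) => x ->.
by apply: ae_eq_Rintegral => //; apply: (ae_impl fg) => x ->.
Qed.

Lemma cintegralD f g : cintegrable mu f -> cintegrable mu g ->
  cintegral mu (fun x => f x + g x)%R = (cintegral mu f + cintegral mu g)%R.
Proof.
move=> [fr fi] [gr gi]; apply: complex_ext; rewrite ?cReD ?cImD /=.
  by rewrite -RintegralD//; apply: eq_Rintegral => x _; rewrite cReD.
by rewrite -RintegralD//; apply: eq_Rintegral => x _; rewrite cImD.
Qed.

Lemma cintegralZ (a : R[i]) f : cintegrable mu f ->
  cintegral mu (fun x => a * f x)%R = (a * cintegral mu f)%R.
Proof.
move=> [fr fi].
have Z (k : R) (h : borel G -> R) (ih : mu.-integrable [set: borel G] (EFin \o h)) :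
    mu.-integrable [set: borel G] (EFin \o (fun x => k * h x)%R).
  exact: (integrableZl measurableT k ih).
apply: complex_ext.
  rewrite cReM; transitivity (Rintegral mu [set: borel G] (fun x =>
      complex.Re a * complex.Re (f x) - complex.Im a * complex.Im (f x))%R).
    by apply: eq_Rintegral => x _; rewrite cReM.
  rewrite RintegralB//; [|exact: Z|exact: Z].
  by congr (_ - _)%R; exact: RintegralZl.
rewrite cImM; transitivity (Rintegral mu [set: borel G] (fun x =>
    complex.Re a * complex.Im (f x) + complex.Im a * complex.Re (f x))%R).
  by apply: eq_Rintegral => x _; rewrite cImM.
rewrite RintegralD//; [|exact: Z|exact: Z].
by congr (_ + _)%R; exact: RintegralZl.
Qed.

Lemma cintegral_conj f :
  cintegral mu (fun x => conjc (f x)) = conjc (cintegral mu f).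
Proof.
rewrite /cintegral /=; congr Complex.
  by apply: eq_Rintegral => x _; rewrite cRe_conj.
by rewrite -RintegralN; apply: eq_Rintegral => x _; rewrite cIm_conj.
Qed.

Lemma cintegral_preserving (h : G -> G) f :
  measure_preserving mu (h : borel G -> borel G) -> cmeasurable f ->
  cintegral mu (fun x => f (h x)) = cintegral mu f.
Proof.
move=> hp [fr fi]; rewrite /cintegral /Rintegral; congr Complex; congr fine.
  apply: (@integral_preserving _ _ _ mu h (fun x => (complex.Re (f x))%:E)) => //.
  exact/measurable_EFinP.
apply: (@integral_preserving _ _ _ mu h (fun x => (complex.Im (f x))%:E)) => //.
exact/measurable_EFinP.
Qed.

End ComplexIntegral.

Section Fubini.
Local Open Scope ereal_scope.
Context (R : realType) (G : topologicalGroupType).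
Variables (mu : {measure set (borel G) -> \bar R}) (K : nat -> set G).
Hypothesis he : haar_exhaustion mu K.

Let bGG := borel (G * G)%type.

Lemma measurable_Rintegral_slice (h : G * G -> R) :
  measurable_fun [set: bGG] (h : bGG -> R) ->
  measurable_fun [set: borel G]
    (fun x : borel G => Rintegral mu [set: borel G] (fun y => h (x, y))).
Proof.
move=> mh; have mh' : measurable_fun [set: bGG] (EFin \o h : bGG -> \bar R).
  exact/measurable_EFinP.
have tp := tonelli_haar he (funepos_ge0 _) (measurable_funepos mh').
have tn := tonelli_haar he (funeneg_ge0 _) (measurable_funeneg mh').
apply: (measurableT_comp (fine_measurable measurableT)).
under eq_fun do rewrite integralE.
apply: emeasurable_funB.
  have := tonelli_measl tp.
  by apply: eq_measurable_fun => x _; apply: eq_integral => y _; rewrite !funeposE.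
have := tonelli_measl tn.
by apply: eq_measurable_fun => x _; apply: eq_integral => y _; rewrite !funenegE.
Qed.

(** Subtract Tonelli's theorem for the positive and the negative part.  The
    partial integrals of both are finite almost everywhere, and only there is
    [fine] of the difference the difference. *)
Lemma Rintegral_fubini (h : G * G -> R) :
  measurable_fun [set: bGG] (h : bGG -> R) ->
  \int[mu]_(x in [set: borel G]) \int[mu]_(y in [set: borel G]) (`|h (x, y)|)%:E < +oo ->
  Rintegral mu [set: borel G] (fun x => Rintegral mu [set: borel G] (fun y => h (x, y))) =
  Rintegral mu [set: borel G] (fun y => Rintegral mu [set: borel G] (fun x => h (x, y))).
Proof.
move=> mh hfin; have mh' : measurable_fun [set: bGG] (EFin \o h : bGG -> \bar R).
  exact/measurable_EFinP.
pose hp := (EFin \o h)^\+; pose hn := (EFin \o h)^\-.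
have hp0 z : 0 <= hp z by exact: funepos_ge0.
have hn0 z : 0 <= hn z by exact: funeneg_ge0.
have tp : tonelli_fun mu mu hp := tonelli_haar he hp0 (measurable_funepos mh').
have tn : tonelli_fun mu mu hn := tonelli_haar he hn0 (measurable_funeneg mh').
have th : tonelli_fun mu mu (fun z => (`|h z|)%:E).
  apply: (tonelli_haar he) => //.
  by apply/measurable_EFinP; exact: measurableT_comp.
have hple z : hp z <= (`|h z|)%:E.
  by rewrite /hp funeposE /= -EFin_max lee_fin ge_max ler_norm normr_ge0.
have hnle z : hn z <= (`|h z|)%:E.
  by rewrite /hn funenegE /= -EFin_max lee_fin ge_max -normrN ler_norm normr_ge0.
have hE z : (h z)%:E = hp z - hn z.
  by have /(congr1 (@^~ z)) := funeposneg (EFin \o h).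
pose A x := \int[mu]_(y in [set: borel G]) hp (x, y).
pose B x := \int[mu]_(y in [set: borel G]) hn (x, y).
pose A' y := \int[mu]_(x in [set: borel G]) hp (x, y).
pose B' y := \int[mu]_(x in [set: borel G]) hn (x, y).
have bound (g : G * G -> \bar R) : tonelli_fun mu mu g -> (forall z, g z <= (`|h z|)%:E) ->
    \int[mu]_(x in [set: borel G]) \int[mu]_(y in [set: borel G]) g (x, y) < +oo.
  move=> tg gh; apply: le_lt_trans hfin; apply: ge0_le_integral => //.
  - by move=> x _; apply: integral_ge0 => y _; exact: (tonelli_ge0 tg).
  - exact: tonelli_measl tg.
  - exact: tonelli_measl th.
  - move=> x _; apply: ge0_le_integral => //.
    + by move=> y _; exact: (tonelli_ge0 tg).
    + exact: (measurable_sliceY _ (tonelli_meas tg)).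
    + exact: (measurable_sliceY _ (tonelli_meas th)).
have Afin := bound _ tp hple; have Bfin := bound _ tn hnle.
have sub (a b : G -> \bar R) : (forall x, 0 <= a x) -> (forall x, 0 <= b x) ->
    measurable_fun [set: borel G] (a : borel G -> \bar R) ->
    measurable_fun [set: borel G] (b : borel G -> \bar R) ->
    \int[mu]_(x in [set: borel G]) a x < +oo ->
    \int[mu]_(x in [set: borel G]) b x < +oo ->
    Rintegral mu [set: borel G] (fun x => fine (a x - b x)) =
      fine (\int[mu]_(x in [set: borel G]) a x - \int[mu]_(x in [set: borel G]) b x).
  move=> a0 b0 ma mb afin bfin.
  have ia : mu.-integrable [set: borel G] (a : borel G -> \bar R).
    by apply/integrableP; split => //; under eq_integral do rewrite gee0_abs//.
  have ib : mu.-integrable [set: borel G] (b : borel G -> \bar R).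
    by apply/integrableP; split => //; under eq_integral do rewrite gee0_abs//.
  rewrite /Rintegral -integralB//; congr fine; apply: ae_eq_integral => //.
  - apply: measurableT_comp => //.
    apply: (measurableT_comp (fine_measurable measurableT)).
    exact: emeasurable_funB.
  - exact: emeasurable_funB.
  - have aefin := ae_and (integrable_ae measurableT ia) (integrable_ae measurableT ib).
    apply: (ae_impl aefin) => x [/(_ I) ax /(_ I) bx] _.
    by rewrite fineK// fin_numB ax bx.
have A0 x : 0 <= A x by exact: integral_ge0.
have B0 x : 0 <= B x by exact: integral_ge0.
have A'0 x : 0 <= A' x by exact: integral_ge0.
have B'0 x : 0 <= B' x by exact: integral_ge0.
have mA := tonelli_measl tp; have mB := tonelli_measl tn.
have mA' := tonelli_measr tp; have mB' := tonelli_measr tn.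
have AA' : \int[mu]_(x in [set: borel G]) A x = \int[mu]_(y in [set: borel G]) A' y :=
  tonelli_swap tp.
have BB' : \int[mu]_(x in [set: borel G]) B x = \int[mu]_(y in [set: borel G]) B' y :=
  tonelli_swap tn.
have A'fin : \int[mu]_(x in [set: borel G]) A' x < +oo by rewrite -AA'.
have B'fin : \int[mu]_(x in [set: borel G]) B' x < +oo by rewrite -BB'.
have S := sub A B A0 B0 mA mB Afin Bfin.
have S' := sub A' B' A'0 B'0 mA' mB' A'fin B'fin.
have L : (fun x => Rintegral mu [set: borel G] (fun y => h (x, y))) =
    (fun x => fine (A x - B x)).
  apply/funext => x; rewrite /Rintegral integralE; congr (fine (_ - _)).
    by apply: eq_integral => y _; rewrite /hp !funeposE.
  by apply: eq_integral => y _; rewrite /hn !funenegE.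
have L' : (fun y => Rintegral mu [set: borel G] (fun x => h (x, y))) =
    (fun y => fine (A' y - B' y)).
  apply/funext => y; rewrite /Rintegral integralE; congr (fine (_ - _)).
    by apply: eq_integral => x _; rewrite /hp !funeposE.
  by apply: eq_integral => x _; rewrite /hn !funenegE.
rewrite L L'; apply: (etrans S); apply: (etrans _ (esym S')).
by rewrite AA' BB'.
Qed.

Lemma cmeasurable_cintegral_slice (h : G * G -> R[i]) :
  complex_measurable (h : bGG -> R[i]) ->
  cmeasurable (fun x => cintegral mu (fun y => h (x, y))).
Proof. by move=> [hr hi]; split;
  [exact: (measurable_Rintegral_slice hr)|exact: (measurable_Rintegral_slice hi)].
Qed.

Lemma cintegral_fubini (h : G * G -> R[i]) :
  complex_measurable (h : bGG -> R[i]) ->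
  \int[mu]_(x in [set: borel G]) \int[mu]_(y in [set: borel G]) (cabs (h (x, y)))%:E < +oo ->
  cintegral mu (fun x => cintegral mu (fun y => h (x, y))) =
  cintegral mu (fun y => cintegral mu (fun x => h (x, y))).
Proof.
move=> mh hfin; have [hr hi] := mh.
have tc : tonelli_fun mu mu (fun z => (cabs (h z))%:E).
  apply: (tonelli_haar he); first by move=> z; rewrite lee_fin cabs_ge0.
  exact: (@measurable_cabsE R _ bGG h).
have bound (g : G * G -> R) : measurable_fun [set: bGG] (g : bGG -> R) ->
    (forall z, `|g z| <= cabs (h z))%R ->
    \int[mu]_(x in [set: borel G]) \int[mu]_(y in [set: borel G]) (`|g (x, y)|)%:E < +oo.
  move=> mg gh.
  have tg : tonelli_fun mu mu (fun z => (`|g z|)%:E).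
    apply: (tonelli_haar he) => //.
    by apply/measurable_EFinP; exact: measurableT_comp.
  apply: le_lt_trans hfin; apply: ge0_le_integral => //.
  - by move=> x _; apply: integral_ge0 => y _; rewrite lee_fin.
  - exact: tonelli_measl tg.
  - exact: tonelli_measl tc.
  - move=> x _; apply: ge0_le_integral => //.
    + exact: (@measurable_sliceY _ _ _ _ (fun z => (`|g z|)%:E) x (tonelli_meas tg)).
    + exact: (@measurable_sliceY _ _ _ _ (fun z => (cabs (h z))%:E) x (tonelli_meas tc)).
    + by move=> y _; rewrite lee_fin.
apply: complex_ext.
  exact: (Rintegral_fubini hr (bound _ hr (fun z => normr_Re_le (h z)))).
exact: (Rintegral_fubini hi (bound _ hi (fun z => normr_Im_le (h z)))).
Qed.

End Fubini.

(** * Complementary Young functions *)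

Section Young.
Local Open Scope ereal_scope.
Context (R : realType).
Variables (Phi Psi : R -> \bar R).
Hypothesis hPhi : complementary_pair Phi Psi.

Let yPhi : young_function Phi. Proof. by case: hPhi. Qed.
Let PsiE y : Psi y = complementary_function Phi y. Proof. by case: hPhi. Qed.
Let Phi0 := young_0 yPhi.
Let Phi_ge0 := young_ge0 yPhi.

Lemma young_shrink (t x : R) : (0 <= t <= 1)%R -> Phi (t * x)%R <= t%:E * Phi x.
Proof.
move=> t01; have := young_convex yPhi x 0 t01.
by rewrite mulr0 addr0 Phi0 mule0 adde0.
Qed.

Lemma young_nondecreasing (x y : R) : (0 <= x <= y)%R -> Phi x <= Phi y.
Proof.
move=> /andP[x0 xy].
have [->|xn0] := eqVneq x 0%R; first by rewrite Phi0.
have xp : (0 < x)%R by rewrite lt_neqAle eq_sym xn0.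
have yp : (0 < y)%R by exact: lt_le_trans xy.
have t01 : (0 <= x / y <= 1)%R.
  by rewrite divr_ge0 ?(ltW yp)//= ler_pdivrMr// mul1r.
have := young_shrink y t01; rewrite divfK ?gt_eqF// => /le_trans; apply.
by rewrite -[leRHS]mul1e lee_wpmul2r// lee_fin; case/andP: t01.
Qed.

Lemma conjugate_ge0 y : 0 <= Psi y.
Proof.
rewrite PsiE; apply: ereal_sup_ubound; exists 0%R => //=.
by rewrite mul0r Phi0 sube0.
Qed.

Lemma conjugate_ub (x y : R) : (0 <= x)%R -> (x * `|y|)%:E - Phi x <= Psi y.
Proof. by move=> x0; rewrite PsiE; apply: ereal_sup_ubound; exists x. Qed.

Lemma conjugate_le (y : R) (b : \bar R) :
  (forall x, (0 <= x)%R -> (x * `|y|)%:E - Phi x <= b) -> Psi y <= b.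
Proof. by move=> H; rewrite PsiE; apply: ge_ereal_sup => _ [x x0 <-]; exact: H. Qed.

Lemma conjugate_nondecreasing (x y : R) : (0 <= x <= y)%R -> Psi x <= Psi y.
Proof.
move=> /andP[x0 xy]; apply: conjugate_le => z z0.
apply: le_trans (conjugate_ub y z0); apply: leeB => //.
by rewrite lee_fin ler_wpM2l// !ger0_norm// (le_trans x0).
Qed.

Lemma conjugate_shrink (t y : R) : (0 <= t <= 1)%R -> Psi (t * y)%R <= t%:E * Psi y.
Proof.
move=> /andP[t0 t1]; apply: conjugate_le => x x0.
apply: (@le_trans _ _ (t%:E * ((x * `|y|)%:E - Phi x))); last first.
  by rewrite lee_wpmul2l// conjugate_ub.
have := Phi_ge0 x; case: (Phi x) => [p| |]//= p0.
  rewrite -EFinB -EFinM lee_fin mulrBr normrM (ger0_norm t0) mulrCA lerB//.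
  by rewrite ler_piMl.
by rewrite ?addeNy leNye.
Qed.

Lemma conjugate0 : Psi 0%R = 0.
Proof.
apply/eqP; rewrite eq_le conjugate_ge0 andbT.
have := @conjugate_shrink 0 0; rewrite lexx ler01 => /(_ isT).
by rewrite mul0r mul0e.
Qed.

(** If [1 <= Phi x0] then [Phi] lies above the line [x / x0] beyond [x0], so that
    [x / x0 - Phi x <= 1] for all [x >= 0]. *)
Lemma conjugate_small : exists2 s : R, (0 < s)%R & Psi s <= 1.
Proof.
have /cvgeyPge/(_ 1%R)[M [_ HM]] := young_lim yPhi.
pose x0 := (`|M| + 1)%R.
have x00 : (0 < x0)%R by rewrite /x0 ltr_wpDl.
have Mx0 : (M < x0)%R by rewrite /x0 (le_lt_trans (ler_norm _))// ltrDl.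
have Px0 : 1 <= Phi x0 by exact: HM.
exists (x0^-1)%R; first by rewrite invr_gt0.
have i0 : (0 <= x0^-1)%R by rewrite invr_ge0 ltW.
apply: conjugate_le => x xge0; rewrite (ger0_norm i0).
have [xx0|xx0] := leP x x0.
  apply: (@le_trans _ _ (x / x0)%:E).
    by rewrite -[leRHS]adde0 leeD// leeNl oppe0.
  by rewrite lee_fin ler_pdivrMr// mul1r.
have xp : (0 < x)%R by exact: lt_trans xx0.
have t01 : (0 <= x0 / x <= 1)%R.
  by rewrite divr_ge0 ?(ltW xp) ?(ltW x00)//= ler_pdivrMr// mul1r ltW.
have := young_shrink x t01; rewrite divfK ?gt_eqF// => /(le_trans Px0).
have := Phi_ge0 x; case: (Phi x) => [p| |]//= p0; last by rewrite ?addeNy leNye.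
rewrite -EFinM !lee_fin => h; rewrite lerBlDr.
apply: (@le_trans _ _ p); last by rewrite lerDr.
move: h; rewrite mulrAC ler_pdivlMr// mul1r => h.
by rewrite ler_pdivrMr// mulrC.
Qed.

(** By convexity [Phi] lies above the line [c t / z] for [t >= z], so there
    [t c / z - Phi t <= 0]; for [t <= z] already [t c / z <= c]. *)
Lemma conjugate_slope (z c : R) : (0 < z)%R -> (0 <= c)%R -> c%:E <= Phi z ->
  Psi (c / z)%R <= c%:E.
Proof.
move=> z0 c0 cz; have cz0 : (0 <= c / z)%R by rewrite divr_ge0// ltW.
apply: conjugate_le => t t0; rewrite ger0_norm//.
have [tz|zt] := leP t z.
  apply: (@le_trans _ _ (t * (c / z))%:E).
    by rewrite -[leRHS]adde0 leeD// leeNl oppe0.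
  by rewrite lee_fin mulrCA ler_piMr// ler_pdivrMr// mul1r.
have tp : (0 < t)%R by exact: lt_trans zt.
have t01 : (0 <= z / t <= 1)%R.
  by rewrite divr_ge0 ?(ltW z0)//= ler_pdivrMr// mul1r ltW.
have := young_shrink t t01; rewrite divfK ?gt_eqF// => /(le_trans cz).
have := Phi_ge0 t; case: (Phi t) => [p| |]//= p0; last by rewrite ?addeNy leNye.
rewrite -EFinM !lee_fin => h; rewrite lerBlDr.
apply: (@le_trans _ _ p); last by rewrite lerDr.
move: h; rewrite mulrAC ler_pdivlMr// => h.
by rewrite mulrA ler_pdivrMr// mulrC (mulrC p).
Qed.

End Young.

(** * The Orlicz norm *)

Section MonotoneComposition.
Local Open Scope ereal_scope.
Context (R : realType).

Lemma measurable_monotone_normr (F : R -> \bar R) :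
  (forall x y, (0 <= x <= y)%R -> F x <= F y) ->
  measurable_fun [set: R] (fun r : R => F `|r|%R).
Proof.
move=> ndF; apply: (measurability _ (ErealGenOInfty.measurableE R)) => //.
move=> _ [_ [c ->] <-]; rewrite setTI.
pose I : set R := [set r | (0 <= r)%R /\ c%:E < F r].
have mI : measurable I.
  apply: is_interval_measurable => x y [x0 Fx] [y0 Fy] z /andP[xz zy]; split.
    exact: le_trans xz.
  by apply: lt_le_trans Fx (ndF _ _ _); rewrite x0.
have -> : (fun r : R => F `|r|%R) @^-1` `]c%:E, +oo[ = (fun r : R => `|r|%R) @^-1` I.
  apply/seteqP; split => r /=; rewrite in_itv/= andbT; first by split.
  by case.
rewrite -[X in measurable X]setTI; exact: normr_measurable.
Qed.

Lemma measurable_monotone_comp d (T : measurableType d) (F : R -> \bar R) (g : T -> R) :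
  (forall x y, (0 <= x <= y)%R -> F x <= F y) ->
  measurable_fun setT g -> (forall x, 0 <= g x)%R ->
  measurable_fun setT (fun x => F (g x)).
Proof.
move=> ndF mg g0; rewrite (_ : (fun x => _) = (fun r : R => F `|r|%R) \o g).
  exact: measurableT_comp (measurable_monotone_normr ndF) mg.
by apply/funext => x /=; rewrite ger0_norm.
Qed.

End MonotoneComposition.

Section OrliczNorm.
Local Open Scope ereal_scope.
Context (R : realType) (G : topologicalGroupType).
Variables (mu : {measure set (borel G) -> \bar R}).
Variables (Phi Psi : R -> \bar R).
Hypothesis hPhi : complementary_pair Phi Psi.
Implicit Types f g h : G -> R[i].

Local Notation N := (orlicz_norm mu Psi).
Local Notation "'\intG_' x F" := (\int[mu]_(x in [set: borel G]) F)
  (at level 36, x name, F at level 36).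

(** The test functions in the definition of [orlicz_norm]. *)
Definition admissible h :=
  cmeasurable h /\ \intG_x Psi (cabs (h x)) <= 1.

Lemma measurable_conjugate d (T : measurableType d) (u : T -> R) :
  measurable_fun setT u -> (forall x, 0 <= u x)%R ->
  measurable_fun setT (fun x => Psi (u x)).
Proof.
by move=> mu' u0; apply: measurable_monotone_comp => //;
  exact: (conjugate_nondecreasing hPhi).
Qed.

Lemma measurable_young d (T : measurableType d) (u : T -> R) :
  measurable_fun setT u -> (forall x, 0 <= u x)%R ->
  measurable_fun setT (fun x => Phi (u x)).
Proof.
by move=> mu' u0; apply: measurable_monotone_comp => //;
  exact: (young_nondecreasing hPhi).
Qed.

Lemma admissible0 : admissible (fun=> 0%R).
Proof.
split; first by split; exact: measurable_cst.
rewrite integral0_eq// => x _; rewrite cabs0; exact: (conjugate0 hPhi).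
Qed.

Lemma admissible_real (u : G -> R) :
  measurable_fun [set: borel G] (u : borel G -> R) -> (forall x, 0 <= u x)%R ->
  \intG_x Psi (u x) <= 1 -> admissible (fun x => (u x)%:C%C).
Proof.
move=> mu' u0 Pu; split; first exact: (@complex_measurable_real R _ (borel G)).
rewrite (eq_integral (fun x : borel G => Psi (u x)))// => x _.
by rewrite cabs_real ger0_norm.
Qed.

Lemma admissible_preserving h (T : G -> G) :
  measure_preserving mu (T : borel G -> borel G) -> admissible h ->
  admissible (fun x => h (T x)).
Proof.
move=> mpT [mh Ph]; split.
  exact: (@complex_measurable_comp R _ _ (borel G) (borel G) h T mpT.1 mh).
rewrite (ge0_integral_preserving mpT (F := fun x : borel G => Psi (cabs (h x))))//.
- apply: measurable_conjugate; last by move=> x; exact: cabs_ge0.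
  exact: (@measurable_cabs R _ (borel G)).
- by move=> x; exact: (conjugate_ge0 hPhi).
Qed.

Lemma measurable_cabs_mul f h : cmeasurable f -> cmeasurable h ->
  measurable_fun [set: borel G] (fun x : borel G => (cabs (f x) * cabs (h x))%:E).
Proof.
move=> mf mh; apply/measurable_EFinP; apply: measurable_funM.
  exact: (@measurable_cabs R _ (borel G)).
exact: (@measurable_cabs R _ (borel G)).
Qed.

Lemma orlicz_norm_ub f h : admissible h ->
  \intG_x (cabs (f x) * cabs (h x))%:E <= N f.
Proof.
move=> [mh Ph]; apply: ereal_sup_ubound; exists h => //.
by apply: eq_integral => x _; rewrite cabsM.
Qed.

Lemma orlicz_norm_le f (b : \bar R) :
  (forall h, admissible h -> \intG_x (cabs (f x) * cabs (h x))%:E <= b) ->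
  N f <= b.
Proof.
move=> fb; apply: ge_ereal_sup => _ [h [mh Ph] <-].
under eq_integral do rewrite cabsM.
exact: fb.
Qed.

Lemma orlicz_norm_ge0 f : 0 <= N f.
Proof.
apply: le_trans (orlicz_norm_ub f admissible0).
by apply: integral_ge0 => x _; rewrite lee_fin mulr_ge0// cabs_ge0.
Qed.

Lemma orlicz_norm_mono f g : cmeasurable f -> cmeasurable g ->
  (forall x, cabs (f x) <= cabs (g x))%R -> N f <= N g.
Proof.
move=> mf mg fg; apply: orlicz_norm_le => h hh.
apply: le_trans (orlicz_norm_ub g hh); have [mh _] := hh.
apply: ge0_le_integral => //.
- by move=> x _; rewrite lee_fin mulr_ge0// cabs_ge0.
- exact: measurable_cabs_mul.
- exact: measurable_cabs_mul.
- by move=> x _; rewrite lee_fin ler_wpM2r// cabs_ge0.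
Qed.

Lemma orlicz_norm_ae f g : cmeasurable f -> cmeasurable g ->
  ae_equal mu f g -> N f = N g.
Proof.
suff H f' g' : cmeasurable f' -> cmeasurable g' -> ae_equal mu f' g' -> N f' <= N g'.
  move=> mf mg fg; apply/eqP; rewrite eq_le !H//.
  by apply: (ae_impl fg) => x ->.
move=> mf mg fg; apply: orlicz_norm_le => h hh.
apply: le_trans (orlicz_norm_ub g' hh); have [mh _] := hh.
rewrite le_eqVlt; apply/orP; left; apply/eqP; apply: ge0_ae_eq_integral => //.
- exact: measurable_cabs_mul.
- exact: measurable_cabs_mul.
- by move=> x _; rewrite lee_fin mulr_ge0// cabs_ge0.
- by move=> x _; rewrite lee_fin mulr_ge0// cabs_ge0.
- by apply: (ae_impl fg) => x -> _.
Qed.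

Lemma orlicz_normD f g : cmeasurable f -> cmeasurable g ->
  N (fun x => f x + g x)%R <= N f + N g.
Proof.
move=> mf mg; apply: orlicz_norm_le => h hh; have [mh _] := hh.
apply: le_trans (leeD (orlicz_norm_ub f hh) (orlicz_norm_ub g hh)).
have p0 (u : G -> R[i]) (x : G) : 0 <= (cabs (u x) * cabs (h x))%:E.
  by rewrite lee_fin mulr_ge0// cabs_ge0.
rewrite -ge0_integralD//; last 2 first.
- exact: measurable_cabs_mul.
- exact: measurable_cabs_mul.
apply: ge0_le_integral => //.
- by move=> x _; exact: (p0 (fun x => f x + g x)%R).
- apply: measurable_cabs_mul => //.
  exact: (@complex_measurableD R _ (borel G)).
- by apply: emeasurable_funD; exact: measurable_cabs_mul.
- by move=> x _; rewrite -EFinD lee_fin -mulrDl ler_wpM2r ?cabs_ge0// cabsD.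
Qed.

Lemma orlicz_normZ (a : R[i]) f : cmeasurable f ->
  N (fun x => a * f x)%R = (cabs a)%:E * N f.
Proof.
have ge b g : cmeasurable g -> N (fun x => b * g x)%R <= (cabs b)%:E * N g.
  move=> mg; apply: orlicz_norm_le => h hh; have [mh _] := hh.
  apply: le_trans (lee_wpmul2l _ (orlicz_norm_ub g hh)); last first.
    by rewrite lee_fin cabs_ge0.
  rewrite -ge0_integralZl_EFin ?cabs_ge0//; last 2 first.
  - by move=> x _; rewrite lee_fin mulr_ge0// cabs_ge0.
  - exact: measurable_cabs_mul.
  rewrite le_eqVlt; apply/orP; left; apply/eqP; apply: eq_integral => x _.
  by rewrite -EFinM cabsM mulrA.
move=> mf; apply/eqP; rewrite eq_le ge//=.
have [->|a0] := eqVneq a 0%R.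
  by rewrite cabs0 mul0e orlicz_norm_ge0.
have ca0 : (0 < cabs a)%R.
  rewrite lt_neqAle cabs_ge0 andbT; apply: contra a0 => /eqP/esym/cabs_eq0 ->.
  exact: eqxx.
have maf : cmeasurable (fun x => a * f x)%R.
  exact: (@complex_measurableM R _ (borel G)).
have := ge a^-1%R _ maf.
rewrite (_ : (fun x => a^-1 * (a * f x))%R = f); last first.
  by apply/funext => x; rewrite mulKf.
move=> /(lee_wpmul2l (_ : 0 <= (cabs a)%:E)); rewrite lee_fin => /(_ (ltW ca0)).
rewrite muleA -EFinM -cabsM divff//.
by rewrite /cabs ComplexField.Normc.normc1 mul1e.
Qed.

(** A test function for [f \o T] becomes one for [f] by composing it with the
    inverse [T']; used for translations and inversion. *)
Lemma orlicz_norm_comp f (T T' : G -> G) :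
  measure_preserving mu (T : borel G -> borel G) ->
  measure_preserving mu (T' : borel G -> borel G) -> cancel T T' ->
  cmeasurable f -> N (fun x => f (T x)) <= N f.
Proof.
move=> mpT mpT' TK mf; apply: orlicz_norm_le => h hh.
have hT' := admissible_preserving mpT' hh.
apply: le_trans (orlicz_norm_ub f hT').
have p0 x : 0 <= (cabs (f x) * cabs (h (T' x)))%:E.
  by rewrite lee_fin mulr_ge0// cabs_ge0.
rewrite -(ge0_integral_preserving mpT _ p0); last first.
  by have [mh _] := hT'; exact: measurable_cabs_mul.
by under [leRHS]eq_integral do rewrite TK.
Qed.

End OrliczNorm.

Lemma measurable_inv_ge0 (R : realType) d (T : measurableType d) (u : T -> R) :
  measurable_fun setT u -> (forall x, 0 <= u x) ->
  measurable_fun setT (fun x => (u x)^-1).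
Proof.
move=> mu u0.
rewrite (_ : (fun x => _) = (@powR R ^~ (-1)) \o u); last first.
  by apply/funext => x /=; rewrite powR_inv1.
apply: measurableT_comp => //; exact: measurable_powR.
Qed.

Section OrliczModular.
Local Open Scope ereal_scope.
Context (R : realType) (G : topologicalGroupType).
Variables (mu : {measure set (borel G) -> \bar R}) (K : nat -> set G).
Hypothesis he : haar_exhaustion mu K.
Variables (Phi Psi : R -> \bar R).
Hypothesis hPhi : complementary_pair Phi Psi.
Implicit Types f : G -> R[i].

Local Notation N := (orlicz_norm mu Psi).
Local Notation "'\intG_' x F" := (\int[mu]_(x in [set: borel G]) F)
  (at level 36, x name, F at level 36).

Lemma orlicz_norm_ub_real f (u : G -> R) :
  measurable_fun [set: borel G] (u : borel G -> R) -> (forall x, 0 <= u x)%R ->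
  \intG_x Psi (u x) <= 1 -> \intG_x (cabs (f x) * u x)%:E <= N f.
Proof.
move=> mu' u0 Pu; have := orlicz_norm_ub f (admissible_real mu' u0 Pu).
apply: le_trans; rewrite le_eqVlt; apply/orP; left; apply/eqP.
by apply: eq_integral => x _; rewrite cabs_real ger0_norm.
Qed.

Lemma ge0_integralZ_EFin (k : R) (u : G -> \bar R) : (0 <= k)%R ->
  measurable_fun [set: borel G] (u : borel G -> \bar R) -> (forall x, 0 <= u x) ->
  \intG_x (k%:E * u x) = k%:E * \intG_x (u x).
Proof. by move=> k0 mu' u0; apply: ge0_integralZl_EFin. Qed.

(** If [I], the integral of [c], exceeded 1, then [u = c / (I a|f|)] would be a test
    function, since [Psi u <= c / I] by [conjugate_slope].  Testing [f] against
    it gives [1 / a <= N f]. *)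
Lemma conjugate_duality f (a : R) (c : G -> R) : (0 < a)%R -> cmeasurable f ->
  a%:E * N f < 1 -> measurable_fun [set: borel G] (c : borel G -> R) ->
  (forall x, 0 <= c x)%R -> (forall x, (c x)%:E <= Phi (a * cabs (f x))%R) ->
  \intG_x (c x)%:E < +oo -> \intG_x (c x)%:E <= 1.
Proof.
move=> a0 mf aN mc c0 cF cfin; rewrite leNgt; apply/negP => I1.
have mfabs : measurable_fun [set: borel G] (fun x : borel G => cabs (f x)).
  exact: (@measurable_cabs R _ (borel G)).
have mcE : measurable_fun [set: borel G] (fun x : borel G => (c x)%:E).
  exact/measurable_EFinP.
have cE0 x : 0 <= (c x)%:E by rewrite lee_fin.
pose I := fine (\intG_x (c x)%:E).
have IE : \intG_x (c x)%:E = I%:E.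
  by rewrite fineK// ge0_fin_numE// integral_ge0.
have I1' : (1 < I)%R by move: I1; rewrite IE lte_fin.
have I0 : (0 < I)%R by exact: lt_trans I1'.
have cu0 x : cabs (f x) = 0%R -> c x = 0%R.
  move=> fx0; have := cF x; rewrite fx0 mulr0 (young_0 hPhi.1) lee_fin => cx0.
  by apply/eqP; rewrite eq_le cx0 c0.
pose u x := (I^-1 * (c x / (a * cabs (f x))))%R.
have u0 x : (0 <= u x)%R.
  by rewrite mulr_ge0 ?invr_ge0 ?(ltW I0)// divr_ge0// mulr_ge0 ?cabs_ge0// ltW.
have mu_ : measurable_fun [set: borel G] (u : borel G -> R).
  apply: measurable_funM => //; apply: measurable_funM => //.
  apply: measurable_inv_ge0; last by move=> x; rewrite mulr_ge0 ?cabs_ge0// ltW.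
  exact: measurable_funM.
have Pu x : Psi (u x) <= (I^-1)%:E * (c x)%:E.
  have I01 : (0 <= I^-1 <= 1)%R.
    by rewrite invr_ge0 (ltW I0) invf_le1// ltW.
  apply: (le_trans (conjugate_shrink hPhi _ I01)).
  rewrite lee_wpmul2l ?lee_fin ?invr_ge0 ?(ltW I0)//.
  have [fx0|fx0] := eqVneq (cabs (f x)) 0%R.
    by rewrite fx0 mulr0 invr0 mulr0 (conjugate0 hPhi) lee_fin.
  apply: (conjugate_slope hPhi) => //.
  by rewrite mulr_gt0// lt_neqAle eq_sym fx0 cabs_ge0.
have Pu1 : \intG_x Psi (u x) <= 1.
  apply: (@le_trans _ _ (\intG_x ((I^-1)%:E * (c x)%:E))).
    apply: ge0_le_integral => //.
    - by move=> x _; exact: (conjugate_ge0 hPhi).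
    - exact: (measurable_conjugate hPhi).
    - exact: measurable_funeM.
  rewrite ge0_integralZ_EFin// ?invr_ge0 ?(ltW I0)//.
  by rewrite IE -EFinM mulVf ?gt_eqF.
have := orlicz_norm_ub_real f mu_ u0 Pu1.
rewrite (eq_integral (fun x : borel G => ((a * I)^-1)%:E * (c x)%:E)); last first.
  move=> x _; rewrite -EFinM; congr EFin; rewrite /u.
  have [fx0|fx0] := eqVneq (cabs (f x)) 0%R.
    by rewrite fx0 (cu0 _ fx0) !mulr0 mul0r.
  by field; rewrite fx0 !gt_eqF.
have aI : (0 < a * I)%R by exact: mulr_gt0.
rewrite ge0_integralZ_EFin// ?invr_ge0 ?(ltW aI)// IE -EFinM.
rewrite invfM -mulrA mulVf ?gt_eqF// mulr1 => aN'.
have : 1 <= a%:E * N f.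
  have := lee_wpmul2l (_ : 0 <= a%:E) aN'; rewrite lee_fin => /(_ (ltW a0)).
  by rewrite -EFinM divff ?gt_eqF.
by rewrite leNgt aN.
Qed.

(** [conjugate_duality] applies to the integrable truncations
    [min (Phi (a|f|), m)] on [K m]; their integrals are at most 1, and
    monotone convergence gives the same bound for [Phi (a|f|)]. *)
Lemma orlicz_norm_modular f : cmeasurable f -> N f < +oo ->
  exists2 a : R, (0 < a)%R & \intG_x Phi (a * cabs (f x))%R < +oo.
Proof.
move=> mf Nf.
have Nfin : N f \is a fin_num by rewrite ge0_fin_numE// (orlicz_norm_ge0 _ hPhi).
pose n := fine (N f).
have n0 : (0 <= n)%R by rewrite fine_ge0// (orlicz_norm_ge0 _ hPhi).
pose a := ((n + 1)^-1)%R.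
have a0 : (0 < a)%R by rewrite invr_gt0 ltr_wpDl.
exists a => //; apply: (@le_lt_trans _ _ 1); last exact: ltry.
have aN : a%:E * N f < 1.
  rewrite -(fineK Nfin) -EFinM lte_fin mulrC ltr_pdivrMr ?mul1r ?ltrDl//.
  by rewrite ltr_wpDl.
pose F x := Phi (a * cabs (f x))%R.
have F0 x : 0 <= F x by exact: (young_ge0 hPhi.1).
have mF : measurable_fun [set: borel G] (F : borel G -> \bar R).
  apply: (measurable_young hPhi).
    apply: measurable_funM => //; exact: (@measurable_cabs R _ (borel G)).
  by move=> x; rewrite mulr_ge0 ?cabs_ge0// ltW.
pose c m x := (fine (mine (F x) m%:R%:E) * \1_(K m) x)%R.
have minfin m x : mine (F x) m%:R%:E \is a fin_num.
  rewrite ge0_fin_numE; last by rewrite le_min F0 lee_fin ler0n.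
  by rewrite gt_min ltry orbT.
have oK m : open (K m) by have [] := he_subgroup he m.
have mK m : measurable (K m : set (borel G)) by exact: borel_open.
have mc m : measurable_fun [set: borel G] (c m : borel G -> R).
  apply: measurable_funM; last exact: measurable_indic.
  apply: (measurableT_comp (fine_measurable measurableT)).
  by apply: measurable_mine => //; exact: measurable_cst.
have c0 m x : (0 <= c m x)%R.
  by rewrite mulr_ge0 ?indicE// fine_ge0// le_min F0 lee_fin ler0n.
have cF m x : (c m x)%:E <= F x.
  rewrite /c indicE; case: (x \in K m); last by rewrite mulr0.
  by rewrite mulr1 fineK// ge_min lexx.
have cfin m : \intG_x (c m x)%:E < +oo.
  apply: (@le_lt_trans _ _ (\intG_x (m%:R%:E * (\1_(K m) x)%:E))).
    apply: ge0_le_integral => //.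
    - by move=> x _; rewrite lee_fin.
    - exact/measurable_EFinP.
    - by apply: measurable_funeM; apply/measurable_EFinP; exact: measurable_indic.
    - move=> x _; rewrite -EFinM lee_fin ler_wpM2r ?indicE//.
      by rewrite -lee_fin fineK// ge_min lexx orbT.
  have mI : measurable_fun [set: borel G] (fun x : borel G => (\1_(K m) x)%:E : \bar R).
    by apply/measurable_EFinP; exact: measurable_indic.
  have I0 (x : G) : 0 <= (\1_(K m) x)%:E :> \bar R by rewrite lee_fin indicE.
  rewrite (ge0_integralZ_EFin (ler0n R m) mI I0) integral_indic// setIT.
  rewrite lte_mul_pinfty// ?lee_fin//; apply: (haar_compact_lty (he_haar he)).
  by have [] := he_subgroup he m.
have c1 m : \intG_x (c m x)%:E <= 1.
  by apply: (conjugate_duality a0 mf aN) => //; exact: cF.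
have cl x : (c m x)%:E @[m --> \oo] --> F x.
  have [k Kx] := exhaustionP he x.
  have := F0 x; case E : (F x) => [r| |]// _.
    apply: cvg_near_cst; near=> m.
    have km : (k <= m)%N by near: m; exact: nbhs_infty_ge.
    rewrite /c indicE mem_set ?mulr1; last exact: (exhaustion_le he km).
    rewrite fineK// E; apply/eqP; rewrite eq_le ge_min lexx/= le_min lexx lee_fin.
    by near: m; exact: nbhs_infty_ger.
  apply/cvgeyPge => A; near=> m.
  have km : (k <= m)%N by near: m; exact: nbhs_infty_ge.
  rewrite /c indicE mem_set ?mulr1; last exact: (exhaustion_le he km).
  rewrite fineK// E le_min leey lee_fin.
  by near: m; exact: nbhs_infty_ger.
have ndc x : nondecreasing_seq (fun m => (c m x)%:E).
  move=> m m' mm'; rewrite lee_fin /c ler_pM ?indicE//.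
  - by rewrite fine_ge0// le_min F0 lee_fin ler0n.
  - by rewrite fine_le// le_min !ge_min lexx/= lee_fin ler_nat mm' orbT.
  - rewrite ler_nat; have [/set_mem xK|//] := boolP (x \in K m).
    by rewrite mem_set//; exact: (exhaustion_le he mm').
rewrite (_ : \intG_x _ = limn (fun m => \intG_x (c m x)%:E)).
  apply: lime_le; last exact: nearW.
  apply: ereal_nondecreasing_is_cvgn => m m' mm'; apply: ge0_le_integral => //.
  - by move=> x _; rewrite lee_fin.
  - exact/measurable_EFinP.
  - exact/measurable_EFinP.
  - by move=> x _; exact: ndc.
rewrite -monotone_convergence//; last 2 first.
- by move=> m; exact/measurable_EFinP.
- by move=> m x _; rewrite lee_fin.
by apply: eq_integral => x _; apply/esym/cvg_lim => //; exact: cl.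
Unshelve. all: by end_near. Qed.

End OrliczModular.

(** * Convolution *)

Section Convolution.
Local Open Scope ereal_scope.
Context (R : realType) (G : topologicalGroupType).
Variables (mu : {measure set (borel G) -> \bar R}) (K : nat -> set G).
Hypothesis he : haar_exhaustion mu K.
Implicit Types f g : G -> R[i].
Let bGG := borel (G * G)%type.

Local Notation "'\intG_' x F" := (\int[mu]_(x in [set: borel G]) F)
  (at level 36, x name, F at level 36).

Lemma measurable_fstG : measurable_fun [set: bGG] ((fun z : G * G => z.1) : bGG -> borel G).
Proof. by apply: (@borel_continuous (G * G)%type G) => z; exact: cvg_fst. Qed.

Lemma measurable_sndG : measurable_fun [set: bGG] ((fun z : G * G => z.2) : bGG -> borel G).
Proof. by apply: (@borel_continuous (G * G)%type G) => z; exact: cvg_snd. Qed.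

Lemma measurable_mulVl :
  measurable_fun [set: bGG] ((fun z : G * G => (z.2^-1 * z.1)%g) : bGG -> borel G).
Proof. exact: (borel_continuous (@continuous_mulVl G)). Qed.

Lemma preserving_mulVr x :
  measure_preserving mu ((fun y : G => (y^-1 * x)%g) : borel G -> borel G).
Proof.
exact: (measure_preserving_comp (preserving_mulr he x) (preserving_inv he)).
Qed.

Lemma integral_convolution (p q : G -> \bar R) :
  (forall x, 0 <= p x) -> (forall x, 0 <= q x) ->
  measurable_fun [set: borel G] (p : borel G -> \bar R) ->
  measurable_fun [set: borel G] (q : borel G -> \bar R) ->
  \intG_x (\intG_y (p y * q (y^-1 * x)%g)) = \intG_x (p x) * \intG_x (q x).
Proof.
move=> p0 q0 mp mq.
have t : tonelli_fun mu mu (fun z => p z.2 * q (z.2^-1 * z.1)%g).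
  apply: (tonelli_haar he); first by move=> z; rewrite mule_ge0.
  apply: emeasurable_funM.
    exact: (measurableT_comp mp measurable_sndG).
  exact: (measurableT_comp mq measurable_mulVl).
rewrite (tonelli_swap t) /=.
rewrite (eq_integral (fun y : borel G => p y * \intG_x (q x))); last first.
  move=> y _; rewrite ge0_integralZl//.
    by rewrite (ge0_integral_preserving (preserving_mull he y^-1%g) mq q0).
  exact: (measurableT_comp mq (preserving_mull he y^-1%g).1).
by rewrite ge0_integralZr// integral_ge0.
Qed.

Lemma measurable_convolution_integrand f g : cmeasurable f -> cmeasurable g ->
  complex_measurable ((fun z : G * G => f z.2 * g (z.2^-1 * z.1)%g)%R : bGG -> R[i]).
Proof.
move=> mf mg; apply: complex_measurableM.
  exact: (@complex_measurable_comp R _ _ bGG (borel G) f _ measurable_sndG mf).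
exact: (@complex_measurable_comp R _ _ bGG (borel G) g _ measurable_mulVl mg).
Qed.

Lemma measurable_convolution f g : cmeasurable f -> cmeasurable g ->
  cmeasurable (convolution mu f g).
Proof.
move=> mf mg.
exact: (cmeasurable_cintegral_slice he (measurable_convolution_integrand mf mg)).
Qed.

Lemma measurable_convolution_slice f g x : cmeasurable f -> cmeasurable g ->
  cmeasurable (fun y => f y * g (y^-1 * x)%g)%R.
Proof.
move=> mf mg; apply: (@complex_measurableM R _ (borel G)) => //.
exact: (@complex_measurable_comp R _ _ (borel G) (borel G) g _ (preserving_mulVr x).1 mg).
Qed.

(** The convolution of the moduli.  It is extended real valued, so that estimates
    can be made before integrability is known. *)
Definition abs_convolution f g (x : G) : \bar R :=
  \intG_y (cabs (f y) * cabs (g (y^-1 * x)%g))%:E.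

Lemma tonelli_abs_convolution f g : cmeasurable f -> cmeasurable g ->
  tonelli_fun mu mu (fun z => (cabs (f z.2) * cabs (g (z.2^-1 * z.1)%g))%:E).
Proof.
move=> mf mg; apply: (tonelli_haar he).
  by move=> z; rewrite lee_fin mulr_ge0 ?cabs_ge0.
have := @measurable_cabsE R _ bGG _ (measurable_convolution_integrand mf mg).
by apply: eq_measurable_fun => z _; rewrite cabsM.
Qed.

Lemma abs_convolution_ge0 f g x : 0 <= abs_convolution f g x.
Proof. by apply: integral_ge0 => y _; rewrite lee_fin mulr_ge0 ?cabs_ge0. Qed.

Lemma measurable_abs_convolution f g : cmeasurable f -> cmeasurable g ->
  measurable_fun [set: borel G] (abs_convolution f g : borel G -> \bar R).
Proof. by move=> mf mg; exact: (tonelli_measl (tonelli_abs_convolution mf mg)). Qed.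

Lemma integral_abs_convolution f g : cmeasurable f -> cmeasurable g ->
  \intG_x (abs_convolution f g x) =
  \intG_x (cabs (f x))%:E * \intG_x (cabs (g x))%:E.
Proof.
move=> mf mg; rewrite -integral_convolution//.
- by move=> x; rewrite lee_fin cabs_ge0.
- by move=> x; rewrite lee_fin cabs_ge0.
- exact: (@measurable_cabsE R _ (borel G)).
- exact: (@measurable_cabsE R _ (borel G)).
Qed.

Lemma cabs_convolution_le f g x : cmeasurable f -> cmeasurable g ->
  (cabs (convolution mu f g x))%:E <= 2%:E * abs_convolution f g x.
Proof.
move=> mf mg; apply: (le_trans (cabs_cintegral_le mu (measurable_convolution_slice x mf mg))).
rewrite le_eqVlt; apply/orP; left; apply/eqP; congr (_ * _).
by apply: eq_integral => y _; rewrite cabsM.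
Qed.

Lemma ae_convolution_integrable f g : cmeasurable f -> cmeasurable g ->
  \intG_x (cabs (f x))%:E < +oo -> \intG_x (cabs (g x))%:E < +oo ->
  {ae mu, forall x, cintegrable mu (fun y : G => f y * g (y^-1 * x)%g)%R}.
Proof.
move=> mf mg ffin gfin.
have iA : mu.-integrable [set: borel G] (abs_convolution f g : borel G -> \bar R).
  apply/integrableP; split; first exact: measurable_abs_convolution.
  under eq_integral do rewrite gee0_abs ?abs_convolution_ge0//.
  rewrite integral_abs_convolution// lte_mul_pinfty//.
    by apply: integral_ge0 => x _; rewrite lee_fin cabs_ge0.
  by rewrite ge0_fin_numE// integral_ge0// => x _; rewrite lee_fin cabs_ge0.
apply: (ae_impl (integrable_ae measurableT iA)) => x /(_ I) Ax.
apply/cintegrableP; split; first exact: measurable_convolution_slice.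
under eq_integral do rewrite cabsM.
by rewrite -ge0_fin_numE// abs_convolution_ge0.
Qed.

End Convolution.

Section ConvolutionOrlicz.
Local Open Scope ereal_scope.
Context (R : realType) (G : topologicalGroupType).
Variables (mu : {measure set (borel G) -> \bar R}) (K : nat -> set G).
Hypothesis he : haar_exhaustion mu K.
Variables (Phi Psi : R -> \bar R).
Hypothesis hPhi : complementary_pair Phi Psi.
Implicit Types f g h : G -> R[i].
Let bGG := borel (G * G)%type.

Local Notation N := (orlicz_norm mu Psi).
Local Notation "'\intG_' x F" := (\int[mu]_(x in [set: borel G]) F)
  (at level 36, x name, F at level 36).

Let tonelli3 f g h : cmeasurable f -> cmeasurable g -> cmeasurable h ->
  tonelli_fun mu mu (fun z : G * G =>
    (cabs (f z.2) * cabs (g (z.2^-1 * z.1)%g))%:E * (cabs (h z.1))%:E).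
Proof.
move=> mf mg mh; apply: (tonelli_haar he).
  by move=> z; rewrite mule_ge0// lee_fin ?mulr_ge0 ?cabs_ge0.
apply: emeasurable_funM; first exact: (tonelli_meas (tonelli_abs_convolution he mf mg)).
apply: (measurable_cabsE (f := (fun z => h z.1) : bGG -> R[i])).
exact: (@complex_measurable_comp R _ _ bGG (borel G) h _ (@measurable_fstG G) mh).
Qed.

Let abs_convolutionM f g h x : cmeasurable f -> cmeasurable g ->
  abs_convolution mu f g x * (cabs (h x))%:E =
  \intG_y ((cabs (f y) * cabs (g (y^-1 * x)%g))%:E * (cabs (h x))%:E).
Proof.
move=> mf mg; rewrite ge0_integralZr//; last by rewrite lee_fin cabs_ge0.
  exact: (measurable_sliceY x (tonelli_meas (tonelli_abs_convolution he mf mg))).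
by move=> y _; rewrite lee_fin mulr_ge0 ?cabs_ge0.
Qed.

(** [|f| * |g|] is an average of the left translates of [|g|] with total mass the
    [L^1]-norm of [f]. *)
Lemma abs_convolution_orlicz_right f g h :
  cmeasurable f -> cmeasurable g -> admissible mu Psi h ->
  \intG_x (abs_convolution mu f g x * (cabs (h x))%:E) <=
    \intG_x (cabs (f x))%:E * N g.
Proof.
move=> mf mg hh; have [mh _] := hh.
have mfE := @measurable_cabsE R _ (borel G) f mf.
have t := tonelli3 mf mg mh.
rewrite (eq_integral (fun x : borel G => \intG_y ((cabs (f y) * cabs (g (y^-1 * x)%g))%:E * (cabs (h x))%:E))); last first.
  by move=> x _; exact: abs_convolutionM.
rewrite (tonelli_swap t) /= -ge0_integralZr//; last 2 first.
- by move=> x _; rewrite lee_fin cabs_ge0.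
- exact: (orlicz_norm_ge0 _ hPhi).
apply: ge0_le_integral => //.
- move=> y _; apply: integral_ge0 => x _.
  by rewrite mule_ge0// lee_fin ?mulr_ge0 ?cabs_ge0.
- exact: (tonelli_measr t).
- by apply: emeasurable_funM => //; exact: measurable_cst.
move=> y _.
have mgy : cmeasurable (fun x => g (y^-1 * x)%g).
  exact: (@complex_measurable_comp R _ _ (borel G) (borel G) g _ (preserving_mull he y^-1%g).1 mg).
rewrite (eq_integral (fun x : borel G => (cabs (f y))%:E * (cabs (g (y^-1 * x)%g) * cabs (h x))%:E)); last first.
  by move=> x _; rewrite -!EFinM mulrA.
rewrite ge0_integralZl_EFin ?cabs_ge0//; last 2 first.
- by move=> x _; rewrite lee_fin mulr_ge0 ?cabs_ge0.
- exact: measurable_cabs_mul.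
rewrite lee_wpmul2l ?lee_fin ?cabs_ge0//.
apply: (le_trans (orlicz_norm_ub _ hh)).
apply: (orlicz_norm_comp hPhi (T' := fun x => (y * x)%g)) => //.
- exact: (preserving_mull he).
- exact: (preserving_mull he).
- by move=> x; rewrite mulVKg.
Qed.

(** Substituting [x y] for [y], [|f| * |g|] is an average of the right translates
    of [|f|]; this uses that [mu] is invariant under inversion and under right
    translations. *)
Lemma abs_convolution_orlicz_left f g h :
  cmeasurable f -> cmeasurable g -> admissible mu Psi h ->
  \intG_x (abs_convolution mu f g x * (cabs (h x))%:E) <=
    N f * \intG_x (cabs (g x))%:E.
Proof.
move=> mf mg hh; have [mh _] := hh.
have mgE := @measurable_cabsE R _ (borel G) g mg.
have minv := preserving_inv he.
pose H (z : G * G) := (cabs (f (z.1 * z.2)%g) * cabs (g z.2^-1%g))%:E * (cabs (h z.1))%:E.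
have t : tonelli_fun mu mu H.
  apply: (tonelli_haar he).
    by move=> z; rewrite mule_ge0// lee_fin ?mulr_ge0 ?cabs_ge0.
  apply: emeasurable_funM; last first.
    apply: (measurable_cabsE (f := (fun z => h z.1) : bGG -> R[i])).
    exact: (@complex_measurable_comp R _ _ bGG (borel G) h _ (@measurable_fstG G) mh).
  have mm : measurable_fun [set: bGG] ((fun z : G * G => (z.1 * z.2)%g) : bGG -> borel G).
    exact: (borel_continuous (@mulg_continuous G)).
  apply/measurable_EFinP; apply: measurable_funM.
    apply: (measurable_cabs (f := (fun z => f (z.1 * z.2)%g) : bGG -> R[i])).
    exact: (@complex_measurable_comp R _ _ bGG (borel G) f _ mm mf).
  apply: (measurable_cabs (f := (fun z => g (z.2^-1)%g) : bGG -> R[i])).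
  have mi : measurable_fun [set: bGG] ((fun z : G * G => z.2^-1%g) : bGG -> borel G).
    exact: (measurableT_comp minv.1 (@measurable_sndG G)).
  exact: (@complex_measurable_comp R _ _ bGG (borel G) g _ mi mg).
rewrite (eq_integral (fun x : borel G => \intG_y H (x, y))); last first.
  move=> x _; rewrite abs_convolutionM//.
  rewrite -(ge0_integral_preserving (preserving_mull he x)
    (F := fun y : borel G => (cabs (f y) * cabs (g (y^-1 * x)%g))%:E * (cabs (h x))%:E)).
  - by apply: eq_integral => y _; rewrite /H /= invgM mulgVK.
  - exact: (measurable_sliceY x (tonelli_meas (tonelli3 mf mg mh))).
  - by move=> y; rewrite mule_ge0// lee_fin ?mulr_ge0 ?cabs_ge0.
rewrite (tonelli_swap t).
have g0 x : 0 <= (cabs (g x))%:E by rewrite lee_fin cabs_ge0.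
rewrite -(ge0_integral_preserving minv mgE g0) -ge0_integralZl//; last 2 first.
- exact: (measurableT_comp mgE minv.1).
- exact: (orlicz_norm_ge0 _ hPhi).
apply: ge0_le_integral => //.
- move=> y _; apply: integral_ge0 => x _; exact: (tonelli_ge0 t).
- exact: (tonelli_measr t).
- by apply: measurable_funeM; exact: (measurableT_comp mgE minv.1).
move=> y _.
have mfy : cmeasurable (fun x => f (x * y)%g).
  exact: (@complex_measurable_comp R _ _ (borel G) (borel G) f _ (preserving_mulr he y).1 mf).
rewrite (eq_integral (fun x : borel G => (cabs (g y^-1%g))%:E * (cabs (f (x * y)%g) * cabs (h x))%:E)); last first.
  by move=> x _; rewrite /H/= -!EFinM; congr EFin; ring.
rewrite ge0_integralZl_EFin ?cabs_ge0//; last 2 first.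
- by move=> x _; rewrite lee_fin mulr_ge0 ?cabs_ge0.
- exact: measurable_cabs_mul.
rewrite muleC lee_wpmul2r ?lee_fin ?cabs_ge0//.
apply: (le_trans (orlicz_norm_ub _ hh)).
apply: (orlicz_norm_comp hPhi (T' := fun x => (x * y^-1)%g)) => //.
- exact: (preserving_mulr he).
- exact: (preserving_mulr he).
- by move=> x; rewrite mulgK.
Qed.

End ConvolutionOrlicz.

(** * The weighted space and its algebra norm *)

Section LimitHelpers.
Local Open Scope ereal_scope.
Context (R : realType).

Lemma cvg_summable_steps (r : R^nat) :
  \sum_(k <oo) (`|r k.+1 - r k|%R)%:E < +oo -> cvgn r.
Proof.
move=> rfin.
have : cvgn (series (telescope r)).
  apply: normed_cvg; apply: nondecreasing_is_cvgn.
    by apply: nondecreasing_series => n _ _; exact: normr_ge0.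
  exists (fine (\sum_(k <oo) (`|r k.+1 - r k|%R)%:E)) => _ [n _ <-].
  rewrite -lee_fin fineK; last first.
    by rewrite ge0_fin_numE// nneseries_ge0// => k _ _; rewrite lee_fin.
  have : (\sum_(0 <= k < n) `|r k.+1 - r k|)%R%:E <=
      \sum_(k <oo) (`|r k.+1 - r k|%R)%:E.
    rewrite -sumEFin; apply: nneseries_lim_ge => k _ _.
    by rewrite lee_fin.
  by apply: le_trans; rewrite lee_fin.
move=> sc; rewrite (funext (eq_sum_telescope r)).
by apply: is_cvgD; first exact: is_cvg_cst.
Qed.

Lemma limn_einf_le (a : (\bar R)^nat) (b : \bar R) :
  (forall k, a k <= b) -> limn_einf a <= b.
Proof.
move=> ab; rewrite limn_einf_lim; apply: lime_le; first exact: is_cvg_einfs.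
apply: nearW => n; apply: le_trans (ab n).
by apply: ereal_inf_lbound; exists n => /=.
Qed.

Lemma fatou_bound d (T : measurableType d) (mu : {measure set T -> \bar R})
    (F : nat -> T -> \bar R) (H : T -> \bar R) (b : \bar R) :
  (forall k, measurable_fun setT (F k)) -> (forall k x, 0 <= F k x) ->
  measurable_fun setT H -> (forall x, 0 <= H x) ->
  {ae mu, forall x, F k x @[k --> \oo] --> H x} ->
  (forall k, \int[mu]_x F k x <= b) -> \int[mu]_x H x <= b.
Proof.
move=> mF F0 mH H0 FH Fb.
apply: (@le_trans _ _ (\int[mu]_x limn_einf (F ^~ x))).
  apply: ae_ge0_le_integral => //.
  - move=> x _; rewrite limn_einf_lim; apply: lime_ge; first exact: is_cvg_einfs.
    by apply: nearW => n; apply: le_ereal_inf_tmp => _ [k _ <-].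
  - apply: measurableT_comp => //.
    apply: (@measurable_fun_limn_esup _ _ _ _ (fun k x => - F k x)) => k.
    exact: measurableT_comp.
  - apply: (ae_impl FH) => x Fx _.
    by have [-> _] := cvg_limn_einf_sup Fx.
apply: le_trans (fatou mu measurableT mF _) _ => //.
exact: limn_einf_le.
Qed.

Lemma cvg_cabs (z : nat -> R[i]) (l : R[i]) :
  complex.Re (z k) @[k --> \oo] --> complex.Re l ->
  complex.Im (z k) @[k --> \oo] --> complex.Im l ->
  cabs (z k) @[k --> \oo] --> cabs l.
Proof.
have cE (u : R[i]) : cabs u = Num.sqrt (complex.Re u ^+ 2 + complex.Im u ^+ 2).
  by case: u.
move=> zr zi; rewrite cE; under eq_fun do rewrite cE.
apply: continuous_cvg; first exact: sqrt_continuous.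
by apply: cvgD; rewrite expr2; under eq_fun do rewrite expr2; exact: cvgM.
Qed.

End LimitHelpers.

Section WeightedSpace.
Local Open Scope ereal_scope.
Context (R : realType) (G : topologicalGroupType).
Variables (mu : {measure set (borel G) -> \bar R}) (K : nat -> set G).
Hypothesis he : haar_exhaustion mu K.
Variables (Phi Psi : R -> \bar R).
Hypothesis hPhi : complementary_pair Phi Psi.
Variable W : G -> R.
Hypothesis hW : weight W.
Hypothesis W_integrable : \int[mu]_(x in [set: borel G]) ((W x)^-1)%:E < +oo.
Implicit Types f g h : G -> R[i].

Local Notation Wn := (weighted_norm mu Psi W).
Local Notation S := (weighted_orlicz_space mu Phi Psi W).
Local Notation "'\intG_' x F" := (\int[mu]_(x in [set: borel G]) F)
  (at level 36, x name, F at level 36).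

Let W1 x : (1 <= W x)%R. Proof. exact: (weight_ge1 hW). Qed.
Let W0 x : (0 < W x)%R. Proof. exact: lt_le_trans (W1 x). Qed.
Let mW : measurable_fun [set: borel G] (W : borel G -> R).
Proof. exact: (weight_measurable hW). Qed.

Lemma measurable_weighted f : cmeasurable f ->
  cmeasurable (fun x => f x * (W x)%:C%C)%R.
Proof.
by move=> mf; exact: (@complex_measurableM R _ (borel G)).
Qed.

Lemma cabs_weighted f x : cabs (f x * (W x)%:C%C)%R = (cabs (f x) * W x)%R.
Proof. by rewrite cabsM cabs_real gtr0_norm. Qed.

(** Because [W >= 1], finiteness of the weighted norm already gives that of the
    Orlicz norm, and with it membership in the Orlicz space. *)
Lemma weighted_spaceP f : S f <-> cmeasurable f /\ Wn f < +oo.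
Proof.
split; first by move=> [[mf _] Wf].
move=> [mf Wf]; split => //; split => //.
apply: (orlicz_norm_modular he hPhi mf); apply: le_lt_trans Wf.
apply: orlicz_norm_mono => //; first exact: measurable_weighted.
by move=> x; rewrite cabs_weighted ler_peMr// cabs_ge0.
Qed.

Lemma weighted_norm_ge0 f : 0 <= Wn f.
Proof. exact: (orlicz_norm_ge0 _ hPhi). Qed.

Lemma weighted_norm_fin f : S f -> Wn f \is a fin_num.
Proof. by move=> [_ Wf]; rewrite ge0_fin_numE// weighted_norm_ge0. Qed.

(** With [Psi s <= 1], and [j] at least 1 and at least the integral of [1 / W], the
    function [s / (j W)] is a test function. *)
Lemma integral_le_weighted_norm : exists2 C : R, (0 < C)%R &
  forall f, cmeasurable f -> \intG_x (cabs (f x))%:E <= C%:E * Wn f.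
Proof.
have [s s0 Ps] := conjugate_small hPhi.
pose J := \intG_x ((W x)^-1)%:E.
have Jfin : J < +oo by exact: W_integrable.
have J0 : 0 <= J by apply: integral_ge0 => x _; rewrite lee_fin invr_ge0 ltW.
have JE : J = (fine J)%:E by rewrite fineK// ge0_fin_numE.
have fJ0 : (0 <= fine J)%R by exact: fine_ge0.
pose j := (fine J + 1)%R.
have j0 : (0 < j)%R by rewrite /j ltr_wpDl.
have mWi : measurable_fun [set: borel G] (fun x : borel G => (W x)^-1%R).
  by apply: measurable_inv_ge0 => // x; exact: ltW.
pose u x := ((j * W x)^-1 * s)%R.
have u0 x : (0 <= u x)%R by rewrite mulr_ge0 ?invr_ge0 ?mulr_ge0 ?(ltW j0) ?(ltW s0) ?(ltW (W0 x)).
have mu_ : measurable_fun [set: borel G] (u : borel G -> R).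
  apply: measurable_funM => //.
  by under eq_fun do rewrite invfM; exact: measurable_funM.
have jW x : (0 <= (j * W x)^-1 <= 1)%R.
  rewrite invr_ge0 ltW ?mulr_gt0//= invf_le1 ?mulr_gt0//.
  by rewrite -[leLHS]mulr1 ler_pM// /j lerDr.
have Pu : \intG_x Psi (u x) <= 1.
  apply: (@le_trans _ _ (\intG_x ((j^-1)%:E * ((W x)^-1)%:E))).
    apply: ge0_le_integral => //.
    - by move=> x _; exact: (conjugate_ge0 hPhi).
    - exact: (measurable_conjugate hPhi).
    - by apply: measurable_funeM; exact/measurable_EFinP.
    - move=> x _; apply: (le_trans (conjugate_shrink hPhi _ (jW x))).
      rewrite -EFinM -invfM -[leRHS]mule1 lee_wpmul2l// lee_fin.
      by case/andP: (jW x).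
  rewrite ge0_integralZl_EFin ?invr_ge0 ?(ltW j0)//; last 2 first.
  - by move=> x _; rewrite lee_fin invr_ge0 ltW.
  - exact/measurable_EFinP.
  rewrite -/J JE -EFinM lee_fin mulrC ler_pdivrMr// mul1r /j lerDl//.
exists (j / s)%R; first by rewrite divr_gt0.
move=> f mf.
have := orlicz_norm_ub_real (fun x => f x * (W x)%:C%C)%R mu_ u0 Pu.
rewrite (eq_integral (fun x : borel G => (s / j)%:E * (cabs (f x))%:E)); last first.
  move=> x _; rewrite cabs_weighted -EFinM; congr EFin; rewrite /u.
  by field; rewrite !gt_eqF.
have sj0 : (0 < s / j)%R by rewrite divr_gt0.
rewrite ge0_integralZl_EFin ?(ltW sj0)//; last 2 first.
- by move=> x _; rewrite lee_fin cabs_ge0.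
- exact: (@measurable_cabsE R _ (borel G)).
move=> h; have := lee_wpmul2l (_ : 0 <= (j / s)%:E) h.
rewrite lee_fin ltW ?divr_gt0// => /(_ isT).
rewrite muleA -EFinM (_ : j / s * (s / j) = 1)%R ?mul1e//.
by field; rewrite !gt_eqF.
Qed.

Lemma integral_weighted_lty f : S f -> \intG_x (cabs (f x))%:E < +oo.
Proof.
move=> Sf; have [C C0 HC] := integral_le_weighted_norm.
have [mf Wf] := (weighted_spaceP f).1 Sf.
by apply: (le_lt_trans (HC _ mf)); rewrite lte_mul_pinfty// lee_fin ltW.
Qed.

Lemma weighted_norm0 : Wn (fun=> 0%R) = 0.
Proof.
apply/eqP; rewrite eq_le weighted_norm_ge0 andbT; apply: orlicz_norm_le => h _.
by rewrite integral0_eq// => x _; rewrite mul0r cabs0 mul0r.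
Qed.

Lemma weighted_normD f g : cmeasurable f -> cmeasurable g ->
  Wn (fun x => f x + g x)%R <= Wn f + Wn g.
Proof.
move=> mf mg; rewrite /weighted_norm.
have := @orlicz_normD R G mu Psi _ _ (measurable_weighted mf) (measurable_weighted mg).
apply: le_trans; rewrite le_eqVlt; apply/orP; left; apply/eqP.
congr (orlicz_norm _ _ _).
by apply/funext => x; rewrite mulrDl.
Qed.

Lemma weighted_normZ (a : R[i]) f : cmeasurable f ->
  Wn (fun x => a * f x)%R = (cabs a)%:E * Wn f.
Proof.
move=> mf; rewrite /weighted_norm -(orlicz_normZ mu hPhi a (measurable_weighted mf)).
by congr (orlicz_norm _ _ _); apply/funext => x; rewrite mulrA.
Qed.

Lemma weighted_norm_ae f g : cmeasurable f -> cmeasurable g ->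
  ae_equal mu f g -> Wn f = Wn g.
Proof.
move=> mf mg fg; apply: orlicz_norm_ae; try exact: measurable_weighted.
by apply: (ae_impl fg) => x ->.
Qed.

Lemma weighted_norm_eq0 f : cmeasurable f -> Wn f = 0 -> ae_equal mu f (fun=> 0%R).
Proof.
move=> mf Wf0; have [C C0 /(_ _ mf)] := integral_le_weighted_norm.
rewrite Wf0 mule0 => f0.
have mfE := @measurable_cabsE R _ (borel G) f mf.
have : \intG_x `|(cabs (f x))%:E| = 0.
  apply/eqP; rewrite eq_le integral_ge0// andbT.
  by under eq_integral do rewrite gee0_abs ?lee_fin ?cabs_ge0//.
move=> /(ae_eq_integral_abs mu measurableT mfE) fae.
by apply: (ae_impl fae) => x /(_ I) [] /cabs_eq0.
Qed.

Lemma measurable_involution f : cmeasurable f -> cmeasurable (involution f).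
Proof.
move=> mf; apply: (@complex_measurable_conj R _ (borel G)).
exact: (@complex_measurable_comp R _ _ (borel G) (borel G) f _ (preserving_inv he).1 mf).
Qed.

Lemma weighted_norm_involution f : cmeasurable f -> Wn (involution f) = Wn f.
Proof.
have le g : cmeasurable g -> Wn (involution g) <= Wn g.
  move=> mg; have mgW := measurable_weighted mg.
  have minv := preserving_inv he.
  apply: le_trans (orlicz_norm_comp hPhi minv minv (@invgK G) mgW).
  apply: orlicz_norm_mono.
  - exact/measurable_weighted/measurable_involution.
  - exact: (@complex_measurable_comp R _ _ (borel G) (borel G) _ _ minv.1 mgW).
  - by move=> x; rewrite !cabs_weighted /involution cabs_conj -(weight_inv hW).
move=> mf; apply/eqP; rewrite eq_le le//=.
have := le _ (measurable_involution mf).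
rewrite (_ : involution (involution f) = f)//.
by apply/funext => x; rewrite /involution invgK conjcK.
Qed.

Hypothesis W_subadd : forall x y, (W (x * y)%g <= W x + W y)%R.

Lemma weighted_norm_convolution : exists c : R, forall f g, S f -> S g ->
  Wn (convolution mu f g) <= c%:E * (Wn f * Wn g).
Proof.
have [C C0 HC] := integral_le_weighted_norm.
exists (2 * (C + C))%R => f g Sf Sg.
have [mf Wf] := (weighted_spaceP f).1 Sf.
have [mg Wg] := (weighted_spaceP g).1 Sg.
have mfW := measurable_weighted mf; have mgW := measurable_weighted mg.
have mfg := measurable_convolution he mf mg.
apply: orlicz_norm_le => h hh; have [mh _] := hh.
have mhE := @measurable_cabsE R _ (borel G) h mh.
set fW := (fun x => f x * (W x)%:C%C)%R in mfW.
set gW := (fun x => g x * (W x)%:C%C)%R in mgW.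
have mA := measurable_abs_convolution he mfW mg.
have mB := measurable_abs_convolution he mf mgW.
have A0 := abs_convolution_ge0 mu fW g; have B0 := abs_convolution_ge0 mu f gW.
have h0 x : 0 <= (cabs (h x))%:E by rewrite lee_fin cabs_ge0.
apply: (@le_trans _ _ (\intG_x (2%:E *
    (abs_convolution mu fW g x * (cabs (h x))%:E +
     abs_convolution mu f gW x * (cabs (h x))%:E)))).
  apply: ge0_le_integral => //.
  - by move=> x _; rewrite lee_fin mulr_ge0 ?cabs_ge0.
  - by apply: measurable_cabs_mul => //; exact: measurable_weighted.
  - by apply: measurable_funeM; apply: emeasurable_funD; exact: emeasurable_funM.
  - move=> x _; rewrite cabs_weighted EFinM -ge0_muleDl// muleA lee_wpmul2r//.
    rewrite EFinM; apply: (@le_trans _ _ (2%:E * abs_convolution mu f g x * (W x)%:E)).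
      by rewrite lee_wpmul2r ?lee_fin ?(ltW (W0 x))// (cabs_convolution_le he).
    rewrite -muleA lee_wpmul2l// /abs_convolution.
    rewrite -ge0_integralZr ?lee_fin ?(ltW (W0 x))//; last 2 first.
    + exact: (measurable_sliceY x (tonelli_meas (tonelli_abs_convolution he mf mg))).
    + by move=> y _; rewrite lee_fin mulr_ge0 ?cabs_ge0.
    rewrite -ge0_integralD//; last 4 first.
    + by move=> y _; rewrite lee_fin mulr_ge0 ?cabs_ge0.
    + exact: (measurable_sliceY x (tonelli_meas (tonelli_abs_convolution he mfW mg))).
    + by move=> y _; rewrite lee_fin mulr_ge0 ?cabs_ge0.
    + exact: (measurable_sliceY x (tonelli_meas (tonelli_abs_convolution he mf mgW))).
    apply: ge0_le_integral => //.
    + by move=> y _; rewrite mule_ge0// lee_fin ?mulr_ge0 ?cabs_ge0// ltW.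
    + apply: emeasurable_funM; last exact: measurable_cst.
      exact: (measurable_sliceY x (tonelli_meas (tonelli_abs_convolution he mf mg))).
    + apply: emeasurable_funD.
        exact: (measurable_sliceY x (tonelli_meas (tonelli_abs_convolution he mfW mg))).
      exact: (measurable_sliceY x (tonelli_meas (tonelli_abs_convolution he mf mgW))).
    + move=> y _; rewrite -EFinM -EFinD lee_fin !cabs_weighted.
      have Wxy : (W x <= W y + W (y^-1 * x)%g)%R.
        by have := W_subadd y (y^-1 * x)%g; rewrite mulVKg.
      apply: (@le_trans _ _ (cabs (f y) * cabs (g (y^-1 * x)%g) * (W y + W (y^-1 * x)%g))%R).
        by rewrite ler_wpM2l// mulr_ge0 ?cabs_ge0.
      by rewrite le_eqVlt; apply/orP; left; apply/eqP; ring.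
rewrite ge0_integralZl_EFin//; last 2 first.
- by move=> x _; rewrite adde_ge0// mule_ge0.
- by apply: emeasurable_funD; exact: emeasurable_funM.
rewrite ge0_integralD//; last 4 first.
- by move=> x _; rewrite mule_ge0.
- exact: emeasurable_funM.
- by move=> x _; rewrite mule_ge0.
- exact: emeasurable_funM.
have L := abs_convolution_orlicz_left he hPhi mfW mg hh.
have R' := abs_convolution_orlicz_right he hPhi mf mgW hh.
rewrite EFinM -muleA lee_wpmul2l// EFinD ge0_muleDl ?lee_fin ?(ltW C0)//.
apply: leeD.
  apply: (le_trans L); rewrite muleCA lee_wpmul2l ?weighted_norm_ge0//.
  exact: HC.
apply: (le_trans R'); rewrite muleA lee_wpmul2r ?weighted_norm_ge0//.
exact: HC.
Qed.

End WeightedSpace.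

(** * Completeness *)

Section Completeness.
Local Open Scope ereal_scope.
Context (R : realType) (G : topologicalGroupType).
Variables (mu : {measure set (borel G) -> \bar R}) (K : nat -> set G).
Hypothesis he : haar_exhaustion mu K.
Variables (Phi Psi : R -> \bar R).
Hypothesis hPhi : complementary_pair Phi Psi.
Variable W : G -> R.
Hypothesis hW : weight W.
Hypothesis W_integrable : \int[mu]_(x in [set: borel G]) ((W x)^-1)%:E < +oo.
Implicit Types f g : G -> R[i].

Local Notation Wn := (weighted_norm mu Psi W).
Local Notation S := (weighted_orlicz_space mu Phi Psi W).
Local Notation "'\intG_' x F" := (\int[mu]_(x in [set: borel G]) F)
  (at level 36, x name, F at level 36).

Lemma cmeasurableB f g : cmeasurable f -> cmeasurable g ->
  cmeasurable (fun x => f x - g x)%R.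
Proof.
move=> [fr fi] [gr gi]; split.
  rewrite (_ : (fun x => _) = (fun x : borel G => complex.Re (f x) - complex.Re (g x))%R).
    exact: measurable_funB.
  by apply/funext => x; case: (f x); case: (g x).
rewrite (_ : (fun x => _) = (fun x : borel G => complex.Im (f x) - complex.Im (g x))%R).
  exact: measurable_funB.
by apply/funext => x; case: (f x); case: (g x).
Qed.

(** The increments are summable in [L^1] by [integral_le_weighted_norm], so their
    sum is finite almost everywhere; the limit is set to 0 where it is not. *)
Lemma ae_limit (v : nat -> G -> R[i]) : (forall k, cmeasurable (v k)) ->
  (forall k, Wn (fun x => v k.+1 x - v k x)%R <= (1 / (2 ^ k.+1)%:R)%:E) ->
  exists f : G -> R[i], cmeasurable f /\ {ae mu, forall x,
    complex.Re (v k x) @[k --> \oo] --> complex.Re (f x) /\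
    complex.Im (v k x) @[k --> \oo] --> complex.Im (f x)}.
Proof.
move=> mv hv; have [C C0 HC] := integral_le_weighted_norm hPhi hW W_integrable.
pose d k x := (cabs (v k.+1 x - v k x)%R)%:E : \bar R.
have d0 k x : 0 <= d k x by rewrite lee_fin cabs_ge0.
have mvd k := cmeasurableB (mv k.+1) (mv k).
have md k : measurable_fun [set: borel G] (d k : borel G -> \bar R).
  exact: (@measurable_cabsE R _ (borel G) _ (mvd k)).
pose D x := \sum_(k <oo) d k x.
have mD : measurable_fun [set: borel G] (D : borel G -> \bar R).
  exact: (@ge0_emeasurable_sum _ (borel G) _ _ d xpredT).
have Dfin : \intG_x (D x) < +oo.
  rewrite integral_nneseries//; apply: (@le_lt_trans _ _ (\sum_(k <oo) (C / (2 ^ k.+1)%:R)%:E)).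
    apply: lee_nneseries => [k _ _|k _]; first exact: integral_ge0.
    apply: (le_trans (HC _ (mvd k))).
    apply: (le_trans (lee_wpmul2l _ (hv k))); first by rewrite lee_fin ltW.
    by rewrite -EFinM mul1r.
  by apply: (le_lt_trans (epsilon_trick0 xpredT (ltW C0))); exact: ltry.
have D0 x : 0 <= D x by exact: nneseries_ge0.
have iD : mu.-integrable [set: borel G] (D : borel G -> \bar R).
  by apply/integrableP; split => //; under eq_integral do rewrite gee0_abs//.
pose A := [set x : borel G | D x \is a fin_num].
have mA : measurable A.
  by rewrite -[A]setTI; exact: (emeasurable_fin_num measurableT mD).
have step (p : R[i] -> R) (x : G) : (forall z t, `|p z - p t| <= cabs (z - t))%R -> A x ->
    cvgn (fun k => p (v k x)).
  move=> pL Ax; apply: cvg_summable_steps.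
  apply: (@le_lt_trans _ _ (D x)); last by rewrite -ge0_fin_numE.
  apply: lee_nneseries => [k _ _|k _]; first by rewrite lee_fin.
  by rewrite lee_fin.
have ReL (z t : R[i]) : (`|complex.Re z - complex.Re t| <= cabs (z - t))%R.
  by apply: le_trans (normr_Re_le _); case: z; case: t.
have ImL (z t : R[i]) : (`|complex.Im z - complex.Im t| <= cabs (z - t))%R.
  by apply: le_trans (normr_Im_le _); case: z; case: t.
have lim_meas (p : R[i] -> R) : (forall z t, `|p z - p t| <= cabs (z - t))%R ->
    (forall k, measurable_fun [set: borel G] (fun x : borel G => p (v k x))) ->
    measurable_fun [set: borel G]
      (fun x : borel G => limn (fun k => p (v k x)) * \1_A x)%R.
  move=> pL mp.
  apply: (@measurable_fun_cvg _ (borel G) _ _ (fun k (x : borel G) => p (v k x) * \1_A x)%R).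
    by move=> k; apply: measurable_funM => //; exact: measurable_indic.
  move=> x _; rewrite indicE; have [/set_mem Ax|_] := boolP (x \in A).
    by under eq_fun do rewrite mulr1; rewrite mulr1; exact: (step p x pL Ax).
  by under eq_fun do rewrite mulr0; rewrite mulr0; exact: cvg_cst.
exists (fun x => Complex (limn (fun k => complex.Re (v k x)) * \1_A x)%R
                         (limn (fun k => complex.Im (v k x)) * \1_A x)%R); split.
  by split; apply: lim_meas => // k; case: (mv k).
apply: (ae_impl (integrable_ae measurableT iD)) => x /(_ I) Ax.
rewrite /= indicE mem_set// !mulr1; split.
  exact: (step (@complex.Re R) x ReL Ax).
exact: (step (@complex.Im R) x ImL Ax).
Qed.

Theorem weighted_complete (u : nat -> G -> R[i]) : (forall n, S (u n)) ->
  (forall e : R, (0 < e)%R -> exists n0, forall m n, (n0 <= m)%N -> (n0 <= n)%N ->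
    Wn (fun x => u m x - u n x)%R < e%:E) ->
  exists2 f, S f & Wn (fun x => u n x - f x)%R @[n --> \oo] --> 0.
Proof.
move=> Su cau.
have mu_ n : cmeasurable (u n) by have [] := (weighted_spaceP he hPhi hW (u n)).1 (Su n).
have /choice[a Ha] : forall k, exists n0, forall m n, (n0 <= m)%N -> (n0 <= n)%N ->
    Wn (fun x => u m x - u n x)%R < (1 / (2 ^ k.+1)%:R)%:E.
  by move=> k; apply: cau; rewrite divr_gt0// ltr0n expn_gt0.
(* A subsequence that is nondecreasing, above [a], and tends to infinity. *)
pose b k := (k + \sum_(i < k.+1) a i)%N.
have ab k : (a k <= b k)%N.
  by rewrite /b big_ord_recr/= addnA leq_addl.
have bS k : (b k <= b k.+1)%N.
  rewrite /b [X in (_ <= _ + X)%N]big_ord_recr /=.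
  by apply: leq_add; [exact: leqnSn|exact: leq_addr].
have [f [mf fae]] : exists f : G -> R[i], cmeasurable f /\ {ae mu, forall x,
    complex.Re (u (b k) x) @[k --> \oo] --> complex.Re (f x) /\
    complex.Im (u (b k) x) @[k --> \oo] --> complex.Im (f x)}.
  apply: (ae_limit (v := fun k => u (b k))) => // k.
  apply/ltW/Ha => //; exact: leq_trans (bS _).
have close (e : R) : (0 < e)%R -> exists n0, forall n, (n0 <= n)%N ->
    Wn (fun x => u n x - f x)%R <= e%:E.
  move=> e0; have [n0 Hn0] := cau _ e0; exists n0 => n nn0.
  apply: orlicz_norm_le => h hh; have [mh _] := hh.
  (* The shift by [n0] puts every [b (k + n0)] into the range of the Cauchy
     estimate. *)
  pose F k x := (cabs ((u n x - u (b (k + n0)%N) x) * (W x)%:C%C) * cabs (h x))%:E.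
  have n0b k : (n0 <= b (k + n0)%N)%N.
    by rewrite /b -addnA addnCA leq_addr.
  apply: (@fatou_bound R _ (borel G) mu F).
  - move=> k; apply: measurable_cabs_mul => //.
    by apply: (measurable_weighted hW); exact: cmeasurableB.
  - by move=> k x; rewrite lee_fin mulr_ge0 ?cabs_ge0.
  - apply: measurable_cabs_mul => //.
    by apply: (measurable_weighted hW); exact: cmeasurableB.
  - by move=> x; rewrite lee_fin mulr_ge0 ?cabs_ge0.
  - apply: (ae_impl fae) => x [fr fi].
    apply/fine_cvgP; split; first exact: nearW.
    apply: cvgM; last exact: cvg_cst.
    have sh (r : R^nat) (l : R) : r k @[k --> \oo] --> l -> r (k + n0)%N @[k --> \oo] --> l.
      by move=> rl; rewrite (cvg_shiftn n0 r).
    have ReW (z t : R[i]) (w : R) :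
        complex.Re ((z - t) * w%:C%C)%R = ((complex.Re z - complex.Re t) * w)%R.
      by case: z => z1 z2; case: t => t1 t2 /=; rewrite mulr0 subr0.
    have ImW (z t : R[i]) (w : R) :
        complex.Im ((z - t) * w%:C%C)%R = ((complex.Im z - complex.Im t) * w)%R.
      by case: z => z1 z2; case: t => t1 t2 /=; rewrite mulr0 add0r.
    apply: cvg_cabs.
      under eq_fun do rewrite ReW; rewrite ReW.
      apply: cvgM; last exact: cvg_cst.
      by apply: cvgB; [exact: cvg_cst|exact: (sh _ _ fr)].
    under eq_fun do rewrite ImW; rewrite ImW.
    apply: cvgM; last exact: cvg_cst.
    by apply: cvgB; [exact: cvg_cst|exact: (sh _ _ fi)].
  - move=> k; apply: (@le_trans _ _ (Wn (fun x => u n x - u (b (k + n0)%N) x)%R)).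
      exact: orlicz_norm_ub.
    by apply/ltW/Hn0.
have Wn0 g : 0 <= Wn g by exact: (weighted_norm_ge0 mu hPhi W g).
exists f.
  apply/(weighted_spaceP he hPhi hW); split => //.
  have [n0 /(_ n0 (leqnn _)) Hn0] := close 1%R ltr01.
  have [_ Wu] := (weighted_spaceP he hPhi hW (u n0)).1 (Su n0).
  have msub := cmeasurableB (mu_ n0) mf.
  have msub' : cmeasurable (fun x => -1 * (u n0 x - f x))%R.
    have [sr si] := msub; split.
      by under eq_fun do rewrite mulN1r; move: (measurable_funN sr);
        apply: eq_measurable_fun => x _ /=; case: (_ - _)%R.
    by under eq_fun do rewrite mulN1r; move: (measurable_funN si);
      apply: eq_measurable_fun => x _ /=; case: (_ - _)%R.
  have := weighted_normD mu Psi hW (mu_ n0) msub'.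
  rewrite (_ : (fun x => u n0 x + -1 * (u n0 x - f x))%R = f); last first.
    by apply/funext => x; rewrite mulN1r opprB addrC subrK.
  move=> /le_lt_trans; apply; rewrite (weighted_normZ _ hPhi hW)//.
  rewrite lte_add_pinfty// lte_mul_pinfty ?lee_fin ?cabs_ge0//.
  exact: (le_lt_trans Hn0 (ltry _)).
apply/fine_cvgP; split.
  have [n0 Hn0] := close 1%R ltr01; exists n0 => // n /= /Hn0 h.
  by rewrite ge0_fin_numE// (le_lt_trans h (ltry _)).
apply/cvgrPdist_le => e e0; have [n0 Hn0] := close e e0; exists n0 => // n /= /Hn0 h.
rewrite sub0r normrN ger0_norm ?fine_ge0// -lee_fin fineK//.
by rewrite ge0_fin_numE// (le_lt_trans h (ltry _)).
Qed.

End Completeness.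

(** * Algebraic laws of convolution *)

Section ConvolutionAlgebra.
Local Open Scope ereal_scope.
Context (R : realType) (G : topologicalGroupType).
Variables (mu : {measure set (borel G) -> \bar R}) (K : nat -> set G).
Hypothesis he : haar_exhaustion mu K.
Implicit Types f g h : G -> R[i].
Let bGG := borel (G * G)%type.

Local Notation "'\intG_' x F" := (\int[mu]_(x in [set: borel G]) F)
  (at level 36, x name, F at level 36).

Lemma convolution_ae f f' g g' : cmeasurable f -> cmeasurable f' ->
  cmeasurable g -> cmeasurable g' -> ae_equal mu f f' -> ae_equal mu g g' ->
  convolution mu f g = convolution mu f' g'.
Proof.
move=> mf mf' mg mg' ff' gg'; apply/funext => x; apply: ae_eq_cintegral.
- exact: (measurable_convolution_slice he x mf mg).
- exact: (measurable_convolution_slice he x mf' mg').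
have gx := ae_preserving (preserving_mulVr he x) gg'.
by apply: (ae_impl (ae_and ff' gx)) => y [-> ->].
Qed.

Lemma involution_convolution f g : cmeasurable f -> cmeasurable g ->
  involution (convolution mu f g) = convolution mu (involution g) (involution f).
Proof.
move=> mf mg; apply/funext => x; rewrite /involution /convolution.
rewrite -cintegral_conj.
have mconj : cmeasurable (fun y => conjc (f y * g (y^-1 * x^-1)%g)%R).
  apply: (@complex_measurable_conj R _ (borel G)).
  exact: (measurable_convolution_slice he _ mf mg).
rewrite -(cintegral_preserving (preserving_mull he x^-1%g) mconj).
congr (cintegral mu _); apply/funext => y.
rewrite !invgM !invgK -mulgA mulgV mulg1.
by case: (f _) => a b; case: (g _) => c d; congr Complex; ring.
Qed.

Lemma cintegrableZ (a : R[i]) f : cintegrable mu f -> cintegrable mu (fun x => a * f x)%R.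
Proof.
move=> /cintegrableP[mf ffin]; apply/cintegrableP; split.
  exact: (@complex_measurableM R _ (borel G)).
rewrite (eq_integral (fun x : borel G => (cabs a)%:E * (cabs (f x))%:E)); last first.
  by move=> x _; rewrite -EFinM cabsM.
rewrite ge0_integralZl_EFin ?cabs_ge0//.
- by rewrite lte_mul_pinfty ?lee_fin ?cabs_ge0.
- by move=> x _; rewrite lee_fin cabs_ge0.
- exact: (@measurable_cabsE R _ (borel G)).
Qed.

Lemma convolution_linearl (a : R[i]) f g h x :
  cintegrable mu (fun y => f y * h (y^-1 * x)%g)%R ->
  cintegrable mu (fun y => g y * h (y^-1 * x)%g)%R ->
  convolution mu (fun y => a * f y + g y)%R h x =
  (a * convolution mu f h x + convolution mu g h x)%R.
Proof.
move=> ifh igh; rewrite /convolution -cintegralZ// -cintegralD//.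
- by congr (cintegral mu _); apply/funext => y; rewrite mulrDl mulrA.
- exact: cintegrableZ.
Qed.

Lemma convolution_linearr (a : R[i]) f g h x :
  cintegrable mu (fun y => h y * f (y^-1 * x)%g)%R ->
  cintegrable mu (fun y => h y * g (y^-1 * x)%g)%R ->
  convolution mu h (fun y => a * f y + g y)%R x =
  (a * convolution mu h f x + convolution mu h g x)%R.
Proof.
move=> ihf ihg; rewrite /convolution -cintegralZ// -cintegralD//.
- by congr (cintegral mu _); apply/funext => y; rewrite mulrDr mulrCA.
- exact: cintegrableZ.
Qed.

(** Integrability is asked of [a f] instead of [f], as Tonelli's theorem provides
    it; the case [a = 0] holds since both sides vanish. *)
Lemma cintegral_Zfin (a : R[i]) f : cmeasurable f ->
  \intG_x (cabs (a * f x)%R)%:E < +oo ->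
  cintegral mu (fun x => a * f x)%R = (a * cintegral mu f)%R.
Proof.
move=> mf affin; have [->|a0] := eqVneq a 0%R.
  rewrite mul0r (_ : (fun x => _) = fun=> 0%R); last first.
    by apply/funext => x; rewrite mul0r.
  by apply: complex_ext; rewrite /= /Rintegral integral0.
apply: cintegralZ.
have : cintegrable mu (fun x => a^-1 * (a * f x))%R.
  apply: cintegrableZ; apply/cintegrableP; split => //.
  exact: (@complex_measurableM R _ (borel G)).
by under eq_fun do rewrite mulKf//.
Qed.

(** Both sides are iterated integrals of [f y * g (y^-1 z) * h (z^-1 x)], in the two
    orders.  Its modulus integrates to [(|f| * (|g| * |h|)) x], which is finite for
    almost every [x]; for these [x] Fubini's theorem applies. *)
Lemma convolution_assoc f g h : cmeasurable f -> cmeasurable g -> cmeasurable h ->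
  \intG_x (cabs (f x))%:E < +oo -> \intG_x (cabs (g x))%:E < +oo ->
  \intG_x (cabs (h x))%:E < +oo ->
  ae_equal mu (convolution mu f (convolution mu g h))
              (convolution mu (convolution mu f g) h).
Proof.
move=> mf mg mh ffin gfin hfin.
pose q := abs_convolution mu g h.
have q0 x : 0 <= q x by exact: abs_convolution_ge0.
have mq : measurable_fun [set: borel G] (q : borel G -> \bar R).
  exact: (measurable_abs_convolution he mg mh).
have mfE := @measurable_cabsE R _ (borel G) f mf.
have f0 x : 0 <= (cabs (f x))%:E by rewrite lee_fin cabs_ge0.
pose A x := \intG_y ((cabs (f y))%:E * q (y^-1 * x)%g).
have nn (k : G -> R[i]) : 0 <= \intG_x (cabs (k x))%:E.
  by apply: integral_ge0 => x _; rewrite lee_fin cabs_ge0.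
have Afin : \intG_x (A x) < +oo.
  rewrite (integral_convolution he f0 q0 mfE mq) (integral_abs_convolution he mg mh).
  by rewrite lte_mul_pinfty ?ge0_fin_numE// lte_mul_pinfty ?ge0_fin_numE.
have A0 x : 0 <= A x by apply: integral_ge0 => y _; rewrite mule_ge0.
have iA : mu.-integrable [set: borel G] (A : borel G -> \bar R).
  apply/integrableP; split; last by under eq_integral do rewrite gee0_abs//.
  have t : tonelli_fun mu mu (fun z => (cabs (f z.2))%:E * q (z.2^-1 * z.1)%g).
    apply: (tonelli_haar he); first by move=> z; rewrite mule_ge0.
    apply: emeasurable_funM.
      exact: (measurableT_comp mfE (@measurable_sndG G)).
    exact: (measurableT_comp mq (@measurable_mulVl G)).
  exact: tonelli_measl t.
apply: (ae_impl (integrable_ae measurableT iA)) => x /(_ I) Ax.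
pose T (z : G * G) := (f z.1 * (g (z.1^-1 * z.2)%g * h (z.2^-1 * x)%g))%R.
have m12 : measurable_fun [set: bGG] ((fun z : G * G => (z.1^-1 * z.2)%g) : bGG -> borel G).
  have := measurableT_comp (@measurable_mulVl G)
    (borel_continuous (@swap_continuous G G)).
  by [].
have m2x : measurable_fun [set: bGG] ((fun z : G * G => (z.2^-1 * x)%g) : bGG -> borel G).
  exact: (measurableT_comp (preserving_mulVr he x).1 (@measurable_sndG G)).
have mT : complex_measurable (T : bGG -> R[i]).
  apply: complex_measurableM.
    exact: (@complex_measurable_comp R _ _ bGG (borel G) f _ (@measurable_fstG G) mf).
  apply: complex_measurableM.
    exact: (@complex_measurable_comp R _ _ bGG (borel G) g _ m12 mg).
  exact: (@complex_measurable_comp R _ _ bGG (borel G) h _ m2x mh).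
have tT : tonelli_fun mu mu (fun z => (cabs (T z))%:E).
  apply: (tonelli_haar he); first by move=> z; rewrite lee_fin cabs_ge0.
  exact: (@measurable_cabsE R _ bGG T mT).
have mgh (y : G) : cmeasurable (fun z => g (y^-1 * z)%g * h (z^-1 * x)%g)%R.
  apply: (@complex_measurableM R _ (borel G)).
    exact: (@complex_measurable_comp R _ _ (borel G) (borel G) g _ (preserving_mull he y^-1%g).1 mg).
  exact: (@complex_measurable_comp R _ _ (borel G) (borel G) h _ (preserving_mulVr he x).1 mh).
have shift (y z : G) : ((y^-1 * z)^-1 * (y^-1 * x))%g = (z^-1 * x)%g.
  by rewrite invgM invgK -mulgA mulVKg.
have inner (y : G) : \intG_z (cabs (g (y^-1 * z)%g * h (z^-1 * x)%g)%R)%:E = q (y^-1 * x)%g.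
  rewrite /q /abs_convolution.
  rewrite -(ge0_integral_preserving (preserving_mull he y^-1%g) (F := fun z : borel G =>
     (cabs (g z) * cabs (h (z^-1 * (y^-1 * x))%g))%:E)).
  - by apply: eq_integral => z _; rewrite shift cabsM.
  - apply: measurable_cabs_mul => //.
    exact: (@complex_measurable_comp R _ _ (borel G) (borel G) h _ (preserving_mulVr he _).1 mh).
  - by move=> z; rewrite lee_fin mulr_ge0 ?cabs_ge0.
have Tfin : \intG_y \intG_z (cabs (T (y, z)))%:E < +oo.
  rewrite (eq_integral (fun y : borel G => (cabs (f y))%:E * q (y^-1 * x)%g)).
    by rewrite -ge0_fin_numE// A0.
  move=> y _; rewrite -inner -ge0_integralZl_EFin ?cabs_ge0//.
  - by apply: eq_integral => z _; rewrite -EFinM -cabsM.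
  - by move=> z _; rewrite lee_fin cabs_ge0.
  - exact: (@measurable_cabsE R _ (borel G) _ (mgh y)).
have T0 z : 0 <= (cabs (T z))%:E by rewrite lee_fin cabs_ge0.
transitivity (cintegral mu (fun y => cintegral mu (fun z => T (y, z)))).
  apply: ae_eq_cintegral.
  - by apply: (measurable_convolution_slice he x mf); exact: (measurable_convolution he).
  - exact: (cmeasurable_cintegral_slice he mT).
  have iT : mu.-integrable [set: borel G] (fun y : borel G => \intG_z (cabs (T (y, z)))%:E).
    apply/integrableP; split; first exact: (tonelli_measl tT).
    by under eq_integral do rewrite gee0_abs ?integral_ge0//.
  apply: (ae_impl (integrable_ae measurableT iT)) => y /(_ I) Ty.
  rewrite /T /= cintegral_Zfin//; last first.
    by rewrite -ge0_fin_numE// integral_ge0.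
  congr (_ * _)%R; rewrite /convolution.
  have mgx : cmeasurable (fun z => g z * h (z^-1 * (y^-1 * x))%g)%R.
    exact: (measurable_convolution_slice he _ mg mh).
  rewrite -(cintegral_preserving (preserving_mull he y^-1%g) mgx).
  by congr (cintegral mu _); apply/funext => z; rewrite shift.
rewrite (cintegral_fubini he mT Tfin).
apply: ae_eq_cintegral.
- have mT' : complex_measurable ((fun z => T (z.2, z.1)) : bGG -> R[i]).
    exact: (@complex_measurable_comp R _ _ bGG bGG T _
      (borel_continuous (@swap_continuous G G)) mT).
  exact: (cmeasurable_cintegral_slice he mT').
- by apply: (measurable_convolution_slice he x) => //; exact: (measurable_convolution he).
have iT : mu.-integrable [set: borel G] (fun z : borel G => \intG_y (cabs (T (y, z)))%:E).
  apply/integrableP; split; first exact: (tonelli_measr tT).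
  under eq_integral do rewrite gee0_abs ?integral_ge0//.
  by rewrite -(tonelli_swap tT).
apply: (ae_impl (integrable_ae measurableT iT)) => z /(_ I) Tz.
have TE : (fun y => T (y, z)) = (fun y => h (z^-1 * x)%g * (f y * g (y^-1 * z)%g))%R.
  by apply/funext => y; rewrite /T /=; ring.
have mfg : cmeasurable (fun y => f y * g (y^-1 * z)%g)%R.
  exact: (measurable_convolution_slice he _ mf mg).
rewrite TE cintegral_Zfin//; first by rewrite mulrC.
rewrite (eq_integral (fun y : borel G => (cabs (T (y, z)))%:E)); last first.
  by move=> y _; have /(congr1 (@^~ y)) /= -> := TE.
by rewrite -ge0_fin_numE// integral_ge0.
Qed.

End ConvolutionAlgebra.

Section LphiWeight.
Local Open Scope ereal_scope.
Context (R : realType) (G : topologicalGroupType).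
Variables (mu : {measure set (borel G) -> \bar R}) (K : nat -> set G).
Hypothesis he : haar_exhaustion mu K.
Variables (Phi Psi : R -> \bar R).
Hypothesis hPhi : complementary_pair Phi Psi.
Variable W : G -> R.
Hypothesis hW : weight W.
Hypothesis W_subadd : forall x y, (W (x * y)%g <= W x + W y)%R.
Hypothesis W_integrable : \int[mu]_(x in [set: borel G]) ((W x)^-1)%:E < +oo.

Local Notation Wn := (weighted_norm mu Psi W).
Local Notation S := (weighted_orlicz_space mu Phi Psi W).

(** The embedding of the weighted space in [L^1] makes all convolution integrals
    converge almost everywhere, so that bilinearity and associativity hold
    almost everywhere. *)
Theorem integrable_inverse_lphi_weight : lphi_weight mu Phi Psi W.
Proof.
have SP f := weighted_spaceP he hPhi hW f.
have Sm f : S f -> cmeasurable f by move=> /SP[].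
have L1 f : S f -> \int[mu]_(x in [set: borel G]) (cabs (f x))%:E < +oo.
  exact: (integral_weighted_lty he hPhi hW W_integrable).
have fin f : S f -> Wn f \is a fin_num by exact: weighted_norm_fin.
have [c Hc] := weighted_norm_convolution he hPhi hW W_integrable W_subadd.
have Smul f g : S f -> S g -> S (convolution mu f g).
  move=> Sf Sg; apply/SP; split.
    by apply: (measurable_convolution he); exact: Sm.
  apply: (le_lt_trans (Hc _ _ Sf Sg)).
  by rewrite -(fineK (fin _ Sf)) -(fineK (fin _ Sg)) -!EFinM ltry.
have Sadd f g : S f -> S g -> S (f + g)%R.
  move=> /SP[mf Wf] /SP[mg Wg]; apply/SP; split.
    exact: (@complex_measurableD R _ (borel G)).
  by apply: (le_lt_trans (weighted_normD _ _ hW mf mg)); exact: lte_add_pinfty.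
have scaleE (a : R[i]) (f : G -> R[i]) : a *: f = (fun x => a * f x)%R by [].
have WZ (a : R[i]) (f : G -> R[i]) : cmeasurable f -> Wn (a *: f) = (cabs a)%:E * Wn f.
  by rewrite scaleE; exact: (weighted_normZ mu hPhi hW a).
have mZ (a : R[i]) (f : G -> R[i]) : cmeasurable f -> cmeasurable (a *: f).
  rewrite scaleE => mf.
  by apply: (@complex_measurableM R _ (borel G)) => //; exact: complex_measurable_cst.
have Sscale (a : R[i]) f : S f -> S (a *: f).
  move=> Sf; have /SP[mf Wf] := Sf; apply/SP; split; first exact: mZ.
  by rewrite WZ// lte_mul_pinfty ?lee_fin ?cabs_ge0.
have Sstar f : S f -> S (involution f).
  move=> /SP[mf Wf]; apply/SP; split; first exact: (measurable_involution he).
  by rewrite (weighted_norm_involution he hPhi hW).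
have conv_ae f g : S f -> S g ->
    {ae mu, forall x, cintegrable mu (fun y : G => f y * g (y^-1 * x)%g)%R}.
  move=> Sf Sg.
  exact: (ae_convolution_integrable he (Sm _ Sf) (Sm _ Sg) (L1 _ Sf) (L1 _ Sg)).
split; [exact: hW|exact: conv_ae|split].
- by move=> f _; apply: (@aeW _ (borel G)).
- by move=> f g _ _ fg; apply: (ae_impl fg) => x ->.
- by move=> f g h _ _ _ fg gh; apply: (ae_impl (ae_and fg gh)) => x [-> ->].
- apply/SP; split; first by split; exact: measurable_cst.
  by rewrite (weighted_norm0 mu hPhi W).
- exact: Sadd.
- exact: Sscale.
- exact: Smul.
- exact: Sstar.
- move=> f f' g g' _ _ _ _ ff' gg'.
  by apply: (ae_impl (ae_and ff' gg')) => x [fx gx]; rewrite !addrfctE fx gx.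
- by move=> a f f' _ _ ff'; apply: (ae_impl ff') => x fx; rewrite !scaleE fx.
- move=> f f' g g' /Sm mf /Sm mf' /Sm mg /Sm mg' ff' gg'.
  rewrite (convolution_ae he mf mf' mg mg' ff' gg').
  by apply: (@aeW _ (borel G)).
- move=> f f' _ _ ff'; apply: (ae_impl (ae_preserving (preserving_inv he) ff')) => x fx.
  by rewrite /involution fx.
- by move=> f f' /Sm mf /Sm mf'; exact: (weighted_norm_ae _ hW).
- exact: fin.
- by move=> f _; exact: (weighted_norm_ge0 _ hPhi).
- move=> f /Sm mf; exact: (weighted_norm_eq0 hPhi hW W_integrable mf).
- by move=> f g /Sm mf /Sm mg; exact: (weighted_normD _ _ hW).
- by move=> a f /Sm; exact: WZ.
- exact: (weighted_complete he hPhi hW W_integrable).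
- move=> f g h Sf Sg Sh.
  exact: (convolution_assoc he (Sm _ Sf) (Sm _ Sg) (Sm _ Sh) (L1 _ Sf) (L1 _ Sg) (L1 _ Sh)).
- move=> a f g h Sf Sg Sh.
  apply: (ae_impl (ae_and (conv_ae f h Sf Sh) (conv_ae g h Sg Sh))) => x [ifh igh].
  by rewrite scaleE; exact: convolution_linearl.
- move=> a f g h Sf Sg Sh.
  apply: (ae_impl (ae_and (conv_ae h f Sh Sf) (conv_ae h g Sh Sg))) => x [ihf ihg].
  by rewrite scaleE; exact: convolution_linearr.
- by exists c; exact: Hc.
- move=> a f g _ _; apply: (@aeW _ (borel G)) => x.
  rewrite !scaleE !addrfctE /involution.
  case: a => a1 a2; case: (f _) => f1 f2; case: (g _) => g1 g2.
  by apply: complex_ext => /=; ring.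
- by move=> f _; apply: (@aeW _ (borel G)) => x; rewrite /involution invgK conjcK.
- move=> f g /Sm mf /Sm mg; rewrite (involution_convolution he mf mg).
  by apply: (@aeW _ (borel G)).
- by move=> f /Sm mf; exact: (weighted_norm_involution he hPhi hW).
Qed.

End LphiWeight.

(** * The sharp weight *)

Section SharpWeight.
Context (R : realType) (G : topologicalGroupType).
Variables (K : nat -> set G) (w : G -> R).
Variable mu : {measure set (borel G) -> \bar R}.
Hypothesis hG : locally_elliptic G.
Hypothesis hK : standard_decomposition K.
Hypothesis hw : weight w.
Hypothesis hmu : haar_measure mu.
Hypothesis hmu1 : mu (K 1%N) = 1%E.

Local Notation W := (sharp_weight mu K w).
Local Notation a := (weight_sup K w).

Lemma standard_exhaustion : haar_exhaustion mu (fun n => K n.+1).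
Proof.
split => //.
- exact: (le_hausdorff hG).
- by move=> n; exact: (sd_subgroup hK).
- by move=> n; exact: (sd_incr hK).
- rewrite -(sd_union hK); apply/seteqP; split => x [n].
    by move=> _ Kx; exists n.+1.
  by case: n => // n _ Kx; exists n.
Qed.

Let oK i : (1 <= i)%N -> open (K i).
Proof. by move=> i1; have [] := sd_subgroup hK i1. Qed.
Let mK i : (1 <= i)%N -> measurable (K i : set (borel G)).
Proof. by move=> i1; apply: borel_open; exact: oK. Qed.
Let fK i : (1 <= i)%N -> (mu (K i) < +oo)%E.
Proof.
by move=> i1; apply: (haar_compact_lty hmu); have [] := sd_subgroup hK i1.
Qed.
Let sK i : (1 <= i)%N -> subgroup (K i).
Proof. by move=> i1; have [] := sd_subgroup hK i1. Qed.

Let leK i j : (1 <= i)%N -> (i <= j)%N -> K i `<=` K j.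
Proof.
move=> i1 /subnK <-; elim: (j - i)%N => //= k IH x /IH.
by apply: (sd_incr hK); rewrite (leq_trans i1)// leq_addl.
Qed.

(** [x] lies in the [i]-th annulus; the first annulus is [K 1]. *)
Definition level (i : nat) (x : G) :=
  [/\ (1 <= i)%N, K i x & (1 < i)%N -> ~ K i.-1 x].

Lemma level_exists x : exists i, level i x.
Proof.
have [j [j1 Kj]] : exists j, (1 <= j)%N /\ K j x.
  have : (\bigcup_(i in [set i | (1 <= i)%N]) K i) x by rewrite (sd_union hK).
  by move=> [j j1 Kj]; exists j.
have exP : exists j, (1 <= j)%N && `[< K j x >].
  by exists j; rewrite j1; apply/asboolP.
have [i /andP[i1 /asboolP Ki] min] := ex_minnP exP.
exists i; split => // i2 Kp.
have := min i.-1; rewrite -ltnS prednK// i2 /=.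
have -> : `[< K i.-1 x >] by exact/asboolP.
by move=> /(_ isT); rewrite -ltnS prednK// ltnn.
Qed.

Lemma level_le i j x : level i x -> (1 <= j)%N -> K j x -> (i <= j)%N.
Proof.
move=> [i1 Ki nK] j1 Kj; rewrite leqNgt; apply/negP => ji.
apply: nK; first exact: leq_ltn_trans ji.
by apply: (leK j1) Kj; rewrite -ltnS prednK.
Qed.

Lemma levelV i x : level i x -> level i x^-1%g.
Proof.
move=> [i1 Ki nK]; split => //; first by have [_ _ KV] := sK i1; exact: KV.
move=> i2 Kp; apply: (nK i2); have i11 : (1 <= i.-1)%N by rewrite -ltnS prednK.
by have [_ _ KV] := sK i11; rewrite -[x]invgK; exact: KV.
Qed.

Let bounded_w i : (1 <= i)%N -> exists M, forall x, K i x -> w x <= M.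
Proof. by move=> i1; apply: (weight_bounded hw); have [] := sd_subgroup hK i1. Qed.

Let has_sup_w i : (1 <= i)%N -> has_sup [set w x | x in K i].
Proof.
move=> i1; split.
  by exists (w 1%g), 1%g => //; have [] := sK i1.
have [M HM] := bounded_w i1; exists M => _ [x Kx <-]; exact: HM.
Qed.

Lemma weight_sup_ge1 i : (1 <= i)%N -> 1 <= a i.
Proof.
move=> i1; apply: (le_trans (weight_ge1 hw 1%g)).
apply: sup_upper_bound; first exact: has_sup_w.
by exists 1%g => //; have [] := sK i1.
Qed.

Lemma weight_sup_mono i j : (1 <= i)%N -> (i <= j)%N -> a i <= a j.
Proof.
move=> i1 ij; have j1 := leq_trans i1 ij.
apply: sup_le.
- move=> _ [x Kx <-]; exists (w x); split => //; exists x => //.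
  exact: (leK i1 ij).
- by case: (has_sup_w i1).
- exact: has_sup_w.
Qed.

Definition annulus_mass i : R := fine (mu (K i `\` K i.-1)).

Definition level_value i : R :=
  if (i <= 1)%N then a 1 + 1 else (a i + i%:R ^+ 2) * annulus_mass i.

Let mA i : (2 <= i)%N -> measurable (K i `\` K i.-1 : set (borel G)).
Proof.
by case: i => // i i2; apply: measurableD; apply: mK.
Qed.

Let fA i : (2 <= i)%N -> mu (K i `\` K i.-1) \is a fin_num.
Proof.
move=> i2; have i1 : (1 <= i)%N by exact: leq_trans i2.
rewrite ge0_fin_numE//; apply: le_lt_trans (fK i1); apply: le_mu.
- exact: mA.
- exact: mK.
- by move=> x [].
Qed.

(** The annulus contains the coset [x K_(i-1)] of any of its points [x].  Without a
    point the bound fails, since the sequence may be constant for a while. *)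
Lemma annulus_mass_ge i x : (2 <= i)%N -> level i x ->
  fine (mu (K i.-1)) <= annulus_mass i.
Proof.
move=> i2 [i1 Ki nK].
have p1 : (1 <= i.-1)%N by case: i i2 {i1 Ki nK} => // [[]].
rewrite /annulus_mass fine_le//.
- by rewrite ge0_fin_numE// fK.
- exact: fA.
rewrite -(haar_left_invariant hmu x (mK p1)); apply: le_mu.
- rewrite (_ : left_coset x (K i.-1) = (fun y => (x^-1 * y)%g) @^-1` K i.-1).
    rewrite -[X in measurable X]setTI.
    exact: ((preserving_mull standard_exhaustion x^-1%g).1 measurableT _ (mK p1)).
  apply/seteqP; split => [_ [y Ky <-]|y Ky] /=; first by rewrite mulKg.
  by exists (x^-1 * y)%g => //; rewrite mulVKg.
- exact: mA.
move=> _ [y Ky <-]; split.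
  have [_ KM _] := sK i1; apply: KM => //.
  by apply: (leK p1 _ Ky); exact: leq_pred.
move=> Kxy; apply: (nK i2); have [_ KM KV] := sK p1.
by have := KM _ _ Kxy (KV _ Ky); rewrite mulgK.
Qed.

Lemma annulus_mass_ge1 i x : (2 <= i)%N -> level i x -> 1 <= annulus_mass i.
Proof.
move=> i2 lx; apply: le_trans (annulus_mass_ge i2 lx).
have p1 : (1 <= i.-1)%N by case: i i2 {lx} => // [[]].
rewrite -(_ : fine (mu (K 1%N)) = 1); last by rewrite hmu1.
rewrite fine_le//; first by rewrite ge0_fin_numE// fK.
  by rewrite ge0_fin_numE// fK.
by apply: le_mu; [exact: mK|exact: mK|exact: leK].
Qed.

Lemma level_value_mono i j x y : level i x -> level j y -> (i <= j)%N ->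
  level_value i <= level_value j.
Proof.
move=> lx ly; rewrite leq_eqVlt => /predU1P[->//|ij].
have [i1 _ _] := lx; have j2 : (2 <= j)%N by exact: leq_ltn_trans ij.
have mj1 := annulus_mass_ge1 j2 ly.
have aij : a i <= a j by apply: weight_sup_mono => //; exact: ltnW.
have a1 := weight_sup_ge1 i1.
rewrite /level_value [(j <= 1)%N]leqNgt j2 /=.
have [i_le1|i2] := leqP i 1.
  have iE : i = 1%N by apply/eqP; rewrite eqn_leq i_le1 i1.
  rewrite iE in aij; apply: (@le_trans _ _ ((a j + j%:R ^+ 2) * 1)).
    rewrite mulr1 lerD// expr2 -natrM ler1n muln_gt0 (ltnW j2)//.
  rewrite ler_wpM2l// addr_ge0 ?sqr_ge0// (le_trans ler01)//.
  exact/weight_sup_ge1/ltnW.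
apply: ler_pM.
- by rewrite addr_ge0 ?sqr_ge0// (le_trans ler01).
- exact: fine_ge0.
- by rewrite lerD// lerXn2r ?nnegrE// ler_nat ltnW.
apply: le_trans (annulus_mass_ge j2 ly); rewrite /annulus_mass fine_le//.
- exact: fA.
- by rewrite ge0_fin_numE// fK// -ltnS prednK// (ltnW j2).
apply: le_mu; [exact: mA|apply: mK|].
  by rewrite -ltnS prednK// (ltnW j2).
move=> z [Kz _]; apply: (leK i1 _ Kz).
by rewrite -ltnS prednK// (ltnW j2).
Qed.

Lemma level_value_ge1 i x : level i x -> 1 <= level_value i.
Proof.
move=> lx; have [i1 _ _] := lx; rewrite /level_value.
have [_|i2] := leqP i 1; first by rewrite lerDr (le_trans ler01)// weight_sup_ge1.
rewrite -[leLHS]mulr1 ler_pM// ?(annulus_mass_ge1 i2 lx)//.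
by rewrite (le_trans (weight_sup_ge1 i1))// lerDl sqr_ge0.
Qed.

Let part n (x : G) : R := \sum_(2 <= i < n) (a i + i%:R ^+ 2) *
    fine (mu (K i `\` K i.-1)) * \1_(K i `\` K i.-1) x.

Lemma partial_sumE i x n : level i x -> (i < n)%N ->
  part n x = if (i <= 1)%N then 0 else level_value i.
Proof.
move=> lx i_n; have [i1 Ki nK] := lx.
have other j : (2 <= j)%N -> j != i -> \1_(K j `\` K j.-1) x = 0 :> R.
  move=> j2 ji; rewrite indicE memNset// => -[Kj nKj].
  have p1 : (1 <= j.-1)%N by case: j j2 {ji Kj nKj} => // [[]].
  have ij := level_le lx (ltnW j2) Kj.
  apply: nKj; apply: (leK i1 _ Ki).
  by rewrite -ltnS prednK ?(ltnW j2)// ltn_neqAle eq_sym ji.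
rewrite /part; have [i_le1|i2] := leqP i 1.
  rewrite big_nat_cond big1// => j /andP[/andP[j2 _] _].
  rewrite other ?mulr0//; apply/eqP => ji; move: i_le1; rewrite -ji.
  by rewrite leqNgt j2.
rewrite (big_cat_nat (n := i))//=; last exact: ltnW.
rewrite big_nat_cond big1 ?add0r; last first.
  move=> j /andP[/andP[j2 ji] _]; rewrite other ?mulr0//.
  by rewrite ltn_eqF.
rewrite big_ltn// big_nat_cond big1 ?addr0; last first.
  move=> j /andP[/andP[ij _] _]; rewrite other ?mulr0//.
    exact: leq_trans (ltnW ij).
  by rewrite gtn_eqF.
rewrite /level_value [(i <= 1)%N]leqNgt i2 /= indicE mem_set ?mulr1//.
by split => //; exact: nK.
Qed.

Lemma partial_sum_cvg i x : level i x ->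
  part n x @[n --> \oo] --> if (i <= 1)%N then 0 else level_value i.
Proof.
move=> lx; apply: cvg_near_cst.
by exists i.+1 => // n /= i_n; exact: (partial_sumE lx).
Qed.

Lemma sharp_weightE i x : level i x -> W x = level_value i.
Proof.
move=> lx; have [i1 Ki nK] := lx.
rewrite /sharp_weight (cvg_lim _ (partial_sum_cvg lx))//.
have [i_le1|i2] := leqP i 1.
  have iE : i = 1%N by apply/eqP; rewrite eqn_leq i_le1 i1.
  by rewrite /level_value i_le1 addr0 indicE mem_set ?mulr1// -iE.
rewrite indicE memNset ?mulr0 ?add0r// => K1.
by have := level_le lx (leqnn 1) K1; rewrite leqNgt i2.
Qed.

(** If both points lie in the subgroup [K j], so does their product: its level is
    at most the larger of the two levels. *)
Lemma sharp_weight_max x y : W (x * y)%g <= Num.max (W x) (W y).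
Proof.
have [i lx] := level_exists x; have [j ly] := level_exists y.
have [k lxy] := level_exists (x * y)%g.
rewrite (sharp_weightE lx) (sharp_weightE ly) (sharp_weightE lxy) le_max.
have [i1 Ki _] := lx; have [j1 Kj _] := ly.
have [ij|ji] := leqP i j; apply/orP; [right|left].
  apply: (level_value_mono lxy ly); apply: (level_le lxy j1).
  by have [_ KM _] := sK j1; apply: KM => //; exact: (leK i1 ij).
apply: (level_value_mono lxy lx); apply: (level_le lxy i1).
by have [_ KM _] := sK i1; apply: KM => //; exact: (leK j1 (ltnW ji)).
Qed.

Lemma sharp_weight_ge1 x : 1 <= W x.
Proof.
by have [i lx] := level_exists x; rewrite (sharp_weightE lx) (level_value_ge1 lx).
Qed.

Lemma measurable_sharp_weight : measurable_fun [set: borel G] (W : borel G -> R).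
Proof.
apply: measurable_funD.
  by apply: measurable_funM => //; apply: measurable_indic; exact: mK.
apply: (@measurable_fun_cvg _ (borel G) _ _ (fun n (x : borel G) => part n x)).
  (* The truncation to [2 <= i] keeps out [K 1 `\` K 0], which may be
     nonmeasurable. *)
  move=> n; pose term i (x : borel G) : R := if (2 <= i)%N then
    (a i + i%:R ^+ 2) * annulus_mass i * \1_(K i `\` K i.-1) x else 0.
  rewrite (_ : (fun x : borel G => part n x) =
      fun x => \sum_(i <- index_iota 2 n) term i x).
    apply: measurable_sum => i; rewrite /term.
    have [i2|_] := boolP (2 <= i)%N; last exact: measurable_cst.
    by apply: measurable_funM => //; apply: measurable_indic; exact: mA.
  apply/funext => x; rewrite /part !big_nat; apply: eq_bigr => i /andP[i2 _].
  by rewrite /term i2.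
move=> x _; have [i lx] := level_exists x; apply/cvg_ex.
by exists (if (i <= 1)%N then 0 else level_value i); exact: partial_sum_cvg.
Qed.

Lemma compact_sub_decomposition C : compact C ->
  exists2 M, (1 <= M)%N & C `<=` K M.
Proof.
rewrite compact_cover => cC.
have [||D sD CD] := cC _ [set i | (1 <= i)%N] K.
- by move=> i; exact: oK.
- by rewrite /cover (sd_union hK).
exists (\max_(i <- enum_fset D) i).+1 => // x /CD [i /= Di Ki].
have i1 : (1 <= i)%N by have := sD _ Di; rewrite inE.
by apply: (leK i1 _ Ki); apply: leqW; exact: (@leq_bigmax_seq _ _ xpredT id).
Qed.

Lemma sharp_weight_weight : weight W.
Proof.
split.
- exact: measurable_sharp_weight.
- exact: sharp_weight_ge1.
- move=> C /compact_sub_decomposition[M M1 CM].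
  exists (\sum_(i < M.+1) `|level_value i|) => x /CM KM.
  have [i lx] := level_exists x; have iM := level_le lx M1 KM.
  rewrite (sharp_weightE lx) (bigD1 (Ordinal (iM : (i < M.+1)%N)))//=.
  by rewrite ler_wpDr ?ler_norm ?sumr_ge0.
- move=> x y; apply: (le_trans (sharp_weight_max x y)); rewrite ge_max.
  have Wx := sharp_weight_ge1 x; have Wy := sharp_weight_ge1 y.
  by rewrite ler_peMr ?(le_trans ler01)//= ler_peMl ?(le_trans ler01).
- move=> x; have [i lx] := level_exists x.
  by rewrite (sharp_weightE lx) (sharp_weightE (levelV lx)).
Qed.

Lemma sharp_weight_subadd x y : W (x * y)%g <= W x + W y.
Proof.
apply: (le_trans (sharp_weight_max x y)); rewrite ge_max.
by rewrite lerDl lerDr !(le_trans ler01 (sharp_weight_ge1 _)).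
Qed.

Local Open Scope ereal_scope.

Let V (x : borel G) : \bar R := ((W x)^-1)%:E.

Let V_ge0 x : 0 <= V x.
Proof. by rewrite lee_fin invr_ge0 (le_trans ler01 (sharp_weight_ge1 _)). Qed.

Let measurable_V D : measurable_fun D V.
Proof.
apply: (measurable_funS measurableT (@subsetT _ _)).
apply/measurable_EFinP.
have -> : (fun x : borel G => (W x)^-1)%R = (fun x => ((W x : R)^-1)%R) by [].
apply: (measurable_inv_ge0 measurable_sharp_weight) => x.
exact: le_trans ler01 (sharp_weight_ge1 _).
Qed.

(** [W] is constant on the annulus, and its factor [annulus_mass] cancels.  What is
    left is [(a_(n+1) + (n+1)^2)^-1], which is below [1 / (n (n + 1))], a
    telescoping difference. *)
Lemma integral_annulus n : (1 <= n)%N ->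
  \int[mu]_(x in (K n.+1 `\` K n : set (borel G))) V x
    <= (n%:R^-1 - n.+1%:R^-1)%:E.
Proof.
move=> n1; rewrite (eq_integral (cst ((level_value n.+1)^-1)%:E)); last first.
  move=> x; rewrite inE => -[Kx nKx].
  by rewrite /V (@sharp_weightE n.+1).
rewrite integral_cst; last exact: (@mA n.+1).
rewrite -(@fineK _ (mu _)); last exact: (@fA n.+1).
rewrite -EFinM lee_fin -/(annulus_mass n.+1) /level_value ltnNge n1 /=.
have n0 : (0 < n%:R :> R)%R by rewrite ltr0n.
have a0 : (1 <= a n.+1)%R by exact: weight_sup_ge1.
set m := annulus_mass n.+1; set b := (a n.+1 + _)%R.
have b0 : (n%:R * n.+1%:R <= b)%R.
  by rewrite /b -natr1; move: a0 n0; nra.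
have n1E : (n%:R^-1 - n.+1%:R^-1 = (n%:R * n.+1%:R)^-1 :> R)%R.
  by rewrite -natr1; field; rewrite natr1 !gt_eqF// ltr0n.
have nn0 : (0 < n%:R * n.+1%:R :> R)%R by rewrite mulr_gt0// ltr0n.
rewrite n1E; have [->|m0] := eqVneq m 0%R; first by rewrite !mulr0 invr_ge0 ltW.
by rewrite invfM mulfVK// lef_pV2// posrE// (lt_le_trans nn0).
Qed.

Lemma integral_exhaustion n : (1 <= n)%N ->
  \int[mu]_(x in (K n : set (borel G))) V x <= (2 - n%:R^-1)%:E.
Proof.
elim: n => // -[_ _|n IH _].
  rewrite invr1 (_ : 2 - 1 = 1)%R; last by ring.
  apply: (@le_trans _ _ (\int[mu]_(x in (K 1%N : set (borel G))) cst 1%:E x)).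
    apply: ge0_le_integral; [by apply: mK|by []|by apply: measurable_V|..].
    - by apply: measurable_cst.
    move=> x _; rewrite lee_fin invf_le1 ?sharp_weight_ge1//.
    exact: lt_le_trans ltr01 (sharp_weight_ge1 _).
  by rewrite integral_cst ?mul1e ?hmu1//; exact: mK.
have -> : K n.+2 = K n.+1 `|` (K n.+2 `\` K n.+1).
  by rewrite setDUK//; exact: leK.
rewrite ge0_integral_setU//; [|exact: mK|exact: (@mA n.+2)|]; last first.
  by apply/disj_set2P; rewrite setDIK.
apply: (le_trans (leeD (IH isT) (@integral_annulus n.+1 isT))).
by rewrite -EFinD lee_fin addrA subrK.
Qed.

Lemma sharp_weight_integrable : \int[mu]_(x in [set: borel G]) V x < +oo.
Proof.
apply: (@le_lt_trans _ _ 2%:E); last exact: ltry.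
apply: (@fatou_bound _ _ _ mu (fun k => V \_ (K k.+1)) V) => //.
- by move=> k; apply/(measurable_restrictT _ (@mK k.+1 isT)).
- by move=> k x; rewrite /patch; case: ifP.
- apply: (@aeW _ (borel G)) => x; have [i lx] := level_exists x.
  apply: cvg_near_cst; exists i => // k /= ik; have [i1 Ki _] := lx.
  by rewrite patchE mem_set//; apply: (leK i1 _ Ki); exact: leqW.
- move=> k; rewrite -integral_mkcond.
  apply: (le_trans (@integral_exhaustion k.+1 isT)).
  by rewrite lee_fin lerBlDr lerDl invr_ge0.
Qed.

End SharpWeight.

Theorem corollary3p6 (R : realType) (G : topologicalGroupType)
    (K : nat -> set G) (Phi Psi : R -> \bar R) (w : G -> R)
    (mu : {measure set (borel G) -> \bar R})
    (hG : locally_elliptic G) (hK : standard_decomposition K)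
    (hPhi : complementary_pair Phi Psi) (hw : weight w)
    (hmu : haar_measure mu) (hmu1 : mu (K 1%N) = 1%E) :
  lphi_weight mu Phi Psi (sharp_weight mu K w).
Proof.
exact: (integrable_inverse_lphi_weight (standard_exhaustion hG hK hmu hmu1) hPhi
  (sharp_weight_weight hG hK hw hmu hmu1) (sharp_weight_subadd hG hK hw hmu hmu1)
  (sharp_weight_integrable hG hK hw hmu hmu1)).
Qed.
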